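(* Let $\rho : G \to O(V)$ be an orthogonal representation of a finite group $G$ on a real finite-dimensional Euclidean vector space $V$. Let $V = V_1 \oplus \cdots \oplus V_l$ be the decomposition into irreducible subrepresentations, and for each $i$ let $v_i \in V_i \setminus \{0\}$ be chosen such that the cardinality of the isotropy group $G_{v_i}$ is maximal (among vectors in $V_i\setminus\{0\}$). Then $\rho$ has property $(\mathcal{B}_k)$ with $k = \max\{d(\rho),\ |G|/|G_{v_i}| : 1 \le i \le l\}$.
   Context: Let $\mathbb{R}[V]^G$ be the (finitely generated) algebra of $G$-invariant real polynomials on $V$, let $\sigma_1,\ldots,\sigma_n$ be homogeneous generators of positive degree, and $\sigma=(\sigma_1,\ldots,\sigma_n):V\to\mathbb{R}^n$ the orbit map; $V/G$ is identified with $\sigma(V)\subseteq\mathbb{R}^n$ via the homeomorphism induced by $\sigma$. A curve in $V/G$ is of class $C^k$ if it is $C^k$ as a curve in $\mathbb{R}^n$ (this does not depend on the choice of generators). A lift of a curve $c$ in $\sigma(V)$ is a curve $\bar c$ in $V$ with $\sigma\circ\bar c=c$; a local lift near $t_0$ is a lift of the restriction of $c$ to an open neighborhood of $t_0$. A differentiable lift has locally bounded derivative if $\|\bar c'\|$ is bounded on compact subsets of its domain. $\rho$ has property $(\mathcal{B}_k)$ if there exists a neighborhood $U$ of $0$ in $V/G=\sigma(V)$ such that each $C^k$-curve in $U$ admits (near each parameter value) a local differentiable lift to $V$ with locally bounded derivative. $d(\rho)$ is the maximum of the degrees of the elements of a minimal system of homogeneous generators of positive degree of $\mathbb{R}[V]^G$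 (independent of the choice of minimal system). $G_v$ is the isotropy group of $v$. *)

(* Defs.v *)
From HB Require Import structures.
From mathcomp Require Import all_boot all_order all_algebra all_fingroup.
From mathcomp Require Import all_character.
(* The notations of mpoly clash with those of mathcomp-analysis: {mpoly R[n]}
   is written mpoly n R, p.@[v] is meval v p, and q \mPo s is comp_mpoly s q. *)
From mathcomp Require Import -(notations) mpoly.
From mathcomp Require Import all_classical all_reals all_analysis.
Import numFieldNormedType.Exports.

Set Implicit Arguments.
Unset Strict Implicit.
Unset Printing Implicit Defensive.

Import Order.TTheory GRing.Theory Num.Theory.
Local Open Scope classical_set_scope.
Local Open Scope ring_scope.

(* The Euclidean space V is 'rV[R]_m with its standard inner product (that is,
   V together with an orthonormal basis). As usual for mx_representation, g
   acts on the row vector v by v *m rG g. *)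

Section Invariants.
Variables (R : realType) (gT : finGroupType) (G : {group gT}) (m : nat).
Variable rG : mx_representation R G m.

Definition orthogonal_repr : Prop :=
  forall g, g \in G -> rG g *m (rG g)^T = 1%:M.

Definition invariant_poly (p : mpoly m R) : Prop :=
  forall g, g \in G -> forall v : 'rV[R]_m,
    meval ((v *m rG g) 0) p = meval (v 0) p.

Definition generates_invariants (s : seq (mpoly m R)) : Prop :=
  forall p, invariant_poly p ->
    exists q : mpoly (size s) R, p = comp_mpoly (in_tuple s) q.

(* mmeasure mdeg p (written msize p in mpoly) is one more than the degree of p
   when p != 0, and is 0 when p = 0. *)
Definition pdeg (p : mpoly m R) : nat := (mmeasure mdeg p).-1.

Definition homogeneous_generators (s : seq (mpoly m R)) : Prop :=
  [/\ forall p, p \in s -> invariant_poly p,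
      forall p, p \in s -> (0 < pdeg p)%N /\ p \is ishomog1 (pdeg p) mdeg
    & generates_invariants s].

Definition minimal_homogeneous_generators (s : seq (mpoly m R)) : Prop :=
  homogeneous_generators s /\
  forall s', subseq s' s -> homogeneous_generators s' -> s' = s.

(* d = d(rho); the degree does not depend on the minimal system. *)
Definition is_max_generator_degree (d : nat) : Prop :=
  exists s, minimal_homogeneous_generators s /\ d = \max_(p <- s) pdeg p.

End Invariants.

Definition orbit_map (R : realType) (m : nat) (s : seq (mpoly m R))
    (v : 'rV[R]_m) : 'rV[R]_(size s) :=
  \row_i meval (v 0) (tnth (in_tuple s) i).

Definition euclidean_norm (R : realType) (m : nat) (v : 'rV[R]_m) : R :=
  Num.sqrt (\sum_j v 0 j ^+ 2).

(* Curves defined on an open set I are represented by total functions on R; as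
   I is open, continuity and derivability at the points of I only depend on the
   values on I. *)
Definition class_C (R : realType) (n k : nat) (I : set R)
    (c : R -> 'rV[R]_n) : Prop :=
  (forall i, (i < k)%N -> forall t, I t -> derivable (derive1n i c) t 1) /\
  (forall t, I t -> {for t, continuous (derive1n k c)}).

Definition differentiable_on (R : realType) (m : nat) (J : set R)
    (b : R -> 'rV[R]_m) : Prop :=
  forall t, J t -> derivable b t 1.

Definition locally_bounded_derivative (R : realType) (m : nat) (J : set R)
    (b : R -> 'rV[R]_m) : Prop :=
  forall K, compact K -> K `<=` J ->
    exists M, forall t, K t -> euclidean_norm (derive1 b t) <= M.

Definition lift_on (R : realType) (m : nat) (s : seq (mpoly m R)) (J : set R)
    (c : R -> 'rV[R]_(size s)) (b : R -> 'rV[R]_m) : Prop :=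
  forall t, J t -> orbit_map s (b t) = c t.

(* Property (B_k) of the representation whose orbit map is orbit_map s; the
   quotient V/G is range (orbit_map s) with the subspace topology. *)
Definition property_B (R : realType) (m : nat) (s : seq (mpoly m R))
    (k : nat) : Prop :=
  exists U : set 'rV[R]_(size s),
    [/\ U `<=` range (orbit_map s),
        within (range (orbit_map s)) (nbhs (0 : 'rV[R]_(size s))) U
      & forall (I : set R) (c : R -> 'rV[R]_(size s)),
          open I -> is_interval I -> (forall t, I t -> U (c t)) ->
          class_C k I c ->
          forall t0, I t0 ->
            exists (J : set R) (b : R -> 'rV[R]_m),
              [/\ open J, J t0 /\ J `<=` I, lift_on J c b,
                  differentiable_on J b & locally_bounded_derivative J b]].

(* Main.v *)
Require Import Defs.
From HB Require Import structures.
From mathcomp Require Import all_boot all_order all_algebra all_fingroup.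
From mathcomp Require Import all_character.
From mathcomp Require Import -(notations) mpoly.
From mathcomp Require Import all_classical all_reals all_analysis.
From mathcomp Require Import ring lra zify.
Import numFieldNormedType.Exports.

Set Implicit Arguments.
Unset Strict Implicit.
Unset Printing Implicit Defensive.

Import Order.TTheory GRing.Theory Num.Theory.
Local Open Scope ring_scope.

(** Let c be a curve of class C^k in the image of the orbit map. As
    sigma generates the invariants, an invariant polynomial takes at the lifts
    of c(t) the value of a fixed polynomial at c(t). It thus becomes a function
    of t with Taylor expansions of order k whose constants are uniform on
    compact sets. The whole image of the orbit map serves as the neighborhood
    U.

    Lifts move with bounded speed. For a vector u, the product of the factors
    X - <x, u g> over the orbit of u has invariant coefficients, degree equal
    to the index of the isotropy group of u, and only real roots. Bronshtein's
    theorem says that the roots of real-rooted monic polynomials of degree n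
    with C^n coefficients are locally Lipschitz. Here n <= k when u is one of
    the v_i, whose orbits span V because the V_i are irreducible, so the root
    estimates bound the displacement of the lift itself ([lift_lipschitz]).

    Bronshtein's theorem is proved by rescaling. When the m-th coefficient is
    bounded below, the scale r is the largest of the numbers |a_j|^(1/(m-j)),
    j < m, formed with the lower coefficients. Up to sign, the coefficients of
    p(X) p(-X) are nonnegative and log-concave for a real-rooted p. A
    nonnegative function that is O(r^2) at 0 and has bounded second derivative
    on a neighborhood of 0 stays O(r^2) for |t| <= r; applied to one of these coefficients this shows
    that all lower coefficients of p keep the size dictated by r, and hence
    that their Taylor coefficients do ([taylor_coef_bound]). After the
    rescaling (t, X) -> (r t, r X) the data are again bounded and some lower
    coefficient has absolute value 1, so that induction on m applies
    ([multiplicity_bound]).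

    Difference quotients of lifts at x0 are thus bounded and have cluster
    values. Two cluster values w, w' differ by an element of the isotropy
    group of x0 ([cluster_tangent_orbit]). To see this, expand the generators
    of degree at most d(rho) <= k at x0. Averaged over the isotropy group,
    each homogeneous part is the leading part at x0 of an invariant polynomial
    of all of G ([invariant_interpolation]), and the value of such a leading
    part at a cluster value is a Taylor coefficient of a function of t.
    Therefore the generators agree at x0 + s w and x0 + s w' for every s.
    These points lie in one orbit, and some g in G serves for two different
    values of s; it fixes x0 and maps w to w'.

    Consequently the 1-jet (x, w) of the lifts at a parameter is determined up
    to G ([lift_jet]). As its orbit is finite, a differentiable lift on one
    side of a parameter has a one-sided limit and derivative there
    ([onesided_jet]), and lifts on both sides can be matched by an element of
    G ([patch]). Zorn's lemma extends local differentiable lifts to open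
    intervals ([glue_interval]). Local lifts are obtained by induction on the
    order of the isotropy group H of a point x0 over t0: near t0 the isotropy
    groups are smaller except on a closed set E, where the lift near x0 is
    fixed by H. At accumulation points of E the 1-jet is fixed by H too, so
    every lift that stays near x0 is differentiable there; isolated points of
    E are crossed by patching ([local_step]). *)

(** * Coefficients of real-rooted polynomials *)

Section RealRooted.
Variable R : realFieldType.
Implicit Types (c x : R) (rs : seq R).

Definition rooted_poly c rs : {poly R} := c *: \prod_(x <- rs) ('X - x%:P).
(** Up to signs these are the coefficients of p(X) p(-X) for p = [rooted_poly c rs]
    ([squared_polyE]), hence quadratic expressions in the coefficients of p. They
    are nonnegative and log-concave because the roots are real, and they dominate
    the squares of the coefficients of p. *)
Definition squared_poly c rs : {poly R} :=
  c ^+ 2 *: \prod_(x <- rs) ('X + (x ^+ 2)%:P).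

Lemma coef_rooted_nil c j : (rooted_poly c [::])`_j = if j is 0 then c else 0.
Proof. by rewrite /rooted_poly big_nil coefZ coef1; case: j => [|j] /=; rewrite ?mulr1 ?mulr0. Qed.

Lemma coef_rooted_cons c x rs j : (rooted_poly c (x :: rs))`_j =
  (if j is j'.+1 then (rooted_poly c rs)`_j' else 0) - x * (rooted_poly c rs)`_j.
Proof.
rewrite /rooted_poly big_cons mulrBl scalerBr coefB !coefZ coefXM mul_polyC coefZ.
by case: j => [|j] /=; rewrite ?coefZ; ring.
Qed.

Lemma coef_squared_nil c j :
  (squared_poly c [::])`_j = if j is 0 then c ^+ 2 else 0.
Proof. by rewrite /squared_poly big_nil coefZ coef1; case: j => [|j] /=; rewrite ?mulr1 ?mulr0. Qed.

Lemma coef_squared_cons c x rs j : (squared_poly c (x :: rs))`_j =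
  (if j is j'.+1 then (squared_poly c rs)`_j' else 0)
    + x ^+ 2 * (squared_poly c rs)`_j.
Proof.
rewrite /squared_poly big_cons mulrDl scalerDr coefD !coefZ coefXM mul_polyC coefZ.
by case: j => [|j] /=; rewrite ?coefZ; ring.
Qed.

Lemma squared_poly_ge0 c rs j : 0 <= (squared_poly c rs)`_j.
Proof.
elim: rs j => [|x rs IH] j.
  by rewrite coef_squared_nil; case: j => //; rewrite sqr_ge0.
rewrite coef_squared_cons; apply: addr_ge0; first by case: j.
by apply: mulr_ge0; rewrite ?sqr_ge0.
Qed.

(** The Cauchy-Schwarz inequality for elementary symmetric functions, with a
    crude constant that is multiplied by 2 with each root. *)
Lemma rooted_poly_le c rs j :
  (rooted_poly c rs)`_j ^+ 2 <= 2 ^+ size rs * (squared_poly c rs)`_j.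
Proof.
elim: rs j => [|x rs IH] j.
  rewrite coef_rooted_nil coef_squared_nil mul1r.
  by case: j; rewrite ?expr0n.
rewrite coef_rooted_cons coef_squared_cons /= (exprS 2).
move: (2 ^+ size rs) IH => C IH.
have Hx : x ^+ 2 * (rooted_poly c rs)`_j ^+ 2
  <= x ^+ 2 * (C * (squared_poly c rs)`_j).
  by rewrite ler_wpM2l ?sqr_ge0.
have Hx0 := sqr_ge0 (x * (rooted_poly c rs)`_j).
case: j Hx Hx0 => [|j] /= Hx Hx0; first by lra.
have H1 := IH j.
have H2 := sqr_ge0 ((rooted_poly c rs)`_j + x * (rooted_poly c rs)`_j.+1).
lra.
Qed.

(** Newton's inequalities in the form that passes to a further factor X + u with
    u >= 0: indices a <= b that are not adjacent are needed to treat the cross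
    terms. *)
Lemma squared_poly_logconcave c rs a b : (a <= b)%N ->
  (squared_poly c rs)`_a * (squared_poly c rs)`_b.+1 <=
  (squared_poly c rs)`_a.+1 * (squared_poly c rs)`_b.
Proof.
elim: rs a b => [|x rs IH] a b leab.
  by rewrite !coef_squared_nil mulr0 mul0r.
move: leab; rewrite leq_eqVlt => /orP[/eqP-> |ltab]; first by rewrite mulrC.
rewrite !coef_squared_cons.
have := squared_poly_ge0 c rs; set q := squared_poly c rs in IH * => q0.
move: (x ^+ 2) (sqr_ge0 x) => u u0.
case: a b ltab => [|a] [|b] //= ltab.
  have H := IH 0 b.+1 isT.
  have := mulr_ge0 (sqr_ge0 u) (_ : 0 <= q`_1 * q`_b.+1 - q`_0 * q`_b.+2).
  rewrite subr_ge0 => /(_ H).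
  have := mulr_ge0 (q0 0) (q0 b); have := mulr_ge0 u0 (mulr_ge0 (q0 1) (q0 b)).
  by move=> *; lra.
have H1 := IH a b (ltnW ltab).
have H2 := IH a.+1 b.+1 (ltnW ltab).
have H3 := IH a b.+1 (leq_trans (ltnW ltab) (leqnSn _)).
have H4 := IH a.+1 b ltab.
have := mulr_ge0 (sqr_ge0 u) (_ : 0 <= q`_a.+2 * q`_b.+1 - q`_a.+1 * q`_b.+2).
rewrite subr_ge0 => /(_ H2).
have := mulr_ge0 u0 (_ : 0 <= q`_a.+2 * q`_b - q`_a * q`_b.+2).
rewrite subr_ge0 => /(_ (le_trans H3 H4)).
by move=> *; lra.
Qed.

Lemma squared_polyE c rs j :
  (squared_poly c rs)`_j = (-1) ^+ j *
  \sum_(i < j.*2.+1) (-1) ^+ i * (rooted_poly c rs)`_i * (rooted_poly c rs)`_(j.*2 - i).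
Proof.
pose pm s := c *: \prod_(x <- s) (- 'X - x%:P).
have pmE s i : (pm s)`_i = (-1) ^+ i * (rooted_poly c s)`_i.
  rewrite /pm; elim: s i => [|x s IH] i.
    by rewrite big_nil coef_rooted_nil coefZ coef1; case: i => [|i]; rewrite ?expr0 ?mul1r ?mulr1 ?mulr0.
  rewrite coef_rooted_cons big_cons mulrBl mulNr mul_polyC coefZ coefB coefN coefXM coefZ.
  have := IH i.-1; have := IH i; rewrite !coefZ mulrBr mulrN [c * (x * _)]mulrCA => -> Hi1.
  by case: i Hi1 => [|i] /= => [_|->]; rewrite ?exprS /rooted_poly ?coefZ; ring.
pose q s := c ^+ 2 *: \prod_(x <- s) ((x ^+ 2)%:P - 'X).
have qE s i : (q s)`_i = (-1) ^+ i * (squared_poly c s)`_i.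
  rewrite /q; elim: s i => [|x s IH] i.
    by rewrite big_nil coef_squared_nil coefZ coef1; case: i => [|i]; rewrite ?expr0 ?mul1r ?mulr1 ?mulr0.
  rewrite coef_squared_cons big_cons mulrBl mul_polyC coefZ coefB coefXM coefZ.
  have := IH i.-1; have := IH i; rewrite !coefZ mulrBr [_ * (x ^+ 2 * _)]mulrCA => -> Hi1.
  by case: i Hi1 => [|i] /= => [_|->]; rewrite ?exprS /squared_poly ?coefZ; ring.
have E : rooted_poly c rs * pm rs = q rs \Po 'X^2.
  rewrite /rooted_poly /pm /q -scalerAl -scalerAr scalerA comp_polyZ expr2.
  congr (_ *: _); rewrite rmorph_prod /= -big_split /=.
  apply: eq_bigr => x _; rewrite comp_polyB comp_polyC comp_polyX expr2 polyCM; ring.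
have : (q rs \Po 'X^2)`_(j.*2) = (q rs)`_j.
  by rewrite coef_comp_poly_Xn // -muln2 dvdn_mull // mulnK.
rewrite -E coefM qE => Hq.
rewrite -[LHS](signrMK j) -Hq.
congr (_ * _); apply: eq_bigr => i _; rewrite pmE.
have -> : (-1) ^+ (j.*2 - i) = (-1) ^+ i :> R.
  rewrite -signr_odd oddB; last by rewrite -ltnS.
  by rewrite odd_double /= signr_odd.
ring.
Qed.

Lemma rooted_poly_scale c rs (k r : R) : r != 0 ->
  exists c' rs', size rs' = size rs /\
  forall j, (rooted_poly c' rs')`_j = k * r ^+ j * (rooted_poly c rs)`_j.
Proof.
move=> r0; exists (k * c * r ^+ size rs), [seq x / r | x <- rs]; split; first by rewrite size_map.
elim: rs => [|x rs IH] j.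
  by rewrite !coef_rooted_nil; case: j => [|j] /=; rewrite ?mulr0 // expr0 !mulr1.
have E : forall d i, (rooted_poly (d * r ^+ (size rs).+1) [seq x0 / r | x0 <- rs])`_i
   = r * (rooted_poly (d * r ^+ (size rs)) [seq x0 / r | x0 <- rs])`_i.
  by move=> d i; rewrite /rooted_poly !coefZ exprS; ring.
rewrite /= !coef_rooted_cons !E !IH.
by case: j => [|j] /=; rewrite ?E ?IH ?exprS; field.
Qed.
End RealRooted.

(** * Bronshtein's estimate by rescaling *)

Section CoefBound.
Variable R : realFieldType.

(** Replacing T(t) by 2^L T(t / 2) - T(t) removes the coefficient of degree L and
    multiplies the others by at least 1, which allows an induction on L. *)
Lemma poly_coef_bound (L : nat) : exists2 C : R, 0 <= C &
  forall (a : nat -> R) (B : R),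
    (forall t : R, `|t| <= 1 -> `|\sum_(i < L) a i * t ^+ i| <= B) ->
    forall i, (i < L)%N -> `|a i| <= C * B.
Proof.
elim: L => [|L [C C0 IH]]; first by exists 0.
have B0 (a : nat -> R) (B : R) : (forall t : R, `|t| <= 1 -> `|\sum_(i < L.+1) a i * t ^+ i| <= B) -> 0 <= B.
  by move=> H; apply: le_trans (H 0 _); rewrite ?normr0 ?ler01.
pose D := C * (2 ^+ L + 1).
have D0 : 0 <= D by rewrite mulr_ge0 // addr_ge0 // exprn_ge0.
exists (1 + D *+ L.+1) => [|a B H]; first by rewrite addr_ge0 // mulrn_wge0.
have Bge := B0 _ _ H.
have low i : (i < L)%N -> `|a i| <= D * B.
  move=> iL.
  pose b j := (2 ^+ L / 2 ^+ j - 1) * a j.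
  have Hb (t : R) : `|t| <= 1 -> `|\sum_(j < L) b j * t ^+ j| <= (2 ^+ L + 1) * B.
    move=> t1.
    have -> : \sum_(j < L) b j * t ^+ j = 2 ^+ L * (\sum_(j < L.+1) a j * (t / 2) ^+ j) - \sum_(j < L.+1) a j * t ^+ j.
      rewrite !big_ord_recr /= mulrDr mulr_sumr.
      have -> : 2 ^+ L * (a L * (t / 2) ^+ L) = a L * t ^+ L.
        by rewrite expr_div_n; field; rewrite expf_neq0 // pnatr_eq0.
      rewrite opprD addrACA addrN addr0 -sumrB; apply: eq_bigr => j _.
      by rewrite /b expr_div_n; field; rewrite expf_neq0 // pnatr_eq0.
    apply: le_trans (ler_normB _ _) _.
    rewrite mulrDl mul1r lerD ?H // normrM ger0_norm ?exprn_ge0 //.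
    rewrite ler_wpM2l ?exprn_ge0 // H // normrM normfV normr_nat.
    by have := normr_ge0 t; lra.
  have := IH b _ Hb i iL; rewrite mulrA -/D; apply: le_trans.
  rewrite /b normrM ler_peMl //.
  have -> : 2 ^+ L / 2 ^+ i = 2 ^+ (L - i) :> R.
    by rewrite -{1}(subnK (ltnW iL)) exprD mulfK // expf_neq0 // pnatr_eq0.
  have : 2 <= 2 ^+ (L - i) :> R.
    by rewrite -{1}(expr1 2) ler_weXn2l ?subn_gt0 ?ler1n.
  by move=> h; rewrite ger0_norm; lra.
move=> i; rewrite ltnS leq_eqVlt => /orP[/eqP->|iL]; last first.
  apply: le_trans (low i iL) _; rewrite ler_wpM2r // mulrS.
  by have := mulrn_wge0 L D0; lra.
have := H 1; rewrite normr1 big_ord_recr /= expr1n mulr1 => /(_ (lexx _)) H1.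
have H2 : `|\sum_(j < L) a j * 1 ^+ j| <= D * B *+ L.
  apply: le_trans (ler_norm_sum _ _ _) _.
  apply: le_trans (ler_sum _ _) _ => [j _|]; first by rewrite expr1n mulr1; apply: low.
  by rewrite sumr_const card_ord.
rewrite -[a L](addrK (\sum_(j < L) a j * 1 ^+ j)) [a L + _]addrC.
apply: le_trans (ler_normB _ _) _.
apply: le_trans (lerD H1 H2) _.
rewrite mulrDl mul1r lerD2l mulrnAl.
by rewrite ler_wpMn2l // mulr_ge0.
Qed.
End CoefBound.

Section Family.
Variable R : rcfType.
Implicit Types (f : R -> nat -> R) (A : nat -> nat -> R) (e M r t : R).

(** A real-rooted polynomial of degree at most n that depends on t: [f t j] is its
    coefficient of X^j, and [A j i] is the i-th Taylor coefficient of [f^~ j] at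
    t = 0. Only the expansion at 0 is recorded, because the estimates are
    pointwise. The polynomial need not be monic, so that the notion is stable
    under the rescaling of t and X. *)
Definition taylor_family (n N : nat) e M f A : Prop :=
  [/\ forall t, `|t| <= e -> exists c rs,
        (size rs <= n)%N /\ forall j, f t j = (rooted_poly c rs)`_j,
      forall j i, `|A j i| <= M
    & forall t j, `|t| <= e ->
        `|f t j - \sum_(i < N.+1) A j i * t ^+ i| <= M * `|t| ^+ N].

Lemma taylor_truncate n N e M f A L t j : e <= 1 -> 1 <= M ->
  taylor_family n N e M f A -> (L <= N)%N -> `|t| <= e ->
  `|f t j - \sum_(i < L) A j i * t ^+ i| <= M * N.+2%:R * `|t| ^+ L.
Proof.
move=> e1 M1 [_ HA Hf] LN te.
have t1 : `|t| <= 1 by apply: le_trans te e1.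
have tp i : (L <= i)%N -> `|t| ^+ i <= `|t| ^+ L.
  by move=> Li; apply: ler_wiXn2l.
have M0 : 0 <= M by apply: le_trans ler01 M1.
rewrite -(subnKC (leqW LN)) in Hf.
have := Hf t j te; rewrite big_split_ord /= opprD addrA.
set a := f t j - _ => H.
rewrite -[a](subrK (\sum_(i < N.+1 - L) A j (L + i)%N * t ^+ (L + i))).
apply: le_trans (ler_normD _ _) _.
rewrite -[N.+2]addn1 natrD mulrDr mulrDl mulr1 addrC lerD //; last first.
  by apply: le_trans H _; rewrite ler_wpM2l // tp.
apply: le_trans (ler_norm_sum _ _ _) _.
have : \sum_(i < N.+1 - L) `|A j (L + i)%N * t ^+ (L + i)| <= \sum_(i < N.+1 - L) M * `|t| ^+ L.
  apply: ler_sum => i _; rewrite normrM normrX ler_pM ?exprn_ge0 //.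
  by rewrite tp // leq_addr.
move=> /le_trans-> //; rewrite sumr_const card_ord -[_ *+ (N.+1 - L)]mulr_natr mulrAC.
rewrite ler_wpM2r ?exprn_ge0 // ler_wpM2l // ler_nat.
exact: leq_subr.
Qed.

(** The terms that are linear in t cancel in the sum over t and -t. So a
    nonnegative quadratic expression in such functions is bounded at t by its
    size at 0 and by t^2, although its derivative at 0 is not assumed small. *)
Lemma symmetric_product_bound (D t x y a b x' y' a' b' : R) :
  `|t| <= 1 -> `|a| <= D -> `|b| <= D -> `|a'| <= D -> `|b'| <= D -> `|x'| <= D -> `|y'| <= D ->
  `|x - (a + b * t)| <= D * `|t| ^+ 2 -> `|y - (a - b * t)| <= D * `|t| ^+ 2 ->
  `|x' - (a' + b' * t)| <= D * `|t| ^+ 2 -> `|y' - (a' - b' * t)| <= D * `|t| ^+ 2 ->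
  `|x * x' + y * y'| <= 2 * `|a * a'| + 8 * D ^+ 2 * t ^+ 2.
Proof.
move=> t1 aD bD a'D b'D x'D y'D.
rewrite real_normK ?num_real //.
set u := x - _; set v := y - _; set u' := x' - _; set v' := y' - _ => Hu Hv Hu' Hv'.
have -> : x * x' + y * y' = 2 * (a * a') + (2 * (b * b') * t ^+ 2 + ((a + b * t) * u' + (a - b * t) * v' + u * x' + v * y')).
  by rewrite /u /v /u' /v'; ring.
have D0 : 0 <= D by apply: le_trans aD.
have t20 := sqr_ge0 t.
have Hbt : `|b * t| <= D by rewrite normrM -[D]mulr1 ler_pM.
have H1 : `|(a + b * t) * u'| <= (D + D) * (D * t ^+ 2).
  rewrite normrM ler_pM //; apply: le_trans (ler_normD _ _) _; exact: lerD.
have H2 : `|(a - b * t) * v'| <= (D + D) * (D * t ^+ 2).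
  rewrite normrM ler_pM //; apply: le_trans (ler_normB _ _) _; exact: lerD.
have H3 : `|u * x'| <= D * t ^+ 2 * D by rewrite normrM ler_pM.
have H4 : `|v * y'| <= D * t ^+ 2 * D by rewrite normrM ler_pM.
have H5 : `|2 * (b * b') * t ^+ 2| <= 2 * (D * D) * t ^+ 2.
  rewrite normrM [`|t ^+ 2|]ger0_norm // ler_wpM2r // normrM normr_nat.
  by rewrite ler_wpM2l // normrM ler_pM.
apply: le_trans (ler_normD _ _) _.
rewrite [`|2 * _|]normrM normr_nat lerD2l.
apply: le_trans (ler_normD _ _) _.
have : 8 * D ^+ 2 * t ^+ 2 = 2 * (D * D) * t ^+ 2 + ((D + D) * (D * t ^+ 2) + (D + D) * (D * t ^+ 2) + D * t ^+ 2 * D + D * t ^+ 2 * D) by ring.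
move=> ->; apply: lerD => //.
do 3 (apply: le_trans (ler_normD _ _) _; apply: lerD => //).
Qed.

(** The coefficient q_(m-1) of the squared polynomial is nonnegative, O(r^2) at
    t = 0, and hence O(r^2) for |t| <= r by [symmetric_product_bound]. As q_m is
    bounded below, log-concavity gives q_(m-i) = O(r^(2 i)), and q_j dominates
    the square of the j-th coefficient. *)
Lemma family_value_bound n N e M m : 0 < e -> e <= 1 -> 1 <= M -> (m <= N)%N ->
  exists C r0, [/\ 0 <= C, 0 < r0, r0 <= e &
  forall f A, taylor_family n N e M f A -> 1 <= M * `|A m 0%N| ->
  forall r, 0 < r -> r <= r0 -> (forall j, (j < m)%N -> `|A j 0%N| <= r ^+ (m - j)) ->
  forall t j, `|t| <= r -> (j < m)%N -> `|f t j| <= C * r ^+ (m - j)].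
Proof.
move=> e0 e1 M1 mN.
have M0 : 0 < M by apply: lt_le_trans M1.
pose D := M * N.+2%:R.
have D1 : 1 <= D by rewrite mulr_ege1 // ler1n.
have MD : M <= D by rewrite /D ler_peMr ?(ltW M0) // ler1n.
have D0 : 0 < D by apply: lt_le_trans D1.
case: (posnP m) => [->|m0].
  by exists 0, e; split.
pose kap : R := (2 ^+ n)^-1 / (4 * M ^+ 2).
have kap0 : 0 < kap.
  by rewrite /kap mulr_gt0 ?invr_gt0 ?exprn_gt0 // mulr_gt0 // exprn_gt0.
pose K1 : R := (m.-1.*2.+1)%:R * (2 * D + 8 * D ^+ 2).
have K10 : 0 < K1.
  by rewrite mulr_gt0 ?ltr0n // addr_gt0 // mulr_gt0 // exprn_gt0.
pose C2 := K1 / kap; have C20 : 0 < C2 by rewrite divr_gt0.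
pose C3 := 1 + C2 + 2 ^+ n * kap.
have C31 : 1 <= C3.
  by rewrite /C3 -addrA lerDl addr_ge0 ?(ltW C20) // mulr_ge0 ?exprn_ge0 // ltW.
have C30 : 0 <= C3 by apply: le_trans C31.
have r00 : 0 < (2 * M * D)^-1 by rewrite invr_gt0 !mulr_gt0.
exists (C3 ^+ m.+1), (Num.min e (2 * M * D)^-1); split; first exact: exprn_ge0.
- by rewrite lt_min e0.
- by rewrite ge_min lexx.
move=> f A HF HAm r rp rr0 Hr t j tr jm.
have re : r <= e by apply: le_trans rr0 _; rewrite ge_min lexx.
have r1 : r <= 1 by apply: le_trans e1.
have te : `|t| <= e by apply: le_trans re.
have rM : r <= (2 * M * D)^-1 by apply: le_trans rr0 _; rewrite ge_min lexx orbT.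
have [Hroot HA Hrem] := HF.
have HAD a b : `|A a b| <= D by apply: le_trans MD.
have N1 : (1 <= N)%N by apply: leq_trans mN.
have Hm : (2 * M)^-1 <= `|f t m|.
  have := taylor_truncate m e1 M1 HF N1 te.
  rewrite big_ord1 expr0 mulr1 expr1 -/D => H.
  have H1 : D * `|t| <= (2 * M)^-1.
    apply: le_trans (_ : D * (2 * M * D)^-1 <= _).
      by rewrite ler_wpM2l ?(ltW D0) // (le_trans tr).
    by rewrite invfM mulrCA mulfV ?mulr1 ?gt_eqF.
  have H2 : M^-1 <= `|A m 0%N| by rewrite -[M^-1]mul1r ler_pdivrMr // mulrC.
  have H3 : M^-1 = (2 * M)^-1 + (2 * M)^-1 by field; rewrite gt_eqF.
  have := lerB_dist (A m 0%N) (f t m); rewrite distrC => H4.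
  move: (le_trans H4 H) H1 H2; rewrite H3; lra.
have [c [rs [szrs frs]]] := Hroot t te.
have [c' [rs' [szrs' frs']]] := Hroot (- t) (etrans (congr1 (fun x => x <= e) (normrN t)) te).
pose q := squared_poly c rs; pose q' := squared_poly c' rs'.
have q0 i : 0 <= q`_i by apply: squared_poly_ge0.
have fq i : f t i ^+ 2 <= 2 ^+ n * q`_i.
  rewrite frs; apply: le_trans (rooted_poly_le _ _ _) _.
  by rewrite ler_wpM2r // ler_weXn2l ?ler1n.
have qm : kap <= q`_m.
  have : (2 * M)^-1 ^+ 2 <= 2 ^+ n * q`_m.
    apply: le_trans (fq m); rewrite -[f t m ^+ 2]real_normK ?num_real //.
    by rewrite ler_pXn2r ?nnegrE ?invr_ge0 ?mulr_ge0 ?(ltW M0).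
  have -> : (2 * M)^-1 ^+ 2 = 2 ^+ n * kap.
    by rewrite /kap mulrA mulfV ?expf_neq0 ?pnatr_eq0 // mul1r exprVn exprMn -natrX.
  by rewrite ler_pM2l ?exprn_gt0.
have qm1 : q`_m.-1 <= K1 * r ^+ 2.
  have : q`_m.-1 + q'`_m.-1 <= K1 * r ^+ 2; last first.
    by apply: le_trans; rewrite lerDl squared_poly_ge0.
  rewrite /q /q' !squared_polyE -mulrDr -big_split /=.
  apply: le_trans (ler_norm _) _; rewrite normrM normrX normrN1 expr1n mul1r.
  apply: le_trans (ler_norm_sum _ _ _) _.
  have -> : K1 * r ^+ 2 = \sum_(i < m.-1.*2.+1) (2 * D + 8 * D ^+ 2) * r ^+ 2.
    by rewrite sumr_const card_ord -[RHS]mulr_natl mulrA.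
  apply: ler_sum => i _; rewrite -!mulrA -mulrDr normrM normrX normrN1 expr1n mul1r.
  rewrite -!frs -!frs'; set k := (m.-1.*2 - i)%N.
  have ik : (i + k = m.-1.*2)%N by rewrite subnKC // -ltnS.
  have t1 : `|t| <= 1 by apply: le_trans te e1.
  have tsq : t ^+ 2 <= r ^+ 2.
    by rewrite -[t ^+ 2]real_normK ?num_real // ler_pXn2r ?nnegrE // ltW.
  have fD s a : `|s| <= e -> `|f s a| <= D.
    move=> se; have := taylor_truncate a e1 M1 HF (leq0n N) se.
    by rewrite big_ord0 subr0 expr0 mulr1.
  have nte : `|- t| <= e by rewrite normrN.
  have Hprod : `|A i 0%N * A k 0%N| <= D * r ^+ 2.
    rewrite normrM.
    have [im|im] := ltnP i m.-1.
      have [im1 im2] : (i < m)%N /\ (1 < m - i)%N by clear -im; lia.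
      rewrite mulrC; apply: ler_pM => //; apply: le_trans (Hr _ im1) _.
      by rewrite ler_wiXn2l // ltW.
    have [km|km] := ltnP k m.-1.
      have [km1 km2] : (k < m)%N /\ (1 < m - k)%N by clear -km; lia.
      apply: ler_pM => //; apply: le_trans (Hr _ km1) _.
      by rewrite ler_wiXn2l // ltW.
    have [-> ->] : (i : nat) = m.-1 /\ k = m.-1 by clear -im km ik; lia.
    have Hm1 : `|A m.-1 0%N| <= r.
      have [m1 m2] : (m.-1 < m)%N /\ (m - m.-1 = 1)%N by clear -m0; lia.
      by apply: le_trans (Hr _ m1) _; rewrite m2.
    rewrite -expr2; apply: le_trans (_ : r ^+ 2 <= _).
      by rewrite ler_pXn2r ?nnegrE // ltW.
    by rewrite ler_peMl ?exprn_ge0 // ltW.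
  have [N2|N2] := leqP 2 N; last first.
    have m1 : m = 1%N by clear -m0 mN N2; lia.
    have [-> ->] : (i : nat) = 0%N /\ k = 0%N by clear -m1 ik; lia.
    have f0 s : `|s| <= r -> `|f s 0%N| <= (D + 1) * r.
      move=> sr; have := taylor_truncate 0%N e1 M1 HF N1 (le_trans sr re).
      rewrite big_ord1 expr0 mulr1 expr1 -/D => H.
      rewrite -[f s 0%N](subrK (A 0%N 0%N)); apply: le_trans (ler_normD _ _) _.
      rewrite mulrDl mul1r lerD //.
        by apply: le_trans H _; rewrite ler_wpM2l // ltW.
      by apply: le_trans (Hr _ _) _; rewrite m1.
    have Hsq s : `|s| <= r -> `|f s 0%N * f s 0%N| <= (D + 1) ^+ 2 * r ^+ 2.
      move=> sr; rewrite normrM -expr2 -exprMn ler_pXn2r ?nnegrE // ?f0 //.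
      by apply: le_trans (f0 _ sr).
    apply: le_trans (ler_normD _ _) _.
    apply: le_trans (lerD (Hsq _ tr) (Hsq (- t) _)) _; first by rewrite normrN.
    rewrite -[leLHS]mulrDl ler_wpM2r ?exprn_ge0 ?(ltW rp) //.
    have : 0 <= D ^+ 2 - D by rewrite subr_ge0 expr2 ler_peMr // ltW.
    by have := sqr_ge0 (D - 1); clear -D1; lra.
  have Ht a s : `|s| <= e -> `|f s a - (A a 0%N + A a 1%N * s)| <= D * `|s| ^+ 2.
    move=> se; have := taylor_truncate a e1 M1 HF N2 se.
    by rewrite !big_ord_recr big_ord0 /= add0r expr0 mulr1 expr1.
  have Hnt a : `|f (- t) a - (A a 0%N - A a 1%N * t)| <= D * `|t| ^+ 2.
    by have := Ht a _ nte; rewrite mulrN normrN.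
  apply: le_trans (symmetric_product_bound t1 (HAD i 0%N) (HAD i 1%N) (HAD k 0%N) (HAD k 1%N) (fD _ _ te) (fD _ _ nte) (Ht _ _ te) (Hnt _) (Ht _ _ te) (Hnt _)) _.
  rewrite [leRHS]mulrDl lerD //; first by rewrite -mulrA ler_wpM2l.
  by rewrite ler_wpM2l // mulr_ge0 // sqr_ge0.
(* Below m the ratio of consecutive coefficients of q is at most
   q_(m-1) / q_m. *)
have qj a : (a < m)%N -> q`_(m - a.+1) <= kap * (C2 * r ^+ 2) ^+ a.+1.
  have C2r : 0 <= C2 * r ^+ 2 by rewrite mulr_ge0 ?sqr_ge0 // ltW.
  elim: a => [|a IHa] am.
    by rewrite subn1 expr1 mulrA /C2 [kap * _]mulrC mulfVK ?gt_eqF.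
  have le1 : (m - a.+2 <= m.-1)%N by clear -am; lia.
  have := squared_poly_logconcave c rs le1; rewrite -/q (ltn_predK m0).
  rewrite (_ : (m - a.+2).+1 = m - a.+1)%N; last by clear -am; lia.
  move=> H; have Ha := IHa (ltnW am).
  have H1 : q`_(m - a.+2) * kap <= kap * (C2 * r ^+ 2) ^+ a.+1 * (K1 * r ^+ 2).
    apply: le_trans (_ : q`_(m - a.+2) * q`_m <= _); first by rewrite ler_wpM2l.
    by apply: le_trans H _; rewrite ler_pM.
  move: H1; rewrite -ler_pdivlMr // => /le_trans-> //.
  rewrite [(_ * r ^+ 2) ^+ a.+2]exprSr le_eqVlt; apply/orP; left; apply/eqP.
  by rewrite /C2; field; rewrite gt_eqF.
have [mj mj' mj''] : [/\ j = (m - (m - j).-1.+1)%N, ((m - j).-1 < m)%N & (m - j).-1.+1 = (m - j)%N].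
  by clear -jm; split; lia.
have := qj _ mj'; rewrite -mj mj'' => Hq.
have : `|f t j| ^+ 2 <= (C3 ^+ m.+1 * r ^+ (m - j)) ^+ 2; last first.
  by rewrite ler_pXn2r ?nnegrE ?mulr_ge0 ?exprn_ge0 // ltW.
rewrite real_normK ?num_real //; apply: le_trans (fq j) _.
apply: le_trans (_ : 2 ^+ n * (kap * (C2 * r ^+ 2) ^+ (m - j)) <= _).
  by rewrite ler_wpM2l // exprn_ge0.
have -> : 2 ^+ n * (kap * (C2 * r ^+ 2) ^+ (m - j)) =
    2 ^+ n * kap * C2 ^+ (m - j) * (r ^+ (m - j)) ^+ 2.
  by rewrite exprMn exprAC !mulrA.
have -> : (C3 ^+ m.+1 * r ^+ (m - j)) ^+ 2 =
    (C3 ^+ m.+1) ^+ 2 * (r ^+ (m - j)) ^+ 2 by rewrite exprMn.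
apply: (@ler_wpM2r _ ((r ^+ (m - j)) ^+ 2)); first exact: sqr_ge0.
apply: le_trans (_ : C3 ^+ m.+1 <= _); last first.
  by rewrite -[leRHS]exprM ler_weXn2l // muln2 -addnn leq_addr.
have k0 : 0 <= 2 ^+ n * kap by rewrite mulr_ge0 ?exprn_ge0 // ltW.
rewrite exprS; apply: ler_pM => //; first by rewrite exprn_ge0 // ltW.
  by rewrite /C3 lerDr addr_ge0 // ltW.
apply: le_trans (_ : C3 ^+ (m - j) <= _).
  rewrite ler_pXn2r ?nnegrE ?(ltW C20) ?subn_gt0 // /C3 addrAC lerDr.
  by rewrite addr_ge0.
by rewrite ler_weXn2l // leq_subr.
Qed.
End Family.

Section Multiplicity.
Variable R : rcfType.
Implicit Types (f : R -> nat -> R) (A : nat -> nat -> R) (e M r t : R).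

Lemma uniform_bound (m : nat) (P : nat -> R -> Prop) :
  (forall j C C', P j C -> C <= C' -> P j C') ->
  (forall j, (j < m)%N -> exists2 C : R, 0 <= C & P j C) ->
  exists2 C : R, 0 <= C & forall j, (j < m)%N -> P j C.
Proof.
move=> Pmon; elim: m => [|m IH] HP; first by exists 0.
have [C C0 HC] := IH (fun j jm => HP j (ltnW jm)).
have [C' C'0 HC'] := HP m (ltnSn m).
exists (C + C') => [|j]; first exact: addr_ge0.
rewrite ltnS leq_eqVlt => /orP[/eqP->|jm].
  by apply: Pmon HC' _; rewrite lerDr.
by apply: Pmon (HC _ jm) _; rewrite lerDl.
Qed.

Lemma exists_nth_root (a : R) (k : nat) : 0 <= a -> (0 < k)%N ->
  exists2 y, 0 <= y & y ^+ k = a.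
Proof.
move=> a0 k0.
have [||x /andP[x0 _]] := @poly_ivt R ('X^k - a%:P) 0 (1 + a).
- by rewrite addr_ge0.
- rewrite !hornerE expr0n (gtn_eqF k0) sub0r oppr_le0 a0 /=.
  rewrite subr_ge0; apply: le_trans (_ : 1 + a <= _); first by rewrite lerDr.
  by rewrite -[X in X <= _]expr1 ler_weXn2l // lerDl.
by rewrite rootE !hornerE subr_eq0 => /eqP; exists x.
Qed.

(** The scale is the largest of the numbers (a j)^(1/(m-j)). *)
Lemma exists_critical_scale (a : nat -> R) (m : nat) :
  (forall j, 0 <= a j) -> (exists2 j, (j < m)%N & a j != 0) ->
  exists r, [/\ 0 < r, forall j, (j < m)%N -> a j <= r ^+ (m - j)
    & exists2 j, (j < m)%N & a j = r ^+ (m - j)].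
Proof.
move=> a0 [j1 j1m aj1].
have /fin_all_exists [rho Hrho] : forall j : 'I_m, exists y, 0 <= y /\ y ^+ (m - j) = a j.
  by move=> j; have [|y y0 yE] := exists_nth_root (a0 j) (k := m - j); [rewrite subn_gt0 | exists y].
pose i0 := [arg max_(i > Ordinal j1m) rho i]%O.
have Hi0 j : rho j <= rho i0.
  by rewrite /i0; case: arg_maxP => // i _; apply.
exists (rho i0); split.
- rewrite lt_neqAle (Hrho i0).1 andbT eq_sym; apply/eqP => ri0.
  have := Hi0 (Ordinal j1m); rewrite ri0 => h.
  have r1 : rho (Ordinal j1m) = 0 by apply/eqP; rewrite eq_le h (Hrho _).1.
  have := (Hrho (Ordinal j1m)).2; rewrite r1 expr0n /= subn_eq0 leqNgt j1m /=.
  by move/esym/eqP; rewrite (negbTE aj1).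
- move=> j jm; rewrite -[a j]((Hrho (Ordinal jm)).2) /=.
  by rewrite ler_pXn2r ?nnegrE ?(Hrho _).1 ?subn_gt0.
- by exists i0 => //; rewrite (Hrho i0).2.
Qed.

Lemma taylor_family_le n N e M M' f A : M <= M' ->
  taylor_family n N e M f A -> taylor_family n N e M' f A.
Proof.
move=> MM' [H1 H2 H3]; split=> // [j i|t j te]; first exact: le_trans MM'.
by apply: le_trans (H3 t j te) _; rewrite ler_wpM2r // exprn_ge0.
Qed.

(** The bound for the values on |t| <= r carries over to the Taylor polynomial of
    degree m - j - 1, whose coefficients it controls after the substitution of
    r t for t. *)
Lemma taylor_coef_bound n N e M m : 0 < e -> e <= 1 -> 1 <= M -> (m <= N)%N ->
  exists C r0, [/\ 0 <= C, 0 < r0, r0 <= e &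
  forall f A, taylor_family n N e M f A -> 1 <= M * `|A m 0%N| ->
  forall r, 0 < r -> r <= r0 -> (forall j, (j < m)%N -> `|A j 0%N| <= r ^+ (m - j)) ->
  forall i j, (i + j < m)%N -> `|A j i| <= C * r ^+ (m - (i + j))].
Proof.
move=> e0 e1 M1 mN.
have [C [r0 [C0 r00 r0e HC]]] := family_value_bound n e0 e1 M1 mN.
have [C' C'0 HC'] := poly_coef_bound R m.
pose D := M * N.+2%:R.
have D0 : 0 <= D by rewrite mulr_ge0 // (le_trans _ M1).
exists (C' * (C + D)), r0; split => //; first by rewrite mulr_ge0 // addr_ge0.
move=> f A HF HAm r rp rr0 Hr i j ijm.
have jm : (j < m)%N by apply: leq_ltn_trans ijm; rewrite leq_addl.
have r1 : r <= 1 by apply: le_trans rr0 (le_trans r0e e1).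
pose b k := if (k < m - j)%N then A j k * r ^+ k else 0.
have Hb (t : R) : `|t| <= 1 -> `|\sum_(k < m) b k * t ^+ k| <= (C + D) * r ^+ (m - j).
  move=> t1.
  have -> : \sum_(k < m) b k * t ^+ k = \sum_(k < m - j) A j k * (r * t) ^+ k.
    rewrite (big_ord_widen m (fun k => A j k * (r * t) ^+ k)) ?leq_subr // [RHS]big_mkcond /=.
    apply: eq_bigr => k _; rewrite /b; case: ifP => _; last by rewrite mul0r.
    by rewrite exprMn mulrA.
  have rt : `|r * t| <= r by rewrite normrM gtr0_norm // ler_piMr // ltW.
  have LN : (m - j <= N)%N by apply: leq_trans mN; rewrite leq_subr.
  have := taylor_truncate j e1 M1 HF LN (le_trans rt (le_trans rr0 r0e)).
  rewrite -/D distrC => H.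
  rewrite -[X in `|X|](subrK (f (r * t) j)); apply: le_trans (ler_normD _ _) _.
  rewrite addrC mulrDl lerD //; first exact: (HC f A).
  apply: le_trans H _; rewrite ler_wpM2l //.
  by rewrite ler_pXn2r ?nnegrE ?subn_gt0 // ltW.
have := HC' b _ Hb i (leq_ltn_trans (leq_addr j i) ijm).
have imj : (i < m - j)%N by clear -ijm; lia.
rewrite /b imj normrM normrX (gtr0_norm rp) mulrA.
have -> : (m - j = (m - (i + j)) + i)%N by clear -ijm; lia.
by rewrite exprD mulrA ler_pM2r // exprn_gt0.
Qed.

(** Here p is the multiplicity of the root 0 at t = 0. The conclusion is invariant
    under rescaling, which is why it can be reduced to a smaller m: at the
    critical scale a coefficient below the m-th one has absolute value 1, and
    [taylor_coef_bound] keeps the rescaled Taylor coefficients bounded. *)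
Lemma multiplicity_bound n N e m M : 0 < e -> e <= 1 -> 1 <= M -> (m <= N)%N ->
  exists2 C : R, 0 <= C & forall f A, taylor_family n N e M f A ->
  1 <= M * `|A m 0%N| -> forall p, (p <= m)%N ->
  (forall j, (j < p)%N -> A j 0%N = 0) -> A p 0%N != 0 ->
  (forall i j, (i + j < p)%N -> A j i = 0) /\
  (forall i j, (i + j)%N = p -> `|A j i| <= C * `|A p 0%N|).
Proof.
move=> e0 e1; elim/ltn_ind: m M => m IH M M1 mN.
have [C1 [r0 [C10 r00 r0e HC1]]] := taylor_coef_bound n e0 e1 M1 mN.
have r01 : r0 <= 1 by apply: le_trans r0e e1.
have uni M' : 1 <= M' -> exists2 C : R, 0 <= C & forall k, (k < m)%N ->
  forall f A, taylor_family n N e M' f A ->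
  1 <= M' * `|A k 0%N| -> forall p, (p <= k)%N ->
  (forall j, (j < p)%N -> A j 0%N = 0) -> A p 0%N != 0 ->
  (forall i j, (i + j < p)%N -> A j i = 0) /\
  (forall i j, (i + j)%N = p -> `|A j i| <= C * `|A p 0%N|).
  move=> M'1; apply: uniform_bound => [j C C' H CC' f A HF HA p pj H1 H2 | j jm].
    have [H3 H4] := H f A HF HA p pj H1 H2; split => // i j' ij'.
    by apply: le_trans (H4 i j' ij') _; rewrite ler_wpM2r.
  by apply: IH => //; apply: leq_trans (ltnW jm) mN.
pose M' := M + (r0 ^+ m)^-1.
have M'1 : 1 <= M' by apply: le_trans M1 _; rewrite lerDl invr_ge0 exprn_ge0 // ltW.
have M''1 : 1 <= M + C1 by apply: le_trans M1 _; rewrite lerDl.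
have [C2 C20 HC2] := uni M' M'1.
have [C3 C30 HC3] := uni (M + C1) M''1.
have M0 : 0 <= M by apply: le_trans M1.
exists (M * M + C2 + C3) => [|f A HF HAm p pm Hp Ap]; first by rewrite !addr_ge0 // mulr_ge0.
have weaken C : 0 <= C -> C <= M * M + C2 + C3 ->
  (forall i j, (i + j < p)%N -> A j i = 0) /\
  (forall i j, (i + j)%N = p -> `|A j i| <= C * `|A p 0%N|) ->
  (forall i j, (i + j < p)%N -> A j i = 0) /\
  (forall i j, (i + j)%N = p -> `|A j i| <= (M * M + C2 + C3) * `|A p 0%N|).
  move=> _ CC [h1 h2]; split => // i j ij; apply: le_trans (h2 i j ij) _.
  by rewrite ler_wpM2r.
have [/forallP Hall|] := boolP [forall j : 'I_m, `|A j 0%N| <= r0 ^+ (m - j)]; last first.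
  move=> /forallPn [j]; rewrite -ltNge => Hj.
  apply: (weaken C2) => //; first by rewrite addrAC lerDr addr_ge0 // mulr_ge0.
  apply: (HC2 j) => //.
  - by apply: taylor_family_le HF; rewrite lerDl invr_ge0 exprn_ge0 // ltW.
  - rewrite /M' mulrDl; apply: le_trans (_ : (r0 ^+ m)^-1 * `|A j 0%N| <= _); last first.
      by rewrite lerDr mulr_ge0.
    rewrite mulrC ler_pdivlMr ?exprn_gt0 // mul1r; apply: le_trans (ltW Hj).
    by rewrite ler_wiXn2l ?leq_subr // ltW.
  - rewrite leqNgt; apply/negP => jp; move: Hj.
    by rewrite Hp // normr0 ltNge exprn_ge0 // ltW.
have {}Hall j : (j < m)%N -> `|A j 0%N| <= r0 ^+ (m - j).
  by move=> jm; apply: (Hall (Ordinal jm)).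
have [HF1 HF2 HF3] := HF.
have [/forallP Hz|] := boolP [forall j : 'I_m, A j 0%N == 0].
  have pmE : p = m.
    apply/eqP; rewrite eqn_leq pm leqNgt; apply/negP => pm'.
    by move/negP: Ap; apply; apply: (Hz (Ordinal pm')).
  subst p; apply: (weaken (M * M)); rewrite ?mulr_ge0 //.
    by rewrite -addrA lerDl addr_ge0.
  split=> i j ij; last first.
    apply: le_trans (HF2 j i) _; rewrite -mulrA; apply: ler_peMr => //.
  apply/eqP; rewrite -normr_eq0 eq_le normr_ge0 andbT leNgt; apply/negP => Aji.
  pose r := Num.min r0 (`|A j i| / (2 * (C1 + 1))).
  have C1p : 0 < C1 + 1 by rewrite ltr_wpDl.
  have rp : 0 < r by rewrite lt_min r00 divr_gt0 // mulr_gt0.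
  have rr0 : r <= r0 by rewrite ge_min lexx.
  have Hk k : (k < m)%N -> `|A k 0%N| <= r ^+ (m - k).
    by move=> km; rewrite (eqP (Hz (Ordinal km))) normr0 exprn_ge0 // ltW.
  have := HC1 f A HF HAm r rp rr0 Hk i j ij.
  apply/negP; rewrite -ltNge.
  have r1 : r <= 1 by apply: le_trans rr0 r01.
  have : r ^+ (m - (i + j)) <= r.
    by rewrite -[leRHS]expr1 ler_wiXn2l ?(ltW rp) // subn_gt0.
  move=> /(ler_wpM2l C10) h; apply: le_lt_trans h _.
  apply: le_lt_trans (_ : C1 * (`|A j i| / (2 * (C1 + 1))) < _).
    by rewrite ler_wpM2l // ge_min lexx orbT.
  rewrite mulrA ltr_pdivrMr ?mulr_gt0 //.
  by have := mulr_ge0 C10 (ltW Aji); move: Aji; clear; nra.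
rewrite negb_forall => /existsP [j1 Hj1].
have [r [rp Hr [j0 j0m Hj0]]] : exists r, [/\ 0 < r, forall j, (j < m)%N -> `|A j 0%N| <= r ^+ (m - j)
    & exists2 j, (j < m)%N & `|A j 0%N| = r ^+ (m - j)].
  apply: (exists_critical_scale (a := fun j => `|A j 0%N|)) => // .
  by exists j1 => //; rewrite normr_eq0.
have rr0 : r <= r0.
  by have := Hall j0 j0m; rewrite Hj0 ler_pXn2r ?nnegrE ?subn_gt0 // ltW.
have r1 : r <= 1 by apply: le_trans rr0 r01.
have rn0 : r != 0 by rewrite gt_eqF.
have rmp : 0 < r ^+ m by rewrite exprn_gt0.
pose f' (s : R) j := (r ^+ m)^-1 * r ^+ j * f (r * s) j.
pose A' j i := r ^+ (i + j) / r ^+ m * A j i.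
have A'E j i : `|A' j i| = r ^+ (i + j) / r ^+ m * `|A j i|.
  by rewrite /A' normrM ger0_norm // divr_ge0 // exprn_ge0 // ltW.
have HF' : taylor_family n N e (M + C1) f' A'.
  split.
  - move=> t te; have rte : `|r * t| <= e.
      by rewrite normrM gtr0_norm //; apply: le_trans te; rewrite ler_piMl.
    have [c [rs [sz H]]] := HF1 _ rte.
    have [c' [rs' [sz' H']]] := rooted_poly_scale c rs (r ^+ m)^-1 rn0.
    exists c', rs'; rewrite sz'; split => // j; rewrite H' /f' H //.
  - move=> j i; rewrite A'E mulrAC ler_pdivrMr //.
    have [ijm|ijm] := ltnP (i + j) m.
      apply: le_trans (_ : r ^+ (i + j) * (C1 * r ^+ (m - (i + j))) <= _).
        by rewrite ler_wpM2l ?exprn_ge0 ?(ltW rp) // (HC1 f A).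
      by rewrite mulrCA -exprD subnKC ?(ltnW ijm) // ler_wpM2r ?(ltW rmp) // lerDr.
    rewrite mulrC ler_pM ?exprn_ge0 ?(ltW rp) //; first by apply: le_trans (HF2 _ _) _; rewrite lerDl.
    by rewrite ler_wiXn2l // ltW.
  - move=> t j te; have rte : `|r * t| <= e.
      by rewrite normrM gtr0_norm //; apply: le_trans te; rewrite ler_piMl.
    have -> : f' t j - \sum_(i < N.+1) A' j i * t ^+ i =
      (r ^+ m)^-1 * r ^+ j * (f (r * t) j - \sum_(i < N.+1) A j i * (r * t) ^+ i).
      rewrite mulrBr; congr (_ - _); rewrite mulr_sumr; apply: eq_bigr => i _.
      by rewrite /A' exprMn exprD; ring.
    have k0 : 0 <= (r ^+ m)^-1 * r ^+ j by rewrite mulr_ge0 ?invr_ge0 ?exprn_ge0 // ltW.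
    rewrite normrM ger0_norm //.
    apply: le_trans (ler_wpM2l k0 (HF3 _ j rte)) _.
    rewrite normrM (gtr0_norm rp) exprMn.
    have H : (r ^+ m)^-1 * r ^+ j * r ^+ N <= 1.
      rewrite -mulrA -exprD mulrC ler_pdivrMr // mul1r ler_wiXn2l ?(ltW rp) //.
      by apply: leq_trans mN _; rewrite leq_addl.
    have M0' : 0 <= M * `|t| ^+ N by rewrite mulr_ge0 // exprn_ge0.
    have := ler_wpM2r M0' H; rewrite mul1r => H'.
    apply: le_trans (_ : M * `|t| ^+ N <= _); last by rewrite ler_wpM2r ?exprn_ge0 // lerDl.
    by apply: le_trans H'; rewrite le_eqVlt; apply/orP; left; apply/eqP; ring.
have Anz j i : (A' j i == 0) = (A j i == 0).
  by rewrite /A' !mulf_eq0 invr_eq0 !expf_eq0 (negbTE rn0) !andbF.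
have HAj0 : 1 <= (M + C1) * `|A' j0 0%N|.
  by rewrite A'E Hj0 add0n mulrAC -exprD subnKC ?(ltnW j0m) // divff ?mulr1 // gt_eqF.
have pj0 : (p <= j0)%N.
  rewrite leqNgt; apply/negP => /Hp h; move: Hj0; rewrite h normr0 => /esym/eqP.
  by rewrite expf_eq0 (negbTE rn0) andbF.
have [H1 H2] := HC3 j0 j0m f' A' HF' HAj0 p pj0 (fun j jp => eqP (etrans (Anz j 0%N) (introT eqP (Hp j jp)))) (etrans (congr1 negb (Anz p 0%N)) Ap).
apply: (weaken C3) => //; first by rewrite lerDr addr_ge0 // mulr_ge0.
split=> i j ij; first by apply/eqP; rewrite -Anz; apply/eqP/H1.
have := H2 i j ij; rewrite !A'E ij add0n mulrCA ler_pM2l //.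
by rewrite divr_gt0 ?exprn_gt0.
Qed.
End Multiplicity.

Section RootBound.
Variable R : rcfType.
Implicit Types (f : R -> nat -> R) (A : nat -> nat -> R) (e M r t : R).

(** Bronshtein's estimate: roots that are close to a root at t = 0 are displaced
    by at most K |s|. By [multiplicity_bound] the polynomial is, near (0, 0),
    close to a form of degree p in (s, x) whose coefficients are bounded by that
    of x^p. The constant K depends on the bounds only, the neighborhood [d] also
    on the family. *)
Lemma root_bound n N e M : 0 < e -> e <= 1 -> 1 <= M -> (n <= N)%N ->
  exists2 K : R, 0 <= K & forall f A, taylor_family n N e M f A ->
  1 <= M * `|A n 0%N| -> A 0%N 0%N = 0 ->
  exists2 d : R, 0 < d & forall s x, `|s| < d -> `|x| < d ->
  \sum_(j < n.+1) f s j * x ^+ j = 0 -> `|x| <= K * `|s|.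
Proof.
move=> e0 e1 M1 nN.
have [C C0 HC] := multiplicity_bound n e0 e1 M1 nN.
have M0 : 0 < M by apply: lt_le_trans M1.
pose D := M * N.+2%:R.
have D1 : 1 <= D by rewrite mulr_ege1 // ler1n.
have D0 : 0 < D by apply: lt_le_trans D1.
pose E := C + 1 + M * M.
have E1 : 1 <= E by rewrite /E addrAC lerDr addr_ge0 // mulr_ge0 // ltW.
have E0 : 0 < E by apply: lt_le_trans E1.
pose K := 2 * E * (n.+1)%:R + 1.
have K1 : 1 <= K by rewrite lerDr !mulr_ge0 // ltW.
exists K => [|f A HF HAn A00]; first by apply: le_trans K1.
have An : A n 0%N != 0.
  by apply/eqP => h; move: HAn; rewrite h normr0 mulr0 ler10.
have exP : exists p, A p 0%N != 0 by exists n.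
have [p Ap minp] := find_ex_minn exP.
have pn : (p <= n)%N by apply: minp.
have Hp j : (j < p)%N -> A j 0%N = 0.
  by move=> jp; apply/eqP; apply/negPn/negP => /minp; rewrite leqNgt jp.
have p0 : (0 < p)%N by rewrite lt0n; apply/eqP => h; move: Ap; rewrite h A00 eqxx.
have [Hz Hb] := HC f A HF HAn p pn Hp Ap.
pose a := `|A p 0%N|; have a0 : 0 < a by rewrite normr_gt0.
have pN : (p <= N)%N by apply: leq_trans nN.
have N1 : (1 <= N)%N by apply: leq_trans pN.
pose d := Num.min e (a / (4 * (n.+1)%:R * D)).
have aD : 0 < a / (4 * (n.+1)%:R * D) by rewrite divr_gt0 // !mulr_gt0 // ltr0n.
exists d => [|s x sd xd Hroot]; first by rewrite lt_min e0.
have de : d <= e by rewrite ge_min lexx.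
have da : D * d <= a / 4 / (n.+1)%:R.
  apply: le_trans (_ : D * (a / (4 * (n.+1)%:R * D)) <= _).
    by rewrite ler_wpM2l ?(ltW D0) // ge_min lexx orbT.
  rewrite le_eqVlt; apply/orP; left; apply/eqP; field.
  by rewrite nat1r pnatr_eq0 /= gt_eqF.
have da4 : D * d <= a / 4.
  apply: le_trans da _; rewrite ler_pdivrMr ?ltr0n // ler_peMr ?ler1n //.
  by rewrite divr_ge0 // ltW.
have se : `|s| <= e by apply: ltW (lt_le_trans sd de).
have x1 : `|x| <= 1 by apply: ltW (lt_le_trans xd (le_trans de e1)).
rewrite leNgt; apply/negP => xs.
have x0 : 0 < `|x| by apply: le_lt_trans xs; rewrite mulr_ge0 // (le_trans _ K1).
have sx : `|s| <= `|x| by apply: ltW; apply: le_lt_trans xs; rewrite ler_peMl.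
have low j : (j < p)%N -> `|f s j| <= E * a * `|s| ^+ (p - j).
  move=> jp.
  have main : `|A j (p - j)%N * s ^+ (p - j)| <= C * a * `|s| ^+ (p - j).
    by rewrite normrM normrX ler_wpM2r ?exprn_ge0 // Hb // subnK // ltnW.
  have [pjN|pjN] := ltnP (p - j) N.
    have := taylor_truncate j e1 M1 HF pjN se.
    rewrite big_ord_recr big1 /=; last first.
      by move=> i _; rewrite Hz ?mul0r //; clear -jp; case: i => i /=; lia.
    rewrite add0r -/D => H.
    rewrite -[f s j](subrK (A j (p - j)%N * s ^+ (p - j))).
    apply: le_trans (ler_normD _ _) _; rewrite addrC.
    have -> : E * a * `|s| ^+ (p - j) = C * a * `|s| ^+ (p - j) + (a * `|s| ^+ (p - j) + M * M * a * `|s| ^+ (p - j)).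
      by rewrite /E; ring.
    apply: lerD => //.
    apply: le_trans (_ : a * `|s| ^+ (p - j) <= _); last first.
      by rewrite lerDl !mulr_ge0 ?exprn_ge0 // ltW.
    apply: le_trans H _; rewrite exprS mulrA ler_wpM2r ?exprn_ge0 //.
    apply: le_trans (_ : D * d <= _); first by rewrite ler_wpM2l ?(ltW D0) // ltW.
    by apply: le_trans da4 _; rewrite ler_pdivrMr // ler_peMr ?(ltW a0) // ler1n.
  (* The expansions stop short of the order p - j + 1 only if p = N = n. Then
     the crude remainder suffices, because the coefficient [a] is at least 1/M. *)
  have [j0 pN'] : j = 0%N /\ p = N by clear -pjN pN jp; lia.
  have pn' : p = n by apply/eqP; rewrite eqn_leq pn pN' nN.
  have HMa : 1 <= M * a by rewrite /a pn'.
  have [_ HA Hrem] := HF.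
  have := Hrem s j se; rewrite big_ord_recr big1 /=; last first.
    by move=> i _; rewrite Hz ?mul0r //; case: i => i /=; rewrite j0 addn0 pN'.
  rewrite add0r => H.
  have pj : (p - j = N)%N by rewrite j0 subn0.
  rewrite pj in main *.
  rewrite -[f s j](subrK (A j N * s ^+ N)).
  apply: le_trans (ler_normD _ _) _; rewrite addrC.
  have -> : E * a * `|s| ^+ N = C * a * `|s| ^+ N + (a * `|s| ^+ N + M * M * a * `|s| ^+ N).
    by rewrite /E; ring.
  apply: lerD => //; apply: le_trans H _.
  apply: le_trans (_ : M * M * a * `|s| ^+ N <= _); last first.
    by rewrite lerDr !mulr_ge0 ?exprn_ge0 // ltW.
  by rewrite -mulrA -mulrA ler_wpM2l ?(ltW M0) // mulrA ler_peMl ?exprn_ge0.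
have hp : a * (3 / 4) <= `|f s p|.
  have := taylor_truncate p e1 M1 HF N1 se.
  rewrite big_ord1 expr0 mulr1 expr1 -/D => H.
  have H1 : D * `|s| <= a / 4.
    by apply: le_trans da4; rewrite ler_wpM2l ?(ltW D0) // ltW.
  have := lerB_dist (A p 0%N) (f s p); rewrite distrC -/a => H4.
  by move: (le_trans H4 H) H1; clear; lra.
have high j : `|f s j| <= D.
  have := taylor_truncate j e1 M1 HF (leq0n N) se.
  by rewrite big_ord0 subr0 expr0 mulr1.
have xp0 : 0 < `|x| ^+ p by rewrite exprn_gt0.
have Hpn : (p < n.+1)%N by rewrite ltnS.
have : `|f s p * x ^+ p| <= \sum_(j < n.+1 | j != p :> nat) `|f s j * x ^+ j|.
  move: Hroot; rewrite (bigD1 (Ordinal Hpn)) //= => /eqP; rewrite addr_eq0 => /eqP->.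
  by rewrite normrN; apply: le_trans (ler_norm_sum _ _ _) _.
move=> Hsum.
have {}Hsum : `|f s p * x ^+ p| <= (n.+1)%:R * ((E * a * (`|s| / `|x|) + D * d) * `|x| ^+ p).
  apply: le_trans Hsum _.
  have -> : (n.+1)%:R * ((E * a * (`|s| / `|x|) + D * d) * `|x| ^+ p) =
      \sum_(j < n.+1) (E * a * (`|s| / `|x|) + D * d) * `|x| ^+ p.
    by rewrite sumr_const card_ord -[RHS]mulr_natl.
  have t10 : 0 <= E * a * (`|s| / `|x|).
    by rewrite mulr_ge0 ?divr_ge0 // mulr_ge0 // ltW.
  have t20 : 0 <= D * d by rewrite mulr_ge0 ?ltW // lt_min e0.
  rewrite [leLHS]big_mkcond; apply: ler_sum => j _ /=; case: ifP => [jp|_]; last first.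
    by rewrite mulr_ge0 ?exprn_ge0 // addr_ge0.
  rewrite normrM normrX [leRHS]mulrDl; case: (ltnP j p) => jp'.
    apply: le_trans (_ : E * a * (`|s| / `|x|) * `|x| ^+ p <= _); last first.
      by rewrite lerDl mulr_ge0 // exprn_ge0.
    apply: le_trans (_ : E * a * `|s| ^+ (p - j) * `|x| ^+ j <= _).
      by rewrite ler_wpM2r ?exprn_ge0 // low.
    rewrite -!mulrA ler_wpM2l ?(ltW E0) // ler_wpM2l ?(ltW a0) //.
    have -> : (p - j = (p - j).-1.+1)%N by rewrite prednK // subn_gt0.
    rewrite exprS -!mulrA ler_wpM2l //.
    apply: le_trans (_ : `|x| ^+ (p - j).-1 * `|x| ^+ j <= _).
      by rewrite ler_wpM2r ?exprn_ge0 // lerXn2r // nnegrE.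
    rewrite -exprD mulrC ler_pdivlMr // -exprSr.
    by rewrite -addSn prednK ?subn_gt0 // subnK // ltnW.
  apply: le_trans (_ : D * d * `|x| ^+ p <= _); last first.
    by rewrite lerDr mulr_ge0 // exprn_ge0.
  have {}jp' : (p < j)%N by rewrite ltn_neqAle eq_sym jp.
  rewrite -mulrA; apply: ler_pM => //.
  apply: le_trans (_ : `|x| ^+ p.+1 <= _); first by rewrite ler_wiXn2l.
  by rewrite exprS ler_wpM2r ?exprn_ge0 // ltW.
move: Hsum; rewrite normrM normrX mulrA ler_pM2r // mulrDr => H5.
have dn : (n.+1)%:R * (D * d) <= a / 4 by rewrite mulrC -ler_pdivlMr ?ltr0n.
have H6 : a / 2 <= (n.+1)%:R * (E * a * (`|s| / `|x|)).
  by move: (le_trans hp H5) dn; clear; lra.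
have H7 : `|x| <= 2 * E * (n.+1)%:R * `|s|.
  have -> : `|x| = a / 2 * (2 * `|x| / a) by field; rewrite gt_eqF.
  have -> : 2 * E * (n.+1)%:R * `|s| = (n.+1)%:R * (E * a * (`|s| / `|x|)) * (2 * `|x| / a).
    by field; rewrite !gt_eqF.
  by rewrite ler_wpM2r // divr_ge0 ?(ltW a0) // mulr_ge0.
have := lt_le_trans xs H7; rewrite mulrDl mul1r ltNge lerDl normr_ge0 //.
Qed.
End RootBound.

(** * Uniform Taylor expansions *)

Section Taylor.
Variable R : realType.
Implicit Types (f g : R -> R) (t s : R).

Definition taylor_poly (k : nat) f t : {poly R} :=
  \poly_(i < k.+1) (derive1n i f t / i`!%:R).

(** Induction on k: the mean value theorem integrates the estimate for the
    derivative. *)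
Lemma taylor_remainder (k : nat) f t (d eta : R) :
  (forall i s, (i < k)%N -> `|s| <= d -> derivable (derive1n i f) (t + s) 1) ->
  (forall s, `|s| <= d -> `|derive1n k f (t + s) - derive1n k f t| <= eta) ->
  forall s, `|s| <= d ->
  `|f (t + s) - (taylor_poly k f t).[s]| <= eta * `|s| ^+ k.
Proof.
elim: k f => [|k IH] f Hd Hk s sd.
  by rewrite /taylor_poly poly_def big_ord1 expr0 alg_polyC hornerC divr1 mulr1; apply: Hk.
have Sn i h : derive1n i.+1 h = derive1n i (derive1 h).
  by elim: i => // i IHi; rewrite derive1nS IHi -derive1nS.
have dT : (taylor_poly k.+1 f t)^`() = taylor_poly k (derive1 f) t.
  apply/polyP => i; rewrite coef_deriv !coef_poly ltnS; case: ltnP => // _; rewrite ?mul0rn //.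
  rewrite Sn -mulr_natr factS natrM; field.
  by rewrite nat1r !pnatr_eq0 -lt0n fact_gt0.
have IH' u : `|u| <= d -> `|derive1 f (t + u) - (taylor_poly k (derive1 f) t).[u]| <= eta * `|u| ^+ k.
  apply: IH => [i v ik vd|v vd]; first by rewrite -Sn; apply: Hd.
  by rewrite -Sn; apply: Hk.
pose phi u := f (t + u) - (taylor_poly k.+1 f t).[u].
have Hder (u : R) : `|u| <= d -> is_derive u (1 : R) phi (derive1 f (t + u) - (taylor_poly k (derive1 f) t).[u]).
  move=> ud; rewrite -dT /phi; apply: is_deriveB.
  have := Hd 0%N u isT ud; rewrite derive1n0 => Hf.
  have Hf' : is_derive (t + u) (1 : R) f (derive1 f (t + u)).
    by rewrite derive1E; apply: DeriveDef.
  have := @is_derive1_comp _ f (fun u => t + u) u _ 1 Hf' _.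
  rewrite mulr1; apply.
  by rewrite -[X in is_derive _ _ _ X]add0r; apply: is_deriveD.
have phi0 : phi 0 = 0.
  by rewrite /phi addr0 horner_coef0 coef_poly /= divr1 subrr.
have d0 : 0 <= d by apply: le_trans sd.
have eta0 : 0 <= eta by apply: le_trans (Hk 0 _); rewrite ?normr0.
have mvt (a b : R) : a <= b -> (forall u, u \in `[a, b]%R -> `|u| <= `|s|) ->
   `|phi b - phi a| <= eta * `|s| ^+ k * (b - a).
  move=> ab Hab.
  have [u uab||c cab ->] := @MVT_segment R phi (fun u => derive1 f (t + u) - (taylor_poly k (derive1 f) t).[u]) a b ab.
  - apply: Hder; apply: le_trans sd; apply: Hab.
    by apply: subset_itvW uab.
  - by apply: derivable_within_continuous => u uab; have [] := Hder u (le_trans (Hab u uab) sd).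
  rewrite normrM [`|b - a|]ger0_norm ?subr_ge0 // ler_wpM2r ?subr_ge0 //.
  have cs := Hab c cab; apply: le_trans (IH' c (le_trans cs sd)) _.
  by rewrite ler_wpM2l // lerXn2r // nnegrE.
rewrite -/(phi s) -[phi s]subr0 -phi0 exprSr mulrA.
have [s0|s0] := leP 0 s.
  apply: le_trans (mvt 0 s s0 _) _ => [u|].
    by rewrite in_itv /= => /andP[u0 us]; rewrite !ger0_norm.
  by rewrite subr0 ler_wpM2l ?ler_norm // mulr_ge0 ?exprn_ge0.
rewrite distrC; apply: le_trans (mvt s 0 (ltW s0) _) _ => [u|].
  rewrite in_itv /= => /andP[us u0]; rewrite !ler0_norm ?lerN2 //; exact: ltW.
rewrite sub0r ler_wpM2l ?mulr_ge0 ?exprn_ge0 //.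
by rewrite -[leRHS]normrN ler_norm.
Qed.
End Taylor.

Section UniformTaylor.
Variable R : realType.
Implicit Types (f g : R -> R) (t s e : R) (K : set R).

(** Both remainder estimates are needed: the bound by [M] is uniform in t and leads
    to uniform Lipschitz constants, whereas the pointwise estimate by any [eta]
    makes the coefficient of order N meaningful. The degree of T may exceed N,
    which avoids truncations in products. *)
Definition uniform_taylor K e (N : nat) f : Prop :=
  exists (M : R) (L : nat), 0 <= M /\ forall t, K t -> exists T : {poly R},
   [/\ (size T <= L)%N, forall i, `|T`_i| <= M,
       forall s, `|s| <= e -> `|f (t + s) - T.[s]| <= M * `|s| ^+ N
     & forall eta, 0 < eta -> exists2 d, 0 < d &
         forall s, `|s| < d -> `|f (t + s) - T.[s]| <= eta * `|s| ^+ N].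

Lemma uniform_taylor_cst K e N (a : R) : uniform_taylor K e N (fun=> a).
Proof.
exists `|a|, 1%N; split => // t Kt; exists a%:P; split.
- exact: size_polyC_leq1.
- by move=> i; rewrite coefC; case: eqP => _ //; rewrite normr0.
- by move=> s _; rewrite hornerC subrr normr0 mulr_ge0 // exprn_ge0.
- move=> eta eta0; exists 1 => // s _.
  by rewrite hornerC subrr normr0 mulr_ge0 ?exprn_ge0 // ltW.
Qed.

Lemma uniform_taylorD K e N f g : uniform_taylor K e N f -> uniform_taylor K e N g ->
  uniform_taylor K e N (fun t => f t + g t).
Proof.
move=> [M1 [L1 [M10 H1]]] [M2 [L2 [M20 H2]]].
exists (M1 + M2), (maxn L1 L2); split => [|t Kt]; first exact: addr_ge0.
have [T1 [s1 c1 r1 p1]] := H1 t Kt; have [T2 [s2 c2 r2 p2]] := H2 t Kt.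
have tri s : `|f (t + s) + g (t + s) - (T1 + T2).[s]| <= `|f (t + s) - T1.[s]| + `|g (t + s) - T2.[s]|.
  by rewrite hornerD opprD addrACA ler_normD.
exists (T1 + T2); split.
- by apply: leq_trans (size_polyD _ _) _; rewrite geq_max !leq_max s1 s2 orbT.
- by move=> i; rewrite coefD; apply: le_trans (ler_normD _ _) _; rewrite lerD.
- by move=> s se; apply: le_trans (tri s) _; rewrite mulrDl lerD ?r1 ?r2.
- move=> eta eta0; have eta2 : 0 < eta / 2 by rewrite divr_gt0.
  have [d1 d10 h1] := p1 _ eta2; have [d2 d20 h2] := p2 _ eta2.
  exists (Num.min d1 d2) => [|s]; first by rewrite lt_min d10.
  rewrite lt_min => /andP[sd1 sd2]; apply: le_trans (tri s) _.
  by rewrite [eta]splitr mulrDl lerD ?h1 ?h2.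
Qed.

Lemma horner_bound (T : {poly R}) (L : nat) (M s : R) : (size T <= L)%N ->
  (forall i, `|T`_i| <= M) -> `|s| <= 1 -> `|T.[s]| <= L%:R * M.
Proof.
move=> sT cT s1; rewrite (horner_coef_wide s sT).
apply: le_trans (ler_norm_sum _ _ _) _.
have -> : L%:R * M = \sum_(i < L) M by rewrite sumr_const card_ord mulr_natl.
apply: ler_sum => i _; rewrite normrM -[M]mulr1 ler_pM // normrX.
exact: exprn_ile1.
Qed.

Lemma uniform_taylorM K e N f g : e <= 1 -> uniform_taylor K e N f -> uniform_taylor K e N g ->
  uniform_taylor K e N (fun t => f t * g t).
Proof.
move=> e1 [M1 [L1 [M10 H1]]] [M2 [L2 [M20 H2]]].
pose B1 := L1%:R * M1; pose B2 := L2%:R * M2 + M2.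
have B10 : 0 <= B1 by rewrite mulr_ge0.
have B20 : 0 <= B2 by rewrite addr_ge0 // mulr_ge0.
exists (L1%:R * (M1 * M2) + (M1 * B2 + B1 * M2)), (L1 + L2)%N; split => [|t Kt].
  by rewrite !addr_ge0 ?mulr_ge0.
have [T1 [s1 c1 r1 p1]] := H1 t Kt; have [T2 [s2 c2 r2 p2]] := H2 t Kt.
have tri s : `|s| <= 1 -> `|g (t + s)| <= B2 -> `|f (t + s) * g (t + s) - (T1 * T2).[s]| <=
  `|f (t + s) - T1.[s]| * B2 + B1 * `|g (t + s) - T2.[s]|.
  move=> ss gs; have -> : f (t + s) * g (t + s) - (T1 * T2).[s] =
    (f (t + s) - T1.[s]) * g (t + s) + T1.[s] * (g (t + s) - T2.[s]).
    by rewrite hornerM; ring.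
  apply: le_trans (ler_normD _ _) _; rewrite !normrM lerD //.
    by rewrite ler_wpM2l.
  by rewrite ler_wpM2r // (horner_bound s1).
have gB s : `|s| <= 1 -> `|g (t + s) - T2.[s]| <= M2 * `|s| ^+ N -> `|g (t + s)| <= B2.
  move=> ss H; rewrite -[g _](subrK T2.[s]) addrC.
  apply: le_trans (ler_normD _ _) _; rewrite lerD ?(horner_bound s2) //.
  by apply: le_trans H _; rewrite ler_piMr // exprn_ile1.
exists (T1 * T2); split.
- apply: leq_trans (size_polyMleq _ _) _; apply: leq_trans (leq_pred _) _.
  exact: leq_add.
- move=> i; apply: le_trans (_ : L1%:R * (M1 * M2) <= _); last first.
    by rewrite lerDl addr_ge0 // mulr_ge0.
  rewrite coefM; apply: le_trans (ler_norm_sum _ _ _) _.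
  have H j : `|T1`_j * T2`_(i - j)| <= if (j < L1)%N then M1 * M2 else 0.
    case: ltnP => jL; first by rewrite normrM ler_pM.
    by rewrite nth_default ?mul0r ?normr0 // (leq_trans s1).
  apply: le_trans (ler_sum _ (fun (j : 'I__) _ => H j)) _.
  rewrite -big_mkcond /=; have [iL|Li] := leqP L1 i.+1.
    by rewrite (big_ord_narrow iL) sumr_const card_ord (mulr_natl (M1 * M2) L1).
  rewrite sumr_const -[leLHS]mulr_natl ler_wpM2r ?mulr_ge0 // ler_nat.
  by apply: leq_trans (max_card _) _; rewrite card_ord ltnW.
- move=> s se; have ss : `|s| <= 1 by apply: le_trans e1.
  apply: le_trans (tri s ss (gB s ss (r2 s se))) _.
  apply: le_trans (_ : (M1 * B2 + B1 * M2) * `|s| ^+ N <= _); last first.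
    by rewrite ler_wpM2r ?exprn_ge0 // lerDr !mulr_ge0.
  rewrite mulrDl lerD //; first by rewrite mulrAC ler_wpM2r // r1.
  by rewrite -mulrA ler_wpM2l // r2.
- move=> eta eta0; pose D := B1 + B2 + M2 + 1.
  have D0 : 0 < D by apply: ltr_wpDl => //; do 2 apply: addr_ge0 => //.
  have eta2 : 0 < eta / (2 * D) by rewrite divr_gt0 // mulr_gt0.
  have [d1 d10 h1] := p1 _ eta2; have [d2 d20 h2] := p2 _ eta2.
  have [d3 d30 h3] := p2 (M2 + 1) (ltr_wpDl M20 ltr01).
  exists (Num.min (Num.min d1 d2) (Num.min d3 1)) => [|s].
    by rewrite !lt_min d10 d20 d30 ltr01.
  rewrite !lt_min => /andP[/andP[sd1 sd2] /andP[sd3 sd4]].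
  have ss := ltW sd4.
  have gB' : `|g (t + s)| <= B2 + 1.
    rewrite -[g _](subrK T2.[s]) addrC.
    apply: le_trans (ler_normD _ _) _; rewrite /B2 -addrA lerD ?(horner_bound s2) //.
    by apply: le_trans (h3 s sd3) _; rewrite ler_piMr ?addr_ge0 // exprn_ile1.
  have -> : f (t + s) * g (t + s) - (T1 * T2).[s] =
    (f (t + s) - T1.[s]) * g (t + s) + T1.[s] * (g (t + s) - T2.[s]).
    by rewrite hornerM; ring.
  apply: le_trans (ler_normD _ _) _; rewrite !normrM.
  apply: le_trans (lerD (ler_pM _ _ (h1 s sd1) gB') (ler_pM _ _ (horner_bound s1 c1 ss) (h2 s sd2))) _ => //.
  have sN : 0 <= `|s| ^+ N by rewrite exprn_ge0.
  apply: le_trans (_ : eta / (2 * D) * `|s| ^+ N * (2 * D) <= _); last first.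
    by rewrite mulrAC divfK // gt_eqF // mulr_gt0.
  rewrite [B1 * _]mulrC -mulrDr; apply: ler_wpM2l.
    by apply: mulr_ge0 => //; apply: ltW.
  by rewrite /D; move: B10 B20 M20; clear; lra.
Qed.

Lemma uniform_taylor_sum K e N (I : Type) (r : seq I) (P : pred I) (F : I -> R -> R) :
  (forall i, uniform_taylor K e N (F i)) ->
  uniform_taylor K e N (fun t => \sum_(i <- r | P i) F i t).
Proof.
move=> H; elim: r => [|i r IH].
  by under eq_fun do rewrite big_nil; exact: uniform_taylor_cst.
under eq_fun do rewrite big_cons.
by case: (P i) => //; apply: uniform_taylorD.
Qed.

Lemma uniform_taylor_prod K e N (I : Type) (r : seq I) (P : pred I) (F : I -> R -> R) :
  e <= 1 -> (forall i, uniform_taylor K e N (F i)) ->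
  uniform_taylor K e N (fun t => \prod_(i <- r | P i) F i t).
Proof.
move=> e1 H; elim: r => [|i r IH].
  by under eq_fun do rewrite big_nil; exact: uniform_taylor_cst.
under eq_fun do rewrite big_cons.
by case: (P i) => //; apply: uniform_taylorM.
Qed.

Lemma uniform_taylorX K e N f k : e <= 1 -> uniform_taylor K e N f ->
  uniform_taylor K e N (fun t => f t ^+ k).
Proof.
move=> e1 H; elim: k => [|k IH]; first exact: uniform_taylor_cst.
by under eq_fun do rewrite exprS; apply: uniform_taylorM.
Qed.

Lemma uniform_taylor_meval K e N n (q : mpoly n R) (c : 'I_n -> R -> R) :
  e <= 1 -> (forall i, uniform_taylor K e N (c i)) ->
  uniform_taylor K e N (fun t => meval (c^~ t) q).
Proof.
move=> e1 H; rewrite /meval /mmap.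
apply: uniform_taylor_sum => m; apply: uniform_taylorM => //; first exact: uniform_taylor_cst.
rewrite /mmap1; apply: uniform_taylor_prod => // i.
exact: uniform_taylorX.
Qed.

End UniformTaylor.

Section ClassC.
Local Open Scope classical_set_scope.
Variable R : realType.

Lemma derive1n_coord n k (I : set R) (c : R -> 'rV[R]_n) (j : 'I_n) :
  open I -> class_C k I c ->
  forall i, (i <= k)%N -> forall t, I t ->
    derive1n i (fun t => c t 0 j) t = derive1n i c t 0 j.
Proof.
move=> oI [dc _]; elim=> [//|i IH] ik t It.
have near_eq : \forall u \near t, derive1n i (fun t => c t 0 j) u = derive1n i c u 0 j.
  have := open_nbhs_nbhs (conj oI It); apply: filterS => u Iu.
  by apply: IH => //; apply: ltnW.
rewrite !derive1nS !derive1E (near_eq_derive _ near_eq) derive_mx ?mxE //.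
exact: dc.
Qed.

Lemma derivable_coord n k (I : set R) (c : R -> 'rV[R]_n) (j : 'I_n) :
  open I -> class_C k I c ->
  forall i, (i < k)%N -> forall t, I t ->
    derivable (derive1n i (fun t => c t 0 j)) t 1.
Proof.
move=> oI cc i ik t It.
have near_eq : \forall u \near t, derive1n i c u 0 j = derive1n i (fun t => c t 0 j) u.
  have := open_nbhs_nbhs (conj oI It); apply: filterS => u Iu.
  by rewrite (derive1n_coord _ oI cc) // ltnW.
apply: near_eq_derivable near_eq _.
by have [dc _] := cc; have /derivable_mxP := dc i ik t It; apply.
Qed.

Lemma continuous_coord n k (I : set R) (c : R -> 'rV[R]_n) (j : 'I_n) :
  open I -> class_C k I c ->
  forall i, (i <= k)%N -> forall t, I t ->
    {for t, continuous (derive1n i (fun t => c t 0 j))}.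
Proof.
move=> oI cc i; rewrite leq_eqVlt => /orP[/eqP-> |ik] t It; last first.
  apply: differentiable_continuous; apply/derivable1_diffP.
  exact: derivable_coord cc _ _ _ _.
have near_eq : \forall u \near t, derive1n k c u 0 j = derive1n k (fun t => c t 0 j) u.
  have := open_nbhs_nbhs (conj oI It); apply: filterS => u Iu.
  by rewrite (derive1n_coord _ oI cc).
have [_ ck] := cc.
rewrite /prop_for /continuous_at (derive1n_coord _ oI cc) //.
apply: cvg_trans (near_eq_cvg near_eq) _.
exact: (continuous_comp (ck t It) (@coord_continuous _ _ _ _ _ _)).
Qed.

Lemma continuous_bounded (f : R -> R) (a b : R) :
  (forall t, a <= t <= b -> {for t, continuous f}) ->
  exists2 M, 0 <= M & forall t, a <= t <= b -> `|f t| <= M.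
Proof.
move=> cf; have [ab|ba] := leP a b; last first.
  by exists 0 => // t /andP[h1 h2]; move: (lt_le_trans ba (le_trans h1 h2)); rewrite ltxx.
have cn : {within `[a, b], continuous (fun t => `|f t|)}.
  apply: continuous_in_subspaceT => t; rewrite inE /= in_itv /= => tab.
  exact: (continuous_comp (cf t tab) (@norm_continuous _ _ _)).
have [x xab Hx] := EVT_max ab cn.
exists `|f x| => // t tab; apply: Hx; by rewrite in_itv.
Qed.

Lemma continuous_at_dist (f : R -> R) t : {for t, continuous f} ->
  forall eta, 0 < eta -> exists2 d, 0 < d &
    forall s, `|s| <= d -> `|f (t + s) - f t| <= eta.
Proof.
move=> /cvgrPdist_le H eta eta0; have [/= d d0 Hd] := H _ eta0.
exists (d / 2) => [|s sd]; first by rewrite divr_gt0.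
rewrite distrC; apply: Hd; rewrite /ball_ /= opprD addNKr normrN.
by apply: le_lt_trans sd _; rewrite ltr_pdivrMr // mulr_natr mulr2n ltrDr.
Qed.

Lemma class_C_uniform_taylor n k (I : set R) (c : R -> 'rV[R]_n) t1 e :
  open I -> class_C k I c -> 0 < e ->
  (forall s, `|s| <= e + e -> I (t1 + s)) ->
  forall j, uniform_taylor [set t | `|t - t1| <= e] e k (fun t => c t 0 j).
Proof.
move=> oI cc e0 HI j; set f := fun t => c t 0 j.
have It t : `|t - t1| <= e + e -> I t by move=> /HI; rewrite addrC subrK.
have cf i t : (i <= k)%N -> `|t - t1| <= e + e -> {for t, continuous (derive1n i f)}.
  by move=> ik /It; apply: continuous_coord cc _ _ _.
have [M M0 HM] : exists2 M : R, 0 <= M & forall i, (i < k.+1)%N ->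
    forall t, `|t - t1| <= e + e -> `|derive1n i f t| <= M.
  apply: (uniform_bound (P := fun i M => forall t, `|t - t1| <= e + e -> `|derive1n i f t| <= M)).
    by move=> i C C' HC CC' t Ht; apply: le_trans (HC t Ht) CC'.
  move=> i ik; have [t|M M0 HM] := @continuous_bounded (derive1n i f) (t1 - (e + e)) (t1 + (e + e)).
    by rewrite -ler_distl; apply: cf.
  by exists M => // t Ht; apply: HM; rewrite -ler_distl.
exists (M + M), k.+1; split => [|t /= Kt]; first exact: addr_ge0.
have Ks s : `|s| <= e -> `|t + s - t1| <= e + e.
  by move=> se; rewrite addrAC; apply: le_trans (ler_normD _ _) _; rewrite lerD.
have Kt' : `|t - t1| <= e + e by apply: le_trans Kt _; rewrite lerDl ltW.
exists (taylor_poly k f t); split.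
- exact: size_poly.
- move=> i; rewrite coef_poly; case: ltnP => ik; last by rewrite normr0 addr_ge0.
  rewrite normrM normfV normr_nat; apply: le_trans (_ : M <= _); last by rewrite lerDl.
  rewrite ler_pdivrMr ?ltr0n ?fact_gt0 //; apply: le_trans (HM i ik t Kt') _.
  by rewrite ler_peMr // ler1n fact_gt0.
- move=> s se; apply: (@taylor_remainder _ k f t e) => // [i u ik ue|u ue].
    exact: (derivable_coord oI cc ik (It _ (Ks _ ue))).
  by apply: le_trans (ler_normB _ _) _; rewrite lerD // HM // Ks.
- move=> eta eta0; have [d d0 Hd] := continuous_at_dist (cf k t (leqnn k) Kt') eta0.
  exists (Num.min d e) => [|s]; first by rewrite lt_min d0.
  rewrite lt_min => /andP[sd se].
  have sm : `|s| <= Num.min d e by rewrite le_min !ltW.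
  apply: (@taylor_remainder _ k f t (Num.min d e)) => // [i u ik|u].
    rewrite le_min => /andP[_ ue].
    exact: (derivable_coord oI cc ik (It _ (Ks _ ue))).
  by rewrite le_min => /andP[ud _]; apply: Hd.
Qed.
End ClassC.

(** * The action on row vectors *)

Section FiniteBound.
Variable R : realType.

Lemma finite_positive_bound (T : finType) (f : T -> R) :
  (forall i, 0 < f i) -> exists2 e : R, 0 < e & forall i, e <= f i.
Proof.
move=> f0; pose S := \sum_i (f i)^-1 + 1.
have S0 : 0 < S by rewrite ltr_wpDl // sumr_ge0 // => i _; rewrite invr_ge0 ltW.
exists S^-1 => [|i]; first by rewrite invr_gt0.
rewrite -[f i]invrK lef_pV2 ?posrE ?invr_gt0 // /S (bigD1 i) //= -addrA lerDl.
by rewrite addr_ge0 // sumr_ge0 // => j _; rewrite invr_ge0 ltW.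
Qed.
End FiniteBound.

Section Action.
Variables (R : realType) (gT : finGroupType) (G : {group gT}) (m : nat).
Variable rG : mx_representation R G m.
Implicit Types (x y w : 'rV[R]_m) (g h : gT).

Definition act x g := x *m rG g.

Lemma act1 x : act x 1%g = x.
Proof. by rewrite /act repr_mx1 mulmx1. Qed.

Lemma actM x g h : g \in G -> h \in G -> act (act x g) h = act x (g * h)%g.
Proof. by move=> Gg Gh; rewrite /act repr_mxM // mulmxA. Qed.

Lemma actK x g : g \in G -> act (act x g) g^-1%g = x.
Proof. by move=> Gg; rewrite actM ?groupV // mulgV act1. Qed.

Lemma actVK x g : g \in G -> act (act x g^-1%g) g = x.
Proof. by move=> Gg; rewrite actM ?groupV // mulVg act1. Qed.

Lemma actB x y g : act (x - y) g = act x g - act y g.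
Proof. exact: mulmxBl. Qed.

Lemma actZ (a : R) x g : act (a *: x) g = a *: act x g.
Proof. by rewrite /act scalemxAl. Qed.

Lemma coord_le_norm x (j : 'I_m) : `|x 0 j| <= `|x|.
Proof. by rewrite [leRHS]/Num.norm /= mx_normrE; apply: (le_bigmax _ _ (0, j)). Qed.

Lemma norm_le_coord x (a : R) : 0 <= a -> (forall j, `|x 0 j| <= a) -> `|x| <= a.
Proof.
move=> a0 H; rewrite [leLHS]/Num.norm /= mx_normrE; apply: bigmax_le => // -[i j] _ /=.
by rewrite ord1.
Qed.

(** The norm on row vectors is the supremum norm, which G does not preserve. *)
Lemma act_bounded : exists2 k : R, 1 <= k &
  forall x g, g \in G -> `|act x g| <= k * `|x|.
Proof.
pose s g := \sum_i \sum_j `|rG g i j|.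
have s0 g : 0 <= s g by apply: sumr_ge0 => i _; apply: sumr_ge0.
exists (1 + \sum_(g in G) s g) => [|x g Gg]; first by rewrite lerDl sumr_ge0.
apply: norm_le_coord => [|j].
  by rewrite mulr_ge0 // addr_ge0 // sumr_ge0.
apply: le_trans (_ : s g * `|x| <= _); last first.
  rewrite ler_wpM2r // (bigD1 g) //= addrCA lerDl addr_ge0 // sumr_ge0 //.
rewrite /act mxE; apply: le_trans (ler_norm_sum _ _ _) _.
rewrite /s mulr_suml; apply: ler_sum => i _; rewrite normrM mulrC ler_pM ?coord_le_norm //.
by rewrite (bigD1 j) //= lerDl sumr_ge0.
Qed.

Lemma orbit_separated x : exists2 e : R, 0 < e & forall g h, g \in G -> h \in G ->
  `|act x g - act x h| <= e -> act x g = act x h.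
Proof.
pose f (p : gT * gT) := if act x p.1 == act x p.2 then 1 else `|act x p.1 - act x p.2| / 2.
have [p|e e0 He] := @finite_positive_bound R _ f.
  by rewrite /f; case: eqP => // /eqP ne; rewrite divr_gt0 // normr_gt0 subr_eq0.
exists e => // g h Gg Gh le_e; apply/eqP/negPn/negP => ne.
have := He (g, h); rewrite /f /= (negbTE ne) => /(le_trans le_e).
have : 0 < `|act x g - act x h| by rewrite normr_gt0 subr_eq0.
by move=> n0; rewrite leNgt ltr_pdivrMr // ltr_pMr // ltr1n.
Qed.

Lemma rstabP x g : reflect (g \in G /\ act x g = x) (g \in rstab rG x).
Proof. by rewrite inE; apply: (iffP andP) => -[Gg /eqP E]; split. Qed.

(** Near x0, points of one G-orbit are related by the isotropy group of x0: the
    part of the slice theorem that a finite group needs. *)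
Lemma slice_radius x0 : exists2 r : R, 0 < r & forall x g, g \in G ->
  `|x - x0| < r -> `|act x g - x0| < r -> g \in rstab rG x0.
Proof.
have [k k1 Hk] := act_bounded.
have k0 : 0 < k by apply: lt_le_trans k1.
have [e e0 He] := orbit_separated x0.
exists (e / (2 * k)) => [|x g Gg xr gr]; first by rewrite divr_gt0 // mulr_gt0.
apply/rstabP; split => //; rewrite -[RHS]act1; apply: He => //.
rewrite act1 -(subrKA (act x g)); apply: le_trans (ler_normD _ _) _.
have -> : e = k * (e / (2 * k)) + e / 2 by field; rewrite gt_eqF.
apply: lerD; last first.
  apply: le_trans (ltW gr) _; rewrite ler_pM2l // lef_pV2 ?posrE ?mulr_gt0 //.
  by rewrite ler_peMr.
by rewrite -actB; apply: le_trans (Hk _ _ Gg) _; rewrite distrC ler_pM2l // ltW.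
Qed.
(** All lifts near t have their 1-jet at t in the G-orbit of (x, w). *)
Definition jet (L : R -> 'rV[R]_m -> Prop) (t : R) x w := forall eta : R, 0 < eta -> exists2 d : R, 0 < d &
  forall t' y, `|t' - t| < d -> L t' y -> exists2 g, g \in G &
    `|y - act x g| <= eta /\
    `|y - act x g - (t' - t) *: act w g| <= eta * `|t' - t|.

End Action.

(** * Polynomial functions and their expansions *)

Section PolynomialFunctions.
Variables (R : realType) (m : nat).
Local Notation V := 'rV[R]_m.
Implicit Types (f g : V -> R) (x y v : V).

Definition polyfun f := exists p : mpoly m R, forall x, f x = meval (x 0) p.

Lemma polyfun_cst (a : R) : polyfun (fun=> a).
Proof. by exists (mpolyC _ a) => x; rewrite mevalC. Qed.

Lemma polyfun_coord (i : 'I_m) : polyfun (fun x => x 0 i).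
Proof. by exists (mpolyX _ (mnm1 i)) => x; rewrite mevalXU. Qed.

Lemma polyfunD f g : polyfun f -> polyfun g -> polyfun (fun x => f x + g x).
Proof. by move=> [p Hp] [q Hq]; exists (p + q) => x; rewrite mevalD Hp Hq. Qed.

Lemma polyfunM f g : polyfun f -> polyfun g -> polyfun (fun x => f x * g x).
Proof. by move=> [p Hp] [q Hq]; exists (p * q) => x; rewrite mevalM Hp Hq. Qed.

Lemma polyfun_sum (T : Type) (r : seq T) (P : pred T) (F : T -> V -> R) :
  (forall i, P i -> polyfun (F i)) -> polyfun (fun x => \sum_(i <- r | P i) F i x).
Proof.
move=> H; elim: r => [|i r IH].
  by under eq_fun do rewrite big_nil; exact: polyfun_cst.
under eq_fun do rewrite big_cons.
by have := H i; case: (P i) => // /(_ isT) Hi; apply: polyfunD.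
Qed.

Lemma polyfun_prod (T : Type) (r : seq T) (P : pred T) (F : T -> V -> R) :
  (forall i, P i -> polyfun (F i)) -> polyfun (fun x => \prod_(i <- r | P i) F i x).
Proof.
move=> H; elim: r => [|i r IH].
  by under eq_fun do rewrite big_nil; exact: polyfun_cst.
under eq_fun do rewrite big_cons.
by have := H i; case: (P i) => // /(_ isT) Hi; apply: polyfunM.
Qed.

Lemma polyfunX f k : polyfun f -> polyfun (fun x => f x ^+ k).
Proof.
move=> H; elim: k => [|k IH]; first exact: polyfun_cst.
by under eq_fun do rewrite exprS; apply: polyfunM.
Qed.

Lemma polyfun_meval n (p : mpoly n R) (F : 'I_n -> V -> R) :
  (forall i, polyfun (F i)) -> polyfun (fun x => meval (F^~ x) p).
Proof.
move=> H; under eq_fun do rewrite mevalE.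
apply: polyfun_sum => k _; apply: polyfunM; first exact: polyfun_cst.
by apply: polyfun_prod => i _; apply: polyfunX.
Qed.

Lemma polyfun_affine f (A : 'M[R]_m) v : polyfun f -> polyfun (fun x => f (x *m A + v)).
Proof.
move=> [p Hp]; have H (i : 'I_m) : polyfun (fun x => (x *m A + v) 0 i).
  under eq_fun do rewrite !mxE; apply: polyfunD; last exact: polyfun_cst.
  by apply: polyfun_sum => j _; apply: polyfunM; [exact: polyfun_coord | exact: polyfun_cst].
have [q Hq] := polyfun_meval p H; exists q => x.
by rewrite Hp -Hq.
Qed.

(** Polynomial functions are the least class that contains constants and
    coordinates and is closed under sums and products. *)
Lemma polyfun_ind (P : (V -> R) -> Prop) :
  (forall a, P (fun=> a)) -> (forall i, P (fun x => x 0 i)) ->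
  (forall f g, P f -> P g -> P (fun x => f x + g x)) ->
  (forall f g, P f -> P g -> P (fun x => f x * g x)) ->
  forall f, polyfun f -> P f.
Proof.
move=> Pc Px PD PM f [p Hp]; have -> : f = fun x => meval (x 0) p by apply/funext.
under eq_fun do rewrite mevalE.
elim: (msupp p) => [|k r IH].
  by under eq_fun do rewrite big_nil; exact: Pc.
under eq_fun do rewrite big_cons.
apply: (PD (fun x => mcoeff k p * \prod_i x 0 i ^+ k i)) => //.
apply: (PM (fun=> mcoeff k p) (fun x => \prod_i x 0 i ^+ k i)); first exact: Pc.
elim: (index_enum _) => [|i s IHs].
  by under eq_fun do rewrite big_nil; exact: Pc.
under eq_fun do rewrite big_cons.
apply: (PM (fun x => x 0 i ^+ k i)) => //.
elim: (k i) => [|n IHn]; first exact: Pc.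
under eq_fun do rewrite exprS.
exact: (PM (fun x => x 0 i) (fun x => x 0 i ^+ n)).
Qed.

Lemma polyfun_lipschitz f v : polyfun f -> exists2 C : R, 0 <= C &
  forall x, `|x| <= 1 -> `|f (v + x) - f v| <= C * `|x|.
Proof.
move: f; apply: polyfun_ind => [a|i|f g [C1 C10 H1] [C2 C20 H2]|f g [C1 C10 H1] [C2 C20 H2]].
- by exists 0 => // x _; rewrite subrr normr0 mul0r.
- by exists 1 => // x _; rewrite mxE addrAC subrr add0r mul1r; apply: coord_le_norm.
- exists (C1 + C2) => [|x x1]; first exact: addr_ge0.
  by rewrite opprD addrACA mulrDl; apply: le_trans (ler_normD _ _) _; rewrite lerD ?H1 ?H2.
- exists (C1 * (`|g v| + C2) + `|f v| * C2) => [|x x1].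
    by rewrite addr_ge0 ?mulr_ge0 // addr_ge0.
  have -> : f (v + x) * g (v + x) - f v * g v =
    (f (v + x) - f v) * (g v + (g (v + x) - g v)) + f v * (g (v + x) - g v) by ring.
  apply: le_trans (ler_normD _ _) _; rewrite !normrM mulrDl; apply: lerD.
    rewrite mulrAC; apply: ler_pM => //; first exact: H1.
    apply: le_trans (ler_normD _ _) _; rewrite lerD2l.
    by apply: le_trans (H2 x x1) _; rewrite ler_piMr.
  by rewrite -mulrA ler_wpM2l // H2.
Qed.

(** Reduction to the unit ball by homogeneity. *)
Lemma homogeneous_bound f r : polyfun f ->
  (forall (s : R) x, f (s *: x) = s ^+ r * f x) ->
  exists2 C : R, 0 <= C & forall x, `|f x| <= C * `|x| ^+ r.
Proof.
move=> pf hf; have [C C0 HC] := polyfun_lipschitz 0 pf.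
exists (C + `|f 0|) => [|x]; first exact: addr_ge0.
have H1 y : `|y| <= 1 -> `|f y| <= C + `|f 0|.
  move=> y1; have := HC y y1; rewrite add0r => h.
  rewrite -(subrK (f 0) (f y)); apply: le_trans (ler_normD _ _) _; rewrite lerD //.
  by apply: le_trans h _; rewrite ler_piMr.
have [->|x0] := eqVneq x 0.
  rewrite normr0; case: r hf => [|r] hf; first by rewrite expr0 mulr1 lerDr.
  by rewrite -(scale0r 0) hf expr0n mul0r normr0 mulr0.
have n0 : 0 < `|x| by rewrite normr_gt0.
have -> : x = `|x| *: (`|x|^-1 *: x) by rewrite scalerA divff ?scale1r // gt_eqF.
rewrite hf normrM normrX normr_id mulrC [`|_ *: (_ *: x)|]normrZ normrZ normr_id.
rewrite normfV normr_id mulVf ?gt_eqF // mulr1 ler_wpM2r ?exprn_ge0 //.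
by apply: H1; rewrite normrZ normfV normr_id mulVf // gt_eqF.
Qed.

(** [T x] is the restriction of f to the line through v in direction x, so that
    its r-th coefficient is the homogeneous part of degree r of f at v. *)
Definition jetpoly v d f (T : V -> {poly R}) : Prop :=
  [/\ forall r, polyfun (fun x => (T x)`_r),
      forall r (s : R) x, (T (s *: x))`_r = s ^+ r * (T x)`_r,
      forall x, (size (T x) <= d.+1)%N
    & forall (s : R) x, f (v + s *: x) = (T x).[s]].

Lemma jetpoly_cst v d a : jetpoly v d (fun=> a) (fun=> a%:P).
Proof.
split => [r|r s x|x|s x].
- exact: polyfun_cst.
- by rewrite coefC; case: r => [|r]; rewrite ?expr0 ?mul1r //= mulr0.
- by apply: leq_trans (size_polyC_leq1 _) _.
- by rewrite hornerC.
Qed.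

Lemma jetpoly_coord v (i : 'I_m) :
  jetpoly v 1 (fun x => x 0 i) (fun x => (v 0 i)%:P + x 0 i *: 'X).
Proof.
split => [r|r s x|x|s x].
- under eq_fun do rewrite coefD coefC coefZ coefX.
  apply: polyfunD; first exact: polyfun_cst.
  by apply: polyfunM; [exact: polyfun_coord | exact: polyfun_cst].
- rewrite !coefD !coefC !coefZ !coefX mxE.
  by case: r => [|[|r]] /=; rewrite ?expr0 ?expr1; ring.
- apply: leq_trans (size_polyD _ _) _; rewrite geq_max (leq_trans (size_polyC_leq1 _)) //=.
  by apply: leq_trans (size_scale_leq _ _) _; rewrite size_polyX.
- by rewrite !hornerE !mxE mulrC.
Qed.

Lemma jetpoly_le v d d' f T : (d <= d')%N -> jetpoly v d f T -> jetpoly v d' f T.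
Proof. by move=> dd [h1 h2 h3 h4]; split => // x; apply: leq_trans (h3 x) _. Qed.

Lemma jetpolyD v d f g T U : jetpoly v d f T -> jetpoly v d g U ->
  jetpoly v d (fun x => f x + g x) (fun x => T x + U x).
Proof.
move=> [h1 h2 h3 h4] [k1 k2 k3 k4]; split => [r|r s x|x|s x].
- by under eq_fun do rewrite coefD; apply: polyfunD.
- by rewrite !coefD h2 k2 mulrDr.
- by apply: leq_trans (size_polyD _ _) _; rewrite geq_max h3 k3.
- by rewrite hornerD h4 k4.
Qed.

Lemma jetpolyM v d d' f g T U : jetpoly v d f T -> jetpoly v d' g U ->
  jetpoly v (d + d') (fun x => f x * g x) (fun x => T x * U x).
Proof.
move=> [h1 h2 h3 h4] [k1 k2 k3 k4]; split => [r|r s x|x|s x].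
- under eq_fun do rewrite coefM; apply: polyfun_sum => i _; exact: polyfunM.
- rewrite !coefM mulr_sumr; apply: eq_bigr => i _; rewrite h2 k2.
  have -> : s ^+ r = s ^+ i * s ^+ (r - i) by rewrite -exprD subnKC // -ltnS.
  ring.
- apply: leq_trans (size_polyMleq _ _) _.
  by have := leq_add (h3 x) (k3 x); rewrite addSn addnS; case: (_ + _)%N.
- by rewrite hornerM h4 k4.
Qed.

Lemma jetpoly_monomial v (e : multinom m) :
  exists T, jetpoly v (mdeg e) (fun x => \prod_i x 0 i ^+ e i) T.
Proof.
rewrite mdegE; elim: (index_enum _) => [|i s [T IH]].
  exists (fun=> 1%:P); rewrite big_nil.
  under eq_fun do rewrite big_nil; exact: jetpoly_cst.
have [U HU] : exists U, jetpoly v (e i) (fun x => x 0 i ^+ e i) U.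
  elim: (e i) => [|n [U HU]].
    by exists (fun=> 1%:P); under eq_fun do rewrite expr0; exact: jetpoly_cst.
  exists (fun x => ((v 0 i)%:P + x 0 i *: 'X) * U x); under eq_fun do rewrite exprS.
  exact: (jetpolyM (jetpoly_coord v i) HU).
exists (fun x => U x * T x); rewrite big_cons; under [X in jetpoly _ _ X]eq_fun do rewrite big_cons.
exact: (jetpolyM HU IH).
Qed.

Lemma jetpoly_meval v d (p : mpoly m R) : (pdeg p <= d)%N ->
  exists T, jetpoly v d (fun x => meval (x 0) p) T.
Proof.
move=> pd; have Hd e : e \in msupp p -> (mdeg e <= d)%N.
  by move=> /msize_mdeg_lt h; apply: leq_trans pd; rewrite /pdeg; case: (mmeasure _ _) h.
under [X in jetpoly _ _ X]eq_fun do rewrite mevalE.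
elim: (msupp p) Hd => [|e r IH] Hd.
  exists (fun=> 0%:P); under eq_fun do rewrite big_nil; exact: jetpoly_cst.
have [T HT] := IH (fun e' h => Hd e' (mem_behead (s := e :: r) h)).
have [U HU] := jetpoly_monomial v e.
exists (fun x => (mcoeff e p)%:P * U x + T x); under eq_fun do rewrite big_cons.
apply: jetpolyD HT; apply: (@jetpoly_le _ (0 + mdeg e)); first exact/Hd/mem_head.
exact: (jetpolyM (jetpoly_cst v 0 _) HU).
Qed.
End PolynomialFunctions.

(** * Invariants attached to an orbit *)

Section Invariants.
Variables (R : realType) (gT : finGroupType) (G : {group gT}) (m : nat).
Variable rG : mx_representation R G m.
Hypothesis rG_orth : orthogonal_repr rG.
Local Notation V := 'rV[R]_m.
Local Notation act := (act rG).
Implicit Types (f : V -> R) (x y z v w : V) (g h : gT).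

Definition invariant f := forall g, g \in G -> forall x, f (act x g) = f x.

Definition dot x y := \sum_j x 0 j * y 0 j.

Lemma dotE x y : dot x y = (x *m y^T) 0 0.
Proof. by rewrite mxE; apply: eq_bigr => j _; rewrite mxE. Qed.

Lemma dot_act x y g : g \in G -> dot (act x g) (act y g) = dot x y.
Proof.
move=> Gg; rewrite !dotE /act trmx_mul mulmxA -[x *m _ *m _]mulmxA rG_orth //.
by rewrite mulmx1.
Qed.

Lemma dot_actV x y g : g \in G -> dot (act x g) y = dot x (act y g^-1%g).
Proof. by move=> Gg; rewrite -{1}(actVK rG y Gg) dot_act. Qed.

Lemma dotBl x y z : dot (x - y) z = dot x z - dot y z.
Proof. by rewrite /dot -sumrB; apply: eq_bigr => j _; rewrite !mxE mulrBl. Qed.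

Lemma dot_ge0 x : 0 <= dot x x.
Proof. by apply: sumr_ge0 => j _; rewrite -expr2 sqr_ge0. Qed.

Lemma sqr_norm_le_dot x : `|x| ^+ 2 <= dot x x.
Proof.
have H j : x 0 j ^+ 2 <= dot x x.
  rewrite /dot (bigD1 j) //= -expr2 lerDl; apply: sumr_ge0 => i _.
  by rewrite -expr2 sqr_ge0.
have s0 := dot_ge0 x.
apply: le_trans (_ : Num.sqrt (dot x x) ^+ 2 <= _); last by rewrite sqr_sqrtr.
rewrite ler_pXn2r ?nnegrE ?sqrtr_ge0 //; apply: norm_le_coord => [|j]; first exact: sqrtr_ge0.
by rewrite -sqrtr_sqr ler_sqrt.
Qed.

Lemma dot_eq0 x : dot x x = 0 -> x = 0.
Proof.
move=> h; have := sqr_norm_le_dot x; rewrite h => h'.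
apply/eqP; rewrite -normr_eq0 -sqrf_eq0; apply/eqP/le_anti.
by rewrite h' sqr_ge0.
Qed.

Lemma polyfun_dotr y : polyfun (fun x => dot x y).
Proof. by apply: polyfun_sum => j _; apply: polyfunM; [exact: polyfun_coord | exact: polyfun_cst]. Qed.

Lemma polyfun_sqdist y : polyfun (fun x => dot (x - y) (x - y)).
Proof.
apply: polyfun_sum => j _; under eq_fun do rewrite !mxE.
by apply: polyfunM; apply: polyfunD; by [exact: polyfun_coord | exact: polyfun_cst].
Qed.

(** Invariant because G acts by isometries, and small only near the orbit of z. *)
Definition orbit_product z x := \prod_(g in G) dot (x - act z g) (x - act z g).

Lemma polyfun_orbit_product z : polyfun (orbit_product z).
Proof. by apply: polyfun_prod => g _; apply: polyfun_sqdist. Qed.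

Lemma orbit_product_invariant z : invariant (orbit_product z).
Proof.
move=> h Gh x; rewrite /orbit_product (reindex_inj (mulIg h)) /=.
apply: eq_big => [g|g Gg]; first by rewrite groupMr.
have {}Gg : g \in G by rewrite groupMr in Gg.
by rewrite -actM // -actB dot_act.
Qed.

Lemma orbit_product_id z : orbit_product z z = 0.
Proof. by rewrite /orbit_product (bigD1 1%g) //= act1 subrr [dot _ _]big1 ?mul0r // => j _; rewrite mxE mul0r. Qed.

Lemma orbit_product_small z x (eta : R) : 0 <= eta ->
  orbit_product z x < (eta ^+ 2) ^+ #|G| ->
  exists2 g, g \in G & `|x - act z g| < eta.
Proof.
move=> eta0 H; apply: contrapT => nH; move: H; apply/negP; rewrite -leNgt.
rewrite -prodr_const; apply: ler_prod => g Gg; rewrite exprn_ge0 //=.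
apply: le_trans (sqr_norm_le_dot _); rewrite ler_pXn2r ?nnegrE // leNgt.
by apply/negP => h; apply: nH; exists g.
Qed.

(** The roots are the <x, u g>. Taking one factor for each coset of the stabilizer of
    u, rather than one for each element of G, keeps the degree at the index of
    the stabilizer. *)
Definition orbit_poly (u : V) (x : V) : {poly R} :=
  \prod_(A in rcosets (rstab rG u) G) ('X - (dot x (act u (repr A)))%:P).

Lemma act_repr_rcoset u g : g \in G -> act u (repr (rstab rG u :* g)%g) = act u g.
Proof.
move=> Gg; case: repr_rcosetP => h Sh.
by have [Gh e] := rstabP _ _ _ Sh; rewrite -actM // e.
Qed.

Lemma orbit_poly_invariant u h x : h \in G -> orbit_poly u (act x h) = orbit_poly u x.
Proof.
move=> Gh; rewrite /orbit_poly.
pose S := rstab rG u.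
have sub : forall A, A \in rcosets S G -> exists2 g, g \in G & A = (S :* g)%g.
  by move=> A /rcosetsP[g Gg ->]; exists g.
rewrite (reindex_onto (fun A => A :* h)%g (fun A => A :* h^-1)%g) /=; last first.
  by move=> A _; rewrite rcosetKV.
apply: eq_big => [A|A].
  rewrite rcosetK eqxx andbT; apply/idP/idP => /sub[g Gg].
    move=> e; apply/rcosetsP; exists (g * h^-1)%g; first by rewrite groupM ?groupV.
    by rewrite rcosetM -e rcosetK.
  by move=> ->; apply/rcosetsP; exists (g * h)%g; rewrite ?groupM // rcosetM.
rewrite rcosetK eqxx andbT => /sub[g Gg e].
have Gg' : (g * h^-1)%g \in G by rewrite groupM ?groupV.
have -> : A = (S :* (g * h^-1))%g by rewrite rcosetM -e rcosetK.
rewrite -rcosetM !act_repr_rcoset ?groupM ?groupV // dot_actV //.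
by rewrite -[act u (g * h^-1)%g]actM ?groupV // mulgKV.
Qed.

Lemma polyfun_orbit_poly u j : polyfun (fun x => (orbit_poly u x)`_j).
Proof.
rewrite /orbit_poly; elim: (index_enum _) j => [|A s IH] j.
  by under eq_fun do rewrite big_nil; exact: polyfun_cst.
under eq_fun do rewrite big_cons; case: (A \in _); last exact: IH.
under eq_fun do rewrite mulrBl coefB coefXM coefCM.
apply: polyfunD; first by case: (j == 0)%N; [exact: polyfun_cst | exact: IH].
under eq_fun do rewrite -mulNr -mulN1r -mulrA.
by apply: polyfunM; [exact: polyfun_cst | apply: polyfunM; [exact: polyfun_dotr | exact: IH]].
Qed.

Definition orbit_roots u x := [seq dot x (act u (repr A)) | A <- enum (rcosets (rstab rG u) G)].

Lemma orbit_polyE u x : orbit_poly u x = \prod_(a <- orbit_roots u x) ('X - a%:P).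
Proof. by rewrite big_map big_enum. Qed.

Lemma size_orbit_roots u x : size (orbit_roots u x) = (#|G| %/ #|rstab rG u|)%N.
Proof. by rewrite size_map -cardE divgS // rstab_sub. Qed.

Lemma orbit_poly_root u x g : g \in G -> (orbit_poly u x).[dot x (act u g)] = 0.
Proof.
move=> Gg; apply/eqP; rewrite -/(root _ _) orbit_polyE root_prod_XsubC.
apply/mapP; exists (rstab rG u :* g)%g; last by rewrite act_repr_rcoset.
by rewrite mem_enum; apply/rcosetsP; exists g.
Qed.
End Invariants.

(** * The Lipschitz estimate for lifts *)

Section TaylorData.
Local Open Scope classical_set_scope.
Variable R : realType.

Lemma truncated_horner (T : {poly R}) (L N : nat) (M s : R) : (size T <= L)%N ->
  (forall i, `|T`_i| <= M) -> 0 <= M -> `|s| <= 1 ->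
  `|T.[s] - \sum_(i < N.+1) T`_i * s ^+ i| <= L%:R * M * `|s| ^+ N.
Proof.
move=> sT cT M0 s1; rewrite (horner_coef_wide s (leq_trans sT (leq_addl N.+1 L))).
rewrite big_split_ord /= addrAC subrr add0r.
apply: le_trans (ler_norm_sum _ _ _) _.
have -> : L%:R * M * `|s| ^+ N = \sum_(i < L) M * `|s| ^+ N.
  by rewrite sumr_const card_ord -mulrA mulr_natl.
apply: ler_sum => i _; rewrite normrM normrX; apply: ler_pM => //.
by apply: ler_wiXn2l => //; rewrite addSn leqW // leq_addr.
Qed.

Definition taylor_bound (K : set R) e N (phi : R -> R) (C : R) : Prop :=
  forall t, K t -> exists T : {poly R}, (forall i, `|T`_i| <= C) /\
    forall s, `|s| <= e -> `|phi (t + s) - \sum_(i < N.+1) T`_i * s ^+ i| <= C * `|s| ^+ N.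

(** Truncation at order N, with a single constant for the coefficients and the
    remainder. *)
Lemma uniform_taylor_bound K e N phi : e <= 1 -> uniform_taylor K e N phi ->
  exists2 C : R, 0 <= C & taylor_bound K e N phi C.
Proof.
move=> e1 [M [L [M0 H]]]; exists (M + L%:R * M) => [|t Kt].
  by rewrite addr_ge0 // mulr_ge0.
have [T [sT cT rT _]] := H t Kt; exists T; split => [i|s se].
  by apply: le_trans (cT i) _; rewrite lerDl mulr_ge0.
rewrite -(subrKA T.[s]) mulrDl; apply: le_trans (ler_normD _ _) _.
by rewrite lerD ?rT // truncated_horner // (le_trans se).
Qed.

Lemma uniform_taylor_continuous K e N phi t : 0 < e -> uniform_taylor K e N phi -> K t ->
  forall eta, 0 < eta -> exists2 d : R, 0 < d &
    forall s, `|s| < d -> `|phi (t + s) - phi t| <= eta.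
Proof.
move=> e0 [M [L [M0 H]]] Kt eta eta0; have [T [sT cT _ pT]] := H t Kt.
have eta3 : 0 < eta / 3 by rewrite divr_gt0.
have [d1 d10 H1] := pT _ eta3.
have T0 : `|phi t - T.[0]| <= eta / 3.
  have := H1 0; rewrite normr0 addr0 => /(_ d10) h; apply: le_trans h _.
  by rewrite ler_piMr ?(ltW eta3) // exprn_ile1.
have /cvgrPdist_le/(_ _ eta3) [/= d2 d20 H2] := @continuous_horner R T 0.
exists (Num.min d1 (Num.min d2 1)) => [|s]; first by rewrite !lt_min d10 d20 ltr01.
rewrite !lt_min => /and3P[s1 s2 s3].
have h1 : `|phi (t + s) - T.[s]| <= eta / 3.
  apply: le_trans (H1 s s1) _; rewrite ler_piMr ?(ltW eta3) // exprn_ile1 //.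
  exact: ltW.
have h2 : `|T.[0] - T.[s]| <= eta / 3 by apply: H2; rewrite /ball_ /= sub0r normrN.
have -> : phi (t + s) - phi t = (phi (t + s) - T.[s]) - (T.[0] - T.[s]) - (phi t - T.[0]) by ring.
apply: le_trans (ler_normB _ _) _; apply: le_trans (lerD (ler_normB _ _) (lexx _)) _.
by move: h1 h2 T0; lra.
Qed.

Lemma coef_shiftX_bound (lam La : R) l j : `|lam| <= La ->
  `|((('X + lam%:P) ^+ l : {poly R}))`_j| <= (1 + La) ^+ l.
Proof.
move=> lL; have L0 : 0 <= La by apply: le_trans lL.
elim: l j => [|l IH] j.
  by rewrite !expr0 coef1; case: (j == 0)%N; rewrite ?normr1 ?normr0.
rewrite exprS mulrDl coefD coefXM coefCM exprS mulrDl mul1r.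
apply: le_trans (ler_normD _ _) _; apply: lerD.
  by case: (j == 0)%N; rewrite ?normr0 ?exprn_ge0 ?addr_ge0.
by rewrite normrM ler_pM.
Qed.
End TaylorData.

Section Curve.
Local Open Scope classical_set_scope.
Variables (R : realType) (gT : finGroupType) (G : {group gT}) (m : nat).
Variable rG : mx_representation R G m.
Hypothesis rG_orth : orthogonal_repr rG.
Local Notation V := 'rV[R]_m.
Local Notation act := (act rG).
Implicit Types (f : V -> R) (x y z v w : V) (g h : gT) (t s eta : R).

Variables (I : set R) (L : R -> V -> Prop) (K : set R) (e : R) (N : nat).
Hypotheses (e0 : 0 < e) (e1 : e <= 1).
Hypothesis KI : forall t, K t -> forall s, `|s| <= e -> I (t + s).
Hypothesis Lex : forall t, I t -> exists x, L t x.
Hypothesis Lact : forall t x g, L t x -> g \in G -> L t (act x g).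
Hypothesis Linv : forall f, polyfun f -> invariant rG f ->
  exists phi, (forall t x, L t x -> f x = phi t) /\ uniform_taylor K e N phi.

Lemma lift_orbit t x y : L t x -> L t y -> exists2 g, g \in G & y = act x g.
Proof.
move=> Lx Ly.
have [phi [Hphi _]] := Linv (polyfun_orbit_product rG x) (orbit_product_invariant rG_orth x).
have := orbit_product_id rG x; rewrite (Hphi t x Lx) -(Hphi t y Ly) => /eqP.
rewrite prodf_seq_eq0 => /hasP[g _ /andP[Gg /eqP h]]; exists g => //.
by apply/eqP; rewrite -subr_eq0; apply/eqP/dot_eq0.
Qed.

(** The invariant [orbit_product] of x0 is continuous along the curve and vanishes
    at t0, so that one of its factors is small near t0. *)
Lemma nearby_lift t0 x0 : K t0 -> L t0 x0 -> forall eta, 0 < eta ->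
  exists2 d : R, 0 < d & forall t y, `|t - t0| < d -> L t y ->
    exists2 g, g \in G & `|act y g - x0| < eta.
Proof.
move=> Kt0 Lx0 eta eta0; have [k k1 Hk] := act_bounded rG.
have k0 : 0 < k by apply: lt_le_trans k1.
have q0 : 0 < eta / k by rewrite divr_gt0.
have [phi [Hphi uphi]] := Linv (polyfun_orbit_product rG x0) (orbit_product_invariant rG_orth x0).
have p0 : 0 < ((eta / k) ^+ 2) ^+ #|G| / 2 by rewrite divr_gt0 // !exprn_gt0.
have [d d0 Hd] := uniform_taylor_continuous e0 uphi Kt0 p0.
exists d => // t y tt0 Ly.
have := Hd _ tt0; rewrite subrKC -(Hphi _ _ Ly) -(Hphi _ _ Lx0) orbit_product_id subr0.
move=> /(le_trans (ler_norm _)) H.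
have [g Gg yg] : exists2 g, g \in G & `|y - act x0 g| < eta / k.
  apply: orbit_product_small; first exact: ltW.
  by apply: le_lt_trans H _; rewrite ltr_pdivrMr // ltr_pMr ?ltr1n // !exprn_gt0.
exists g^-1%g; first by rewrite groupV.
have -> : act y g^-1%g - x0 = act (y - act x0 g) g^-1%g by rewrite actB actK.
apply: le_lt_trans (Hk _ _ (groupVr Gg)) _.
by rewrite mulrC -ltr_pdivlMr.
Qed.

(** The squared norm is an invariant polynomial. *)
Lemma lift_bounded : exists2 C : R, 0 <= C & forall t x, K t -> L t x -> `|x| <= C.
Proof.
have pd : polyfun (fun x : V => dot x x).
  by under eq_fun do rewrite -[x in dot x _]subr0 -[x in dot _ x]subr0; exact: polyfun_sqdist.
have [phi [Hphi uphi]] := Linv pd (fun g Gg x => dot_act rG_orth x x Gg).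
have [C C0 HC] := uniform_taylor_bound e1 uphi.
exists (1 + (C + C)) => [|t x Kt Lx]; first by rewrite !addr_ge0.
have [T [cT rT]] := HC t Kt.
have H : `|x| ^+ 2 <= C + C.
  apply: le_trans (sqr_norm_le_dot x) _; rewrite (Hphi t x Lx).
  have := rT 0; rewrite normr0 addr0 => /(_ (ltW e0)).
  rewrite big_ord_recl big1 ?addr0 => [|i _]; last by rewrite expr0n mulr0.
  rewrite expr0 mulr1 => h; apply: le_trans (ler_norm _) _.
  rewrite -(subrK T`_0 (phi t)); apply: le_trans (ler_normD _ _) _; rewrite lerD //.
  by apply: le_trans h _; rewrite ler_piMr // exprn_ile1.
have := sqr_ge0 (`|x| - 1); move: H; set a := `|x| => H; nra.
Qed.

Lemma dot_bound x y : `|dot x y| <= m%:R * (`|x| * `|y|).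
Proof.
apply: le_trans (ler_norm_sum _ _ _) _.
have -> : m%:R * (`|x| * `|y|) = \sum_(j < m) `|x| * `|y|.
  by rewrite sumr_const card_ord mulr_natl.
by apply: ler_sum => j _; rewrite normrM ler_pM ?coord_le_norm.
Qed.

(** [root_bound] applied to the orbit polynomial of u, translated by its root
    <x0, u g>. The translation is bounded in terms of the norms of x0 and u, so
    the Taylor data stay uniformly bounded. *)
Lemma root_lipschitz u : (#|G| %/ #|rstab rG u| <= N)%N ->
  exists2 C : R, 0 <= C & forall t0 x0 g, K t0 -> L t0 x0 -> g \in G ->
    exists2 d : R, 0 < d & forall t y, `|t - t0| < d -> L t y -> `|y - x0| < d ->
      `|dot (y - x0) (act u g)| <= C * `|t - t0|.
Proof.
set n := (#|G| %/ _)%N => nN.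
have n0 : (0 < n)%N by rewrite divn_gt0 ?cardG_gt0 // subset_leq_card // rstab_sub.
have N0 : (0 < N)%N by apply: leq_trans nN.
have [k k1 Hk] := act_bounded rG.
have k0 : 0 <= k by apply: le_trans k1.
have [B B0 HB] := lift_bounded.
pose La := m%:R * (B * (k * `|u|)).
have La0 : 0 <= La by rewrite !mulr_ge0.
have [phi Hphi] : {phi : nat -> R -> R & forall l,
    (forall t x, L t x -> (orbit_poly rG u x)`_l = phi l t) /\ uniform_taylor K e N (phi l)}.
  apply: (@choice _ _ (fun l p => (forall t x, L t x -> (orbit_poly rG u x)`_l = p t) /\ uniform_taylor K e N p)) => l.
  by apply: Linv (polyfun_orbit_poly rG u l) _ => g Gg x; rewrite orbit_poly_invariant.
have [C C0 HC] : exists2 C : R, 0 <= C & forall l, (l < n.+1)%N -> taylor_bound K e N (phi l) C.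
  apply: (uniform_bound (P := fun l C => taylor_bound K e N (phi l) C)) => [l C C' H CC' t Kt|l _].
    have [T [h1 h2]] := H t Kt; exists T; split => [i|s se]; first exact: le_trans CC'.
    by apply: le_trans (h2 s se) _; rewrite ler_wpM2r // exprn_ge0.
  by apply: uniform_taylor_bound => //; have [] := Hphi l.
pose D := \sum_(l < n.+1) (1 + La) ^+ l * C.
have D0 : 0 <= D by apply: sumr_ge0 => l _; rewrite mulr_ge0 // exprn_ge0 // addr_ge0.
pose M := D + 1; have M1 : 1 <= M by rewrite lerDr.
have [Q Q0 HQ] := root_bound e0 e1 M1 nN.
exists Q => // t0 x0 g Kt0 Lx0 Gg.
pose lam := dot x0 (act u g).
have lamL : `|lam| <= La.
  apply: le_trans (dot_bound _ _) _; rewrite ler_wpM2l //; apply: ler_pM => //.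
    exact: HB Lx0.
  exact: Hk.
have [Y HY] : {Y : R -> V & forall s, `|s| <= e -> L (t0 + s) (Y s)}.
  apply: (@choice _ _ (fun s y => `|s| <= e -> L (t0 + s) y)) => s.
  have [se|nse] := pselect (`|s| <= e); last by exists 0 => /nse.
  by have [y Ly] := Lex (KI Kt0 se); exists y.
have [T HT] : {T : nat -> {poly R} & forall l, (l < n.+1)%N -> (forall i, `|(T l)`_i| <= C) /\
    forall s, `|s| <= e -> `|phi l (t0 + s) - \sum_(i < N.+1) (T l)`_i * s ^+ i| <= C * `|s| ^+ N}.
  apply: (@choice _ _ (fun l (T : {poly R}) => (l < n.+1)%N -> (forall i, `|T`_i| <= C) /\
    forall s, `|s| <= e -> `|phi l (t0 + s) - \sum_(i < N.+1) T`_i * s ^+ i| <= C * `|s| ^+ N)) => l.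
  have [ln|ln] := boolP (l < n.+1)%N; last by exists 0.
  by have [T HT] := HC l ln t0 Kt0; exists T.
pose kap l j := ((('X + lam%:P) ^+ l : {poly R}))`_j.
pose rs s := [seq a - lam | a <- orbit_roots rG u (Y s)].
pose f s j := (rooted_poly 1 (rs s))`_j.
have rsE y : rooted_poly 1 [seq a - lam | a <- orbit_roots rG u y] = orbit_poly rG u y \Po ('X + lam%:P).
  rewrite /rooted_poly scale1r big_map orbit_polyE rmorph_prod /=.
  by apply: eq_bigr => a _; rewrite comp_polyB comp_polyX comp_polyC rmorphB /= opprB addrA.
have szP y : size (orbit_poly rG u y) = n.+1.
  by rewrite orbit_polyE size_prod_XsubC size_orbit_roots.
have fE s j : `|s| <= e -> f s j = \sum_(l < n.+1) kap l j * phi l (t0 + s).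
  move=> se; rewrite /f rsE coef_comp_poly szP; apply: eq_bigr => l _.
  by rewrite (proj1 (Hphi l) _ _ (HY s se)) mulrC.
pose A j i := \sum_(l < n.+1) kap l j * (T l)`_i.
have kapB l j : `|kap l j| <= (1 + La) ^+ l by apply: coef_shiftX_bound.
have HF : taylor_family n N e M f A.
  split => [s se|j i|s j se].
  - by exists 1, (rs s); rewrite size_map size_orbit_roots.
  - apply: le_trans (_ : D <= _); last by rewrite lerDl.
    apply: le_trans (ler_norm_sum _ _ _) _; apply: ler_sum => l _.
    by rewrite normrM ler_pM //; have [] := HT l (ltn_ord l).
  - rewrite fE //; apply: le_trans (_ : D * `|s| ^+ N <= _); last first.
      by rewrite ler_wpM2r ?exprn_ge0 // lerDl.
    have -> : \sum_(i < N.+1) A j i * s ^+ i = \sum_(l < n.+1) kap l j * \sum_(i < N.+1) (T l)`_i * s ^+ i.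
      under eq_bigr do rewrite mulr_suml; rewrite exchange_big /=.
      by apply: eq_bigr => l _; rewrite mulr_sumr; apply: eq_bigr => i _; rewrite mulrA.
    rewrite -sumrB; apply: le_trans (ler_norm_sum _ _ _) _.
    rewrite mulr_suml; apply: ler_sum => l _; rewrite -mulrBr normrM -mulrA.
    by apply: ler_pM => //; have [_] := HT l (ltn_ord l); apply.
have A0 j : A j 0%N = f 0 j.
  have [_ _ H] := HF; have := H 0 j; rewrite normr0 expr0n gtn_eqF // mulr0 => /(_ (ltW e0)).
  rewrite big_ord_recl big1 ?addr0 => [|i _]; last by rewrite expr0n mulr0.
  by rewrite expr0 mulr1 normr_le0 subr_eq0 => /eqP.
have PY s y : `|s| <= e -> L (t0 + s) y -> orbit_poly rG u (Y s) = orbit_poly rG u y.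
  move=> se Ly; have [h Gh ->] := lift_orbit (HY s se) Ly.
  by rewrite orbit_poly_invariant.
have rootf s y : `|s| <= e -> L (t0 + s) y ->
    \sum_(j < n.+1) f s j * (dot y (act u g) - lam) ^+ j = 0.
  move=> se Ly; have sz : (size (rooted_poly 1 (rs s)) <= n.+1)%N.
    by rewrite /rooted_poly scale1r size_prod_XsubC size_map size_orbit_roots.
  rewrite -(horner_coef_wide _ sz) rsE horner_comp !hornerE subrK (PY s y se Ly).
  exact: orbit_poly_root.
have An : A n 0%N = 1.
  rewrite A0 /f /rooted_poly scale1r.
  have := monic_prod_XsubC (rs 0) xpredT id; rewrite monicE lead_coefE size_prod_XsubC.
  by rewrite size_map size_orbit_roots => /eqP.
have A00 : A 0%N 0%N = 0.
  rewrite A0; have := rootf 0 x0; rewrite normr0 addr0 => /(_ (ltW e0) Lx0).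
  rewrite subrr big_ord_recl big1 ?addr0 => [|i _]; last by rewrite expr0n mulr0.
  by rewrite expr0 mulr1.
have [|d d0 Hd] := HQ f A HF _ A00; first by rewrite An normr1 mulr1.
pose k' := m%:R * (k * `|u|) + 1.
have k'0 : 0 < k' by rewrite ltr_wpDl // !mulr_ge0.
exists (Num.min (Num.min d e) (d / k')) => [|t y].
  by rewrite !lt_min d0 e0 divr_gt0.
rewrite !lt_min => /andP[/andP[td te] _] Ly /andP[/andP[yd _] yk].
have dB : dot (y - x0) (act u g) = dot y (act u g) - lam by rewrite dotBl.
rewrite dB; apply: Hd => //; last first.
  by apply: rootf; [exact: ltW | rewrite subrKC].
rewrite -dB; apply: le_lt_trans (dot_bound _ _) _.
move: yk; rewrite ltr_pdivlMr //; apply: le_lt_trans.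
rewrite mulrCA ler_wpM2l //; apply: le_trans (_ : m%:R * (k * `|u|) <= _); last by rewrite lerDl.
by rewrite ler_wpM2l // Hk.
Qed.
End Curve.

Section Span.
Variables (R : realType) (gT : finGroupType) (G : {group gT}) (m : nat).
Variable rG : mx_representation R G m.
Variables (l : nat) (W : 'I_l -> 'M[R]_m) (v : 'I_l -> 'rV[R]_m).
Hypothesis W_irr : forall i, mxsimple rG (W i).
Hypothesis W_sum : (\sum_(i < l) W i :=: 1%:M)%MS.
Hypothesis v_in : forall i, (v i <= W i)%MS.
Hypothesis v_neq0 : forall i, v i != 0.

(** In an irreducible summand the cyclic module of a nonzero vector is the whole
    summand. *)
Lemma orbits_span (y : 'rV[R]_m) : exists a : 'I_l -> gT -> R,
  y = \sum_i \sum_(g in G) a i g *: act rG (v i) g.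
Proof.
have : (y <= \sum_(i < l) W i)%MS by rewrite W_sum submx1.
move=> /sub_sumsmxP [u ->].
have H i : exists a : gT -> R, u i *m W i = \sum_(g in G) a g *: act rG (v i) g.
  have [modW _ minW] := W_irr i.
  have sub : (W i <= cyclic_mx rG (v i))%MS.
    apply: minW; first exact: cyclic_mx_module.
      exact: cyclic_mx_sub.
    by rewrite cyclic_mx_eq0.
  have /cyclic_mxP [A /envelop_mxP [a ->] ->] := submx_trans (submxMl (u i) (W i)) sub.
  exists a; rewrite mulmx_sumr; apply: eq_bigr => g _; by rewrite -scalemxAr.
have [a Ha] := fin_all_exists H.
by exists a; apply: eq_bigr => i _.
Qed.

Lemma orbits_norming : exists2 C : R, 0 <= C & forall (x : 'rV[R]_m) eta, 0 <= eta ->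
  (forall i g, g \in G -> `|dot x (act rG (v i) g)| <= eta) -> `|x| <= C * eta.
Proof.
have [a Ha] := fin_all_exists (fun j : 'I_m => orbits_span (delta_mx 0 j)).
pose c j := \sum_i \sum_(g in G) `|a j i g|.
have c0 j : 0 <= c j by apply: sumr_ge0 => i _; apply: sumr_ge0.
exists (\sum_j c j) => [|x eta eta0 H]; first exact: sumr_ge0.
apply: norm_le_coord => [|j]; first by rewrite mulr_ge0 // sumr_ge0.
have -> : x 0 j = dot x (delta_mx 0 j).
  rewrite /dot (bigD1 j) //= big1 ?addr0 ?mxE ?eqxx ?mulr1 // => i ij.
  by rewrite mxE (negbTE ij) andbF mulr0.
have dotS (T : finType) (P : pred T) (F : T -> 'rV[R]_m) :
    dot x (\sum_(i | P i) F i) = \sum_(i | P i) dot x (F i).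
  rewrite /dot exchange_big /=; apply: eq_bigr => i _.
  by rewrite summxE mulr_sumr.
have dotZ b y : dot x (b *: y) = b * dot x y.
  by rewrite /dot mulr_sumr; apply: eq_bigr => i _; rewrite mxE mulrCA.
apply: le_trans (_ : c j * eta <= _); last first.
  by rewrite ler_wpM2r // (bigD1 j) //= lerDl sumr_ge0.
rewrite Ha dotS; apply: le_trans (ler_norm_sum _ _ _) _.
rewrite /c mulr_suml; apply: ler_sum => i _.
rewrite dotS mulr_suml; apply: le_trans (ler_norm_sum _ _ _) _.
by apply: ler_sum => g Gg; rewrite dotZ normrM ler_wpM2l // H.
Qed.
End Span.

(** * Cluster values of difference quotients *)

Section PolyLimit.
Local Open Scope classical_set_scope.
Variable R : realType.

(** Otherwise the lowest nonzero term of S would dominate near 0. *)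
Lemma poly_vanish (S : {poly R}) r :
  (forall eta, 0 < eta -> exists s : R, [/\ 0 < `|s|, `|s| < eta & `|S.[s]| <= eta * `|s| ^+ r]) ->
  forall i, (i <= r)%N -> S`_i = 0.
Proof.
move=> H; elim/ltn_ind => i IH ir.
have E : S = drop_poly i S * 'X^i.
  rewrite -{1}(poly_take_drop i S); set p := take_poly i S.
  suff -> : p = 0 by rewrite add0r.
  apply/polyP => j; rewrite coef_take_poly coef0; case: ltnP => // ji.
  by rewrite IH // (leq_trans (ltnW ji)).
have c0 : (drop_poly i S).[0] = S`_i by rewrite horner_coef0 coef_drop_poly.
apply/eqP; rewrite -normr_eq0 eq_le normr_ge0 andbT leNgt; apply/negP => Si.
have q0 : 0 < `|S`_i| / 3 by rewrite divr_gt0.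
have /cvgrPdist_le/(_ _ q0) [/= d d0 Hd] := @continuous_horner R (drop_poly i S) 0.
have eta0 : 0 < Num.min (Num.min d 1) (`|S`_i| / 3) by rewrite !lt_min d0 ltr01.
have [s [s0]] := H _ eta0; rewrite !lt_min => /andP[/andP[sd s1] _] Hs.
have h1 : `|S`_i - (drop_poly i S).[s]| <= `|S`_i| / 3.
  by rewrite -{1}c0; apply: Hd; rewrite /ball_ /= sub0r normrN.
have h2 : `|(drop_poly i S).[s]| <= `|S`_i| / 3.
  move: Hs; rewrite {1}E hornerM hornerXn normrM normrX => Hs.
  have si : 0 < `|s| ^+ i by rewrite exprn_gt0.
  rewrite -(ler_pM2r si); apply: le_trans Hs _; apply: ler_pM.
  - exact: ltW.
  - by rewrite exprn_ge0.
  - by rewrite ge_min lexx orbT.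
  - by rewrite ler_wiXn2l // ltW.
have := ler_normD (S`_i - (drop_poly i S).[s]) (drop_poly i S).[s].
by rewrite subrK; move: h1 h2 Si; lra.
Qed.

Lemma bounded_cluster m (u : nat -> 'rV[R]_m) (C : R) : (forall n, `|u n| <= C) ->
  exists w, forall eta, 0 < eta -> forall n0 : nat, exists2 n, (n0 <= n)%N & `|u n - w| < eta.
Proof.
move=> Hu; pose A := [set x : 'rV[R]_m | `|x| <= C].
have cA : compact A.
  apply: bounded_closed_compact.
    exists C; split; first exact: num_real.
    by move=> M CM x Ax; apply: le_trans Ax (ltW CM).
  have -> : A = (fun x : 'rV[R]_m => `|x|) @^-1` [set y | y <= C] by [].
  apply: closed_comp; first by move=> x _; exact: norm_continuous.
  exact: closed_le.
have FA : (u @ \oo) A by exists 0%N => // n _; apply: Hu.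
have [w [_ Hw]] := cA _ (fmap_proper_filter _ _) FA.
exists w => eta eta0 n0.
have B1 : (u @ \oo) [set x | exists2 n, (n0 <= n)%N & x = u n].
  by exists n0 => // n n0n; exists n.
have B2 : nbhs w (ball w eta) by apply: nbhsx_ballx.
have [x [[n n0n ->] xw]] := Hw _ _ B1 B2.
by exists n => //; move: xw; rewrite mx_norm_ball /ball_ /= distrC.
Qed.
End PolyLimit.

Section Interpolation.
Variables (R : realType) (gT : finGroupType) (G : {group gT}) (m : nat).
Variable rG : mx_representation R G m.
Local Notation V := 'rV[R]_m.
Local Notation act := (act rG).
Implicit Types (f : V -> R) (x y z v w : V) (g h : gT).

Lemma dot_selfB x : `|x| <= 1 -> `|dot x x| <= m%:R * `|x|.
Proof.
move=> x1; apply: le_trans (dot_bound _ _) _; rewrite ler_wpM2l //.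
by rewrite ler_piMr.
Qed.

Lemma polyfun_act f g : polyfun f -> polyfun (fun x => f (act x g)).
Proof.
move=> pf; have := polyfun_affine (rG g) 0 pf.
by under eq_fun do rewrite addr0.
Qed.

Lemma polyfun_bounded f v : polyfun f -> exists2 C : R, 0 <= C &
  forall x, `|x| <= 1 -> `|f (v + x)| <= C.
Proof.
move=> pf; have [C C0 HC] := polyfun_lipschitz v pf.
exists (C + `|f v|) => [|x x1]; first exact: addr_ge0.
rewrite -(subrK (f v) (f (v + x))); apply: le_trans (ler_normD _ _) _.
by rewrite lerD //; apply: le_trans (HC x x1) _; rewrite ler_piMr.
Qed.

(** The form tau in x - v is multiplied by a polynomial that vanishes to high order at
    the other points of the orbit of v, and the product is averaged over G. At v
    only the stabilizer contributes to the terms of degree r. *)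
Lemma invariant_interpolation v tau r : polyfun tau ->
  (forall (s : R) x, tau (s *: x) = s ^+ r * tau x) ->
  exists f (c C d : R), [/\ polyfun f, invariant rG f, 0 < c, 0 <= C /\ 0 < d &
    forall x, `|x| <= d ->
    `|f (v + x) - c * \sum_(h in rstab rG v) tau (act x h)| <= C * `|x| ^+ r.+1].
Proof.
move=> ptau htau.
pose P x := \prod_(g in G | act v g != v) dot (x - act v g) (x - act v g) ^+ r.+1.
pose F x := tau (x - v) * P x.
have pP : polyfun P by apply: polyfun_prod => g _; apply: polyfunX; apply: polyfun_sqdist.
have ptv : polyfun (fun x => tau (x - v)).
  have := polyfun_affine 1%:M (- v) ptau; by under eq_fun do rewrite mulmx1.
have pF : polyfun F by apply: polyfunM.
have Pv : 0 < P v.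
  apply: prodr_gt0 => g /andP[_ vg]; apply: exprn_gt0; rewrite lt_neqAle dot_ge0 andbT eq_sym.
  by apply/eqP => /dot_eq0/eqP; rewrite subr_eq0 eq_sym (negbTE vg).
have [k k1 Hk] := act_bounded rG.
have k0 : 0 < k by apply: lt_le_trans k1.
have [C1 C10 HC1] := homogeneous_bound ptau htau.
have [C2 C20 HC2] := polyfun_lipschitz v pP.
pose val g x := if g \in rstab rG v then P v * tau (act x g) else 0.
have Hg g : exists C : R, 0 <= C /\ (g \in G -> forall x, k * `|x| <= 1 ->
    `|F (act (v + x) g) - val g x| <= C * `|x| ^+ r.+1).
  have [Gg|nGg] := boolP (g \in G); last by exists 0; split => // /negP.
  have actD x : act (v + x) g = act v g + act x g by rewrite /act mulmxDl.
  have xg x : k * `|x| <= 1 -> `|act x g| <= 1 by apply: le_trans; apply: Hk.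
  have xgr x : `|act x g| ^+ r.+1 <= k ^+ r.+1 * `|x| ^+ r.+1.
    by rewrite -exprMn lerXn2r ?nnegrE ?mulr_ge0 // ?Hk // ltW.
  have [Sg|nSg] := boolP (g \in rstab rG v).
    have [_ vg] := rstabP _ _ _ Sg.
    exists (C1 * C2 * k ^+ r.+1); split; first by rewrite !mulr_ge0 // exprn_ge0 // ltW.
    move=> _ x xk; rewrite /val Sg actD vg /F addrAC subrr add0r [P v * _]mulrC -mulrBr normrM.
    apply: le_trans (ler_pM _ _ (HC1 _) (HC2 _ (xg x xk))) _ => //.
    rewrite mulrACA -exprSr -[leRHS]mulrA; apply: ler_wpM2l; first exact: mulr_ge0.
    exact: xgr.
  have vg : act v g != v by apply: contra nSg => /eqP e; apply/rstabP.
  pose P' x := \prod_(h | (h \in G) && (act v h != v) && (h != g)) dot (x - act v h) (x - act v h) ^+ r.+1.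
  have PE x : P x = dot (x - act v g) (x - act v g) ^+ r.+1 * P' x.
    by rewrite /P (bigD1 g) //= Gg.
  have pP' : polyfun (fun x => tau (x - v) * P' x).
    by apply: polyfunM ptv _; apply: polyfun_prod => h _; apply: polyfunX; apply: polyfun_sqdist.
  have [B B0 HB] := polyfun_bounded (act v g) pP'.
  exists (B * (m%:R ^+ r.+1 * k ^+ r.+1)); split.
    by rewrite !mulr_ge0 // exprn_ge0 // ltW.
  move=> _ x xk; rewrite /val (negbTE nSg) subr0 actD /F PE mulrCA.
  rewrite [act v g + act x g - act v g]addrAC subrr add0r mulrC normrM -mulrA.
  apply: ler_pM => //; first exact: HB (xg x xk).
  rewrite normrX; apply: le_trans (_ : (m%:R * `|act x g|) ^+ r.+1 <= _).
    by rewrite lerXn2r ?nnegrE ?mulr_ge0 // dot_selfB // xg.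
  by rewrite exprMn -mulrA ler_wpM2l ?exprn_ge0.
have [C HC] := fin_all_exists Hg.
exists (fun x => \sum_(g in G) F (act x g)), (P v), (\sum_(g in G) C g), k^-1; split => //.
- by apply: polyfun_sum => g _; apply: polyfun_act.
- move=> h Gh x; rewrite [RHS](reindex_inj (mulgI h)) /=.
  apply: eq_big => [g|g Gg]; first by rewrite groupMl.
  by rewrite actM.
- by split; [apply: sumr_ge0 => g _; have [] := HC g | rewrite invr_gt0].
- move=> x xk; have {}xk : k * `|x| <= 1 by rewrite mulrC -ler_pdivlMr // div1r.
  have -> : P v * \sum_(h in rstab rG v) tau (act x h) = \sum_(g in G) val g x.
    rewrite mulr_sumr /val -big_mkcondr /=; apply: eq_bigl => g.
    by rewrite andb_idl // => /rstabP[].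
  rewrite -sumrB mulr_suml; apply: le_trans (ler_norm_sum _ _ _) _.
  by apply: ler_sum => g Gg; have [_] := HC g; apply.
Qed.
End Interpolation.

Section Tangents.
Local Open Scope classical_set_scope.
Variables (R : realType) (gT : finGroupType) (G : {group gT}) (m : nat).
Variable rG : mx_representation R G m.
Hypothesis rG_orth : orthogonal_repr rG.
Local Notation V := 'rV[R]_m.
Local Notation act := (act rG).
Implicit Types (f : V -> R) (x y z v w : V) (g h : gT) (t s eta : R).

Variables (I : set R) (L : R -> V -> Prop) (K : set R) (e : R) (N : nat).
Hypotheses (e0 : 0 < e) (e1 : e <= 1).
Hypothesis KI : forall t, K t -> forall s, `|s| <= e -> I (t + s).
Hypothesis Lex : forall t, I t -> exists x, L t x.
Hypothesis Lact : forall t x g, L t x -> g \in G -> L t (act x g).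
Hypothesis Linv : forall f, polyfun f -> invariant rG f ->
  exists phi, (forall t x, L t x -> f x = phi t) /\ uniform_taylor K e N phi.
Variable gens : seq (mpoly m R).
Hypothesis gens_inv : forall p, p \in gens -> invariant_poly rG p.
Hypothesis gens_deg : forall p, p \in gens -> (pdeg p <= N)%N.
Hypothesis gens_gen : generates_invariants rG gens.
Variables (l : nat) (u : 'I_l -> V).
Hypothesis u_orbit : forall i, (#|G| %/ #|rstab rG (u i)| <= N)%N.
Hypothesis u_norming : exists2 C : R, 0 <= C & forall x eta, 0 <= eta ->
  (forall i g, g \in G -> `|dot x (act (u i) g)| <= eta) -> `|x| <= C * eta.

(** The constant C is uniform on K, whereas [d] depends on t0 and x0. This is
    enough to bound the derivatives of lifts. *)
Lemma lift_lipschitz : exists2 C : R, 0 <= C & forall t0 x0, K t0 -> L t0 x0 ->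
  exists2 d : R, 0 < d & forall t y, `|t - t0| < d -> L t y -> `|y - x0| < d ->
    `|y - x0| <= C * `|t - t0|.
Proof.
have [C C0 HC] := u_norming.
have Hi i : exists B : R, 0 <= B /\ forall t0 x0 g, K t0 -> L t0 x0 -> g \in G ->
    exists2 d : R, 0 < d & forall t y, `|t - t0| < d -> L t y -> `|y - x0| < d ->
      `|dot (y - x0) (act (u i) g)| <= B * `|t - t0|.
  have [B B0 HB] := root_lipschitz rG_orth e0 e1 KI Lex Linv (u_orbit i).
  by exists B.
have [B HB] := fin_all_exists Hi.
have sB0 : 0 <= \sum_i B i by apply: sumr_ge0 => i _; have [] := HB i.
exists (C * \sum_i B i) => [|t0 x0 Kt0 Lx0]; first exact: mulr_ge0.
have Hp (p : 'I_l * gT) : exists d : R, 0 < d /\ (p.2 \in G -> forall t y, `|t - t0| < d -> L t y -> `|y - x0| < d ->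
      `|dot (y - x0) (act (u p.1) p.2)| <= B p.1 * `|t - t0|).
  have [Gp|nG] := boolP (p.2 \in G); last by exists 1.
  by have [_ H] := HB p.1; have [d d0 Hd] := H t0 x0 p.2 Kt0 Lx0 Gp; exists d.
have [d Hd] := fin_all_exists Hp.
have [r r0 Hr] := finite_positive_bound (fun p => (Hd p).1).
exists r => // t y tr Ly yr; rewrite -mulrA; apply: HC => [|i g Gg]; first exact: mulr_ge0.
have [_ H] := Hd (i, g); apply: le_trans (H Gg t y _ Ly _) _ => /=.
- exact: lt_le_trans tr _.
- exact: lt_le_trans yr _.
- rewrite ler_wpM2r // (bigD1 i) //= lerDl; apply: sumr_ge0 => j _.
  by have [] := HB j.
Qed.

(** The possible limits of difference quotients of lifts at x0. *)
Definition cluster_tangent t0 x0 w := forall eta, 0 < eta -> exists t y,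
  [/\ 0 < `|t - t0|, `|t - t0| < eta, L t y & `|y - x0 - (t - t0) *: w| <= eta * `|t - t0|].

(** Along the curve, the invariant with leading part c times the averaged tau is a
    function of t that is O(|s|^r) on a sequence of parameters t0 + s. So its
    Taylor coefficients below r vanish, and the r-th one, which is determined by
    the function, is the value of the leading part at any cluster value. *)
Lemma tangent_coefficient t0 x0 tau r : K t0 -> L t0 x0 -> (r <= N)%N -> polyfun tau ->
  (forall (s : R) x, tau (s *: x) = s ^+ r * tau x) ->
  forall w w', cluster_tangent t0 x0 w -> cluster_tangent t0 x0 w' ->
  \sum_(h in rstab rG x0) tau (act w h) = \sum_(h in rstab rG x0) tau (act w' h).
Proof.
move=> Kt0 Lx0 rN ptau htau.
have [f [c [C [d [pf invf c0 [C0 d0] Hf]]]]] := invariant_interpolation rG x0 ptau htau.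
have [phi [Hphi [M [S [M0 HT]]]]] := Linv pf invf.
have [T [_ _ _ pT]] := HT t0 Kt0.
pose q x := c * \sum_(h in rstab rG x0) tau (act x h).
have pq : polyfun q.
  by apply: polyfunM; [exact: polyfun_cst | apply: polyfun_sum => h _; apply: polyfun_act].
have hq (s : R) x : q (s *: x) = s ^+ r * q x.
  rewrite /q mulrCA; congr (_ * _); rewrite mulr_sumr; apply: eq_bigr => h _.
  by rewrite actZ htau.
suff key w : cluster_tangent t0 x0 w -> T`_r = q w.
  by move=> w w' /key h1 /key h2; apply: (mulfI (lt0r_neq0 c0)); rewrite -/(q w) -h1 h2.
move=> Hw; have [C2 C20 HC2] := polyfun_lipschitz w pq.
pose D := 1 + C * (`|w| + 1) ^+ r.+1 + C2.
have D1 : 1 <= D by rewrite /D -addrA lerDl addr_ge0 // mulr_ge0 // exprn_ge0 // addr_ge0.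
have D0 : 0 < D by apply: lt_le_trans D1.
suff : (T - q w *: 'X^r)`_r = 0.
  by rewrite coefB coefZ coefXn eqxx mulr1 => /eqP; rewrite subr_eq0 => /eqP.
apply: (poly_vanish (r := r)) => // eta eta0.
pose a := eta / D; have a0 : 0 < a by rewrite divr_gt0.
have aeta : a <= eta by rewrite ler_pdivrMr // ler_peMr // ltW.
have [b b0 Hb] := pT a a0.
have w1 : 0 < `|w| + 1 by rewrite ltr_wpDl.
pose eta' := Num.min (Num.min a 1) (Num.min b (d / (`|w| + 1))).
have eta'0 : 0 < eta' by rewrite !lt_min a0 ltr01 b0 divr_gt0.
have [t [y [s0 st Ly Hy]]] := Hw eta' eta'0; exists (t - t0).
set s := t - t0 in s0 st Hy *.
move: st; rewrite !lt_min => /andP[/andP[sa s1] /andP[sb sd]].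
have eta'a : eta' <= a by rewrite !ge_min lexx.
have eta'1 : eta' <= 1 by rewrite !ge_min lexx orbT.
have sn0 : s != 0 by rewrite -normr_gt0.
pose eps := s^-1 *: (y - x0) - w.
have epsE : y - x0 = s *: (w + eps).
  by rewrite /eps subrKC scalerA divff // scale1r.
have eps1 : `|eps| <= eta'.
  have : `|s| * `|eps| <= eta' * `|s|.
    by rewrite -normrZ /eps scalerBr scalerA divff // scale1r.
  by rewrite mulrC ler_pM2r.
have eps11 : `|eps| <= 1 by apply: le_trans eta'1.
have weps : `|w + eps| <= `|w| + 1 by apply: le_trans (ler_normD _ _) _; rewrite lerD2l.
have yx : `|y - x0| <= `|s| * (`|w| + 1) by rewrite epsE normrZ ler_wpM2l.
split => //; first exact: lt_le_trans sa aeta.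
have h1 : `|phi t - T.[s]| <= a * `|s| ^+ r.
  have := Hb s sb; rewrite subrKC => h; apply: le_trans h _; rewrite ler_pM2l //.
  by rewrite ler_wiXn2l // ltW.
have h2 : `|phi t - q (y - x0)| <= C * (`|w| + 1) ^+ r.+1 * (a * `|s| ^+ r).
  rewrite -(Hphi t y Ly) -{1}(subrKC x0 y); apply: le_trans (Hf _ _) _.
    by apply: le_trans yx _; move: sd; rewrite ltr_pdivlMr // => /ltW.
  rewrite -mulrA ler_wpM2l //.
  apply: le_trans (_ : (`|s| * (`|w| + 1)) ^+ r.+1 <= _).
    by rewrite lerXn2r ?nnegrE ?mulr_ge0 // ltW.
  rewrite exprMn mulrC ler_wpM2l ?exprn_ge0 ?(ltW w1) //.
  by rewrite exprS ler_wpM2r ?exprn_ge0 // ltW.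
have h3 : `|q (y - x0) - q w * s ^+ r| <= C2 * (a * `|s| ^+ r).
  rewrite epsE hq [q w * _]mulrC -mulrBr normrM normrX mulrC mulrA.
  apply: ler_wpM2r; first exact: exprn_ge0.
  by apply: le_trans (HC2 _ eps11) _; rewrite ler_wpM2l // (le_trans eps1).
rewrite hornerD hornerN hornerZ hornerXn.
have -> : T.[s] - q w * s ^+ r = - (phi t - T.[s]) + (phi t - q (y - x0)) + (q (y - x0) - q w * s ^+ r) by ring.
apply: le_trans (ler_normD _ _) _; apply: le_trans (lerD (ler_normD _ _) h3) _.
rewrite normrN; apply: le_trans (lerD (lerD h1 h2) (lexx _)) _.
have -> : a * `|s| ^+ r + C * (`|w| + 1) ^+ r.+1 * (a * `|s| ^+ r) + C2 * (a * `|s| ^+ r) = a * D * `|s| ^+ r.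
  by rewrite /D; ring.
by rewrite /a divfK // gt_eqF.
Qed.

(** All generators, and hence all invariants, agree at x0 + s w and x0 + s w' for
    every s. By the pigeonhole principle, the elements of G that relate these
    points agree for two values of s, and such an element satisfies
    x0 = x0 g and w' = w g. *)
Lemma cluster_tangent_orbit t0 x0 w w' : K t0 -> L t0 x0 ->
  cluster_tangent t0 x0 w -> cluster_tangent t0 x0 w' ->
  exists2 h, h \in rstab rG x0 & w' = act w h.
Proof.
move=> Kt0 Lx0 Hw Hw'.
have S0 : (#|rstab rG x0|)%:R != 0 :> R by rewrite pnatr_eq0 -lt0n cardG_gt0.
have gen_eq p : p \in gens -> forall s : R,
    meval ((x0 + s *: w) 0) p = meval ((x0 + s *: w') 0) p.
  move=> pg; have [T [T1 T2 T3 T4]] := jetpoly_meval x0 (gens_deg pg).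
  have avg x (s : R) : (#|rstab rG x0|)%:R * meval ((x0 + s *: x) 0) p =
      (\sum_(h in rstab rG x0) T (act x h)).[s].
    rewrite horner_sum mulr_natl -sumr_const; apply: eq_bigr => h /rstabP[Gh e'].
    rewrite -T4 -(gens_inv pg Gh (x0 + s *: x)) mulmxDl -scalemxAl.
    by rewrite -[x0 *m _]/(act x0 h) e'.
  move=> s; apply: (mulfI S0); rewrite !avg; congr (_.[s]); apply/polyP => r.
  rewrite !coef_sum; have [rN|Nr] := leqP r N.
    exact: (tangent_coefficient Kt0 Lx0 rN (T1 r) (T2 r)).
  by rewrite !big1 // => h _; rewrite nth_default // (leq_trans (T3 _)).
have inv_eq f : polyfun f -> invariant rG f -> forall s : R, f (x0 + s *: w) = f (x0 + s *: w').
  move=> [p Hp] invf s; have ip : invariant_poly rG p.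
    by move=> g Gg x; rewrite -!Hp; apply: invf.
  have [q qE] := gens_gen ip; rewrite !Hp qE !comp_mpoly_meval; apply: meval_eq => i.
  by apply: gen_eq; apply: mem_tnth.
have ex_g (s : R) : exists g, g \in G /\ x0 + s *: w' = act (x0 + s *: w) g.
  have := inv_eq _ (polyfun_orbit_product rG (x0 + s *: w)) (orbit_product_invariant rG_orth _) s.
  rewrite orbit_product_id => /esym/eqP; rewrite prodf_seq_eq0 => /hasP[g _ /andP[Gg /eqP h]].
  by exists g; split => //; apply/eqP; rewrite -subr_eq0; apply/eqP/dot_eq0.
have [g Hg] := fin_all_exists (fun i : 'I_(#|gT|.+1) => ex_g (i%:R)).
have /injectivePn [i [j ij gij]] : ~~ injectiveb g.
  apply/injectiveP => inj_g; have := leq_card g inj_g.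
  by rewrite card_ord ltnn.
have [Gg gi] := Hg i; have [_ gj] := Hg j; rewrite -gij in gj.
have ijR : (i%:R - j%:R : R) != 0.
  by rewrite subr_eq0 eqr_nat; apply: contra ij => /eqP/val_inj->.
have E : (i%:R - j%:R : R) *: w' = (i%:R - j%:R : R) *: act w (g i).
  rewrite -actZ !scalerBl; have -> : i%:R *: w' - j%:R *: w' = (x0 + i%:R *: w') - (x0 + j%:R *: w').
    by rewrite opprD addrACA subrr add0r.
  by rewrite gi gj -actB opprD addrACA subrr add0r.
have wE : w' = act w (g i) by apply: (scalerI ijR).
exists (g i) => //; apply/rstabP; split => //.
by move: gi; rewrite {1}/act mulmxDl -/(act _ _) -scalemxAl -/(act _ _) -wE => /addIr <-.
Qed.

(** Bolzano-Weierstrass for the difference quotients, which are bounded by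
    [lift_lipschitz]. *)
Lemma exists_cluster_tangent t0 x0 (t : nat -> R) (y : nat -> V) : K t0 -> L t0 x0 ->
  (forall n, 0 < `|t n - t0| /\ `|t n - t0| < n.+1%:R^-1) -> (forall n, L (t n) (y n)) ->
  exists2 w, cluster_tangent t0 x0 w & forall eta, 0 < eta ->
    exists n g, [/\ g \in G, `|act (y n) g - x0| < eta &
      `|act (y n) g - x0 - (t n - t0) *: w| <= eta * `|t n - t0| ].
Proof.
move=> Kt0 Lx0 Ht HL.
have [C C0 HC] := lift_lipschitz; have [d d0 Hd] := HC t0 x0 Kt0 Lx0.
have small (a : R) : 0 < a -> exists n0 : nat, forall n, (n0 <= n)%N -> `|t n - t0| < a.
  move=> a0; exists (Num.truncn a^-1) => n n0n; apply: lt_le_trans (Ht n).2 _.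
  rewrite invf_ple ?posrE ?ltr0n //; apply: ltW.
  by apply: lt_le_trans (truncnS_gt _) _; rewrite ler_nat ltnS.
have near (a : R) : 0 < a -> exists n0 : nat, forall n, (n0 <= n)%N -> exists2 g, g \in G & `|act (y n) g - x0| < a.
  move=> a0; have [b b0 Hb] := nearby_lift rG_orth e0 Linv Kt0 Lx0 a0.
  have [n0 Hn0] := small b b0; exists n0 => n /Hn0 tb.
  exact: Hb tb (HL n).
(* With the nearest representatives, the orbits converge to x0 as points. *)
have [g Hg] : {g : nat -> gT & forall n, g n \in G /\ forall h, h \in G -> `|act (y n) (g n) - x0| <= `|act (y n) h - x0|}.
  apply: (@choice _ _ (fun n g => g \in G /\ forall h, h \in G -> `|act (y n) g - x0| <= `|act (y n) h - x0|)) => n.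
  exists [arg min_(g < 1%g in G) `|act (y n) g - x0|]%O.
  by case: arg_minP => // g Gg Hg; split => // h Gh; apply: Hg.
have nearg (a : R) : 0 < a -> exists n0 : nat, forall n, (n0 <= n)%N -> `|act (y n) (g n) - x0| < a.
  move=> a0; have [n0 Hn0] := near a a0; exists n0 => n /Hn0 [h Gh hh].
  by have [_ H] := Hg n; apply: le_lt_trans (H h Gh) hh.
have [n1 Hn1] := nearg d d0; have [n2 Hn2] := small d d0.
pose n3 := maxn n1 n2.
pose z n := act (y (n3 + n)%N) (g (n3 + n)%N) - x0.
pose s n := t (n3 + n)%N - t0.
have s0 n : s n != 0 by rewrite -normr_gt0; have [] := Ht (n3 + n)%N.
have zs n : `|(s n)^-1 *: z n| <= C.
  rewrite normrZ normfV mulrC ler_pdivrMr ?normr_gt0 //.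
  apply: Hd; [apply: Hn2 | apply: Lact => //; exact: (Hg _).1 | apply: Hn1].
    by apply: leq_trans (leq_addr _ _); rewrite leq_maxr.
  by apply: leq_trans (leq_addr _ _); rewrite leq_maxl.
have [w Hw] := bounded_cluster zs.
have good eta : 0 < eta -> exists n, [/\ `|t n - t0| < eta, `|act (y n) (g n) - x0| < eta &
      `|act (y n) (g n) - x0 - (t n - t0) *: w| <= eta * `|t n - t0| ].
  move=> eta0; have [m1 Hm1] := small eta eta0; have [m2 Hm2] := nearg eta eta0.
  have [n nm Hn] := Hw eta eta0 (maxn m1 m2).
  have n1' : (m1 <= n3 + n)%N by apply: leq_trans (leq_addl _ _); apply: leq_trans nm; rewrite leq_maxl.
  have n2' : (m2 <= n3 + n)%N by apply: leq_trans (leq_addl _ _); apply: leq_trans nm; rewrite leq_maxr.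
  exists (n3 + n)%N; split; [exact: Hm1 | exact: Hm2 |].
  have -> : act (y (n3 + n)%N) (g (n3 + n)%N) - x0 - (t (n3 + n)%N - t0) *: w = s n *: ((s n)^-1 *: z n - w).
    by rewrite scalerBr scalerA divff // scale1r.
  by rewrite normrZ mulrC ler_wpM2r // ltW.
exists w => [eta eta0|eta eta0].
  have [n [h1 h2 h3]] := good eta eta0.
  exists (t n), (act (y n) (g n)); split => //; first exact: (Ht n).1.
  by apply: Lact => //; exact: (Hg n).1.
have [n [h1 h2 h3]] := good eta eta0.
by exists n, (g n); split => //; exact: (Hg n).1.
Qed.

(** If lifts approached t0 away from the jets (x0 g, w g), their difference
    quotients would have a cluster value outside the orbit of w under the
    stabilizer of x0. *)
Lemma lift_jet t0 x0 : K t0 -> L t0 x0 -> exists w, jet rG L t0 x0 w.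
Proof.
move=> Kt0 Lx0.
have inv_pos n : 0 < (n.+1%:R : R)^-1 by rewrite invr_gt0 ltr0n.
have [w Hw _] : exists2 w, cluster_tangent t0 x0 w & True.
  pose t n : R := t0 + Num.min e (n.+2%:R^-1).
  have tp n : 0 < Num.min e (n.+2%:R^-1) by rewrite lt_min e0 inv_pos.
  have tE n : t n - t0 = Num.min e (n.+2%:R^-1) by rewrite /t addrAC subrr add0r.
  have It n : I (t n).
    by apply: KI => //; rewrite gtr0_norm // ge_min lexx.
  have [y Hy] : {y : nat -> V & forall n, L (t n) (y n)}.
    by apply: (@choice _ _ (fun n y => L (t n) y)) => n; apply: Lex.
  have [|w Hw _] := exists_cluster_tangent Kt0 Lx0 _ Hy; last by exists w.
  move=> n; rewrite tE gtr0_norm //; split => //.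
  apply: (@le_lt_trans _ _ (n.+2%:R^-1)); first by rewrite ge_min lexx orbT.
  by rewrite ltf_pV2 ?posrE ?ltr0n // ltr_nat.
exists w => eta eta0; apply: contrapT => nd.
have [k k1 Hk] := act_bounded rG.
have k0 : 0 < k by apply: lt_le_trans k1.
have bad n : exists p : R * V, [/\ `|p.1 - t0| < n.+1%:R^-1, L p.1 p.2 &
   forall g, g \in G -> ~ (`|p.2 - act x0 g| <= eta /\
     `|p.2 - act x0 g - (p.1 - t0) *: act w g| <= eta * `|p.1 - t0|)].
  apply: contrapT => nb; apply: nd; exists n.+1%:R^-1 => // t y ty Ly.
  apply: contrapT => ng; apply: nb; exists (t, y); split => //= g Gg h.
  by apply: ng; exists g.
have [p Hp] := choice bad.
have [|w' Hw' H] := @exists_cluster_tangent t0 x0 (fun n => (p n).1) (fun n => (p n).2) Kt0 Lx0 _ (fun n => let: And3 _ h _ := Hp n in h).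
  move=> n; have [h1 h2 h3] := Hp n; split => //.
  rewrite normr_gt0; apply/eqP => tt0; move/eqP: (tt0); rewrite subr_eq0 => /eqP tE.
  rewrite tE in h2; have [g Gg yE] := lift_orbit rG_orth Linv Lx0 h2.
  apply: (h3 g Gg); rewrite yE subrr normr0 tt0 scale0r subr0 !normr0 mulr0.
  by split => //; apply: ltW.
have [h Sh wE] := cluster_tangent_orbit Kt0 Lx0 Hw Hw'.
have [Gh x0h] := rstabP _ _ _ Sh.
have q0 : 0 < eta / k by rewrite divr_gt0.
have [n [g [Gg c1 c2]]] := H _ q0; have [_ _ bn] := Hp n.
have Gg' : (h * g^-1)%g \in G by rewrite groupM ?groupV.
apply: (bn _ Gg'); rewrite -!actM ?groupV // x0h -wE.
have yE : (p n).2 - act x0 g^-1%g = act (act (p n).2 g - x0) g^-1%g by rewrite actB actK.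
have keta a : a <= eta / k -> k * a <= eta by rewrite ler_pdivlMr // mulrC.
split.
  rewrite yE; apply: le_trans (Hk _ _ (groupVr Gg)) _.
  by apply: keta; apply: ltW.
rewrite yE -actZ -actB; apply: le_trans (Hk _ _ (groupVr Gg)) _.
apply: le_trans (ler_wpM2l (ltW k0) c2) _.
by rewrite mulrA [k * _]mulrC divfK // gt_eqF.
Qed.
End Tangents.

(** * Gluing differentiable lifts *)

Section LocallyConstant.
Local Open Scope classical_set_scope.
Variable R : realType.

(** Connectedness of intervals. *)
Lemma interval_locally_constant (D : set R) (P : R -> Prop) : is_interval D ->
  (forall t, D t -> exists2 d : R, 0 < d &
     forall t', D t' -> `|t' - t| < d -> (P t' <-> P t)) ->
  forall t t', D t -> D t' -> P t -> P t'.
Proof.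
move=> /connected_intervalP cD HP t t' Dt Dt' Pt.
pose C (Q : R -> Prop) := [set u | exists t d, [/\ D t, Q t, 0 < d, `|u - t| < d &
   forall t', D t' -> `|t' - t| < d -> (Q t' <-> Q t)]].
have oC Q : open (C Q).
  move=> u [s [d [Ds Qs d0 us Hd]]]; apply/nbhs_ballP.
  exists (d - `|u - s|) => [|v]; first by rewrite /= subr_gt0.
  rewrite /ball /= => uv; exists s, d; split => //.
  rewrite -(subrK u v) -addrA; apply: le_lt_trans (ler_normD _ _) _.
  by rewrite -ltrBrDr distrC.
have E : D `&` P = D.
  apply: cD; first by exists t.
    exists (C P); first exact: oC.
    apply/seteqP; split => u /= [Du].
      by move=> Pu; split => //; have [d d0 Hd] := HP u Du; exists u, d; rewrite subrr normr0.
    by move=> [s [d [Ds Ps d0 us Hd]]]; split => //; apply/(Hd u Du us).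
  exists (~` C (fun u => ~ P u)); first exact/open_closedC/oC.
  apply/seteqP; split => u /= [Du].
    by move=> Pu; split => // -[s [d [Ds Ps d0 us Hd]]]; case: ((Hd u Du us).2 Ps).
  move=> nC; split => //; apply: contrapT => nP; apply: nC.
  have [d d0 Hd] := HP u Du; exists u, d; rewrite subrr normr0; split => // v Dv uv.
  by have := Hd v Dv uv; tauto.
by have [] : (D `&` P) t' by rewrite E.
Qed.

End LocallyConstant.

Section Gluing.
Local Open Scope classical_set_scope.
Variables (R : realType) (gT : finGroupType) (G : {group gT}) (m : nat).
Variable rG : mx_representation R G m.
Local Notation act := (act rG).
Local Notation V := 'rV[R]_m.
Implicit Types (x y w : V) (g h : gT) (t s d eta : R) (D : set R) (b : R -> V).

Variables (I : set R) (L : R -> V -> Prop).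
Local Notation jet := (jet rG L).

Hypothesis Iopen : forall t, I t -> exists2 d : R, 0 < d & forall t', `|t' - t| < d -> I t'.
Hypothesis Lex : forall t, I t -> exists x, L t x.
Hypothesis Ldom : forall t x, L t x -> I t.
Hypothesis Lact : forall t x g, L t x -> g \in G -> L t (act x g).
Hypothesis Ljet : forall t x, L t x -> exists w, jet t x w.

(** Stated with epsilon and delta, as the pieces to be glued are compared through
    their values near t. *)
Definition has_derivative b t := exists y, forall eta, 0 < eta -> exists2 d : R, 0 < d &
  forall t', `|t' - t| < d -> `|b t' - b t - (t' - t) *: y| <= eta * `|t' - t|.

Definition differentiable_lift b t := L t (b t) /\ has_derivative b t.

Lemma has_derivative_continuous b t : has_derivative b t -> forall eta, 0 < eta -> exists2 d : R, 0 < d &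
  forall t', `|t' - t| < d -> `|b t' - b t| <= eta.
Proof.
move=> [y Hy] eta eta0; have [d d0 Hd] := Hy 1 ltr01.
pose k := 1 + `|y|; have k0 : 0 < k by rewrite ltr_pwDl.
exists (Num.min d (eta / k)) => [|t']; first by rewrite lt_min d0 divr_gt0.
rewrite lt_min => /andP[td te].
rewrite -(subrK ((t' - t) *: y) (b t' - b t)); apply: le_trans (ler_normD _ _) _.
apply: le_trans (lerD (Hd _ td) (lexx _)) _.
rewrite normrZ mul1r -{1}[`|t' - t|]mulr1 -mulrDr -/k -ler_pdivlMr //.
exact: ltW.
Qed.

Lemma has_derivative_act b t g : g \in G -> has_derivative b t -> has_derivative (fun t => act (b t) g) t.
Proof.
move=> Gg [y Hy]; have [k k1 Hk] := act_bounded rG.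
have k0 : 0 < k by apply: lt_le_trans k1.
exists (act y g) => eta eta0.
have [d d0 Hd] := Hy (eta / k) (divr_gt0 eta0 k0).
exists d => // t' td; rewrite -actZ -!actB.
apply: le_trans (Hk _ _ Gg) _.
apply: le_trans (ler_wpM2l (ltW k0) (Hd _ td)) _.
by rewrite mulrA [k * _]mulrC divfK // gt_eqF.
Qed.

Lemma differentiable_lift_act b t g : g \in G -> differentiable_lift b t -> differentiable_lift (fun t => act (b t) g) t.
Proof. by move=> Gg [bL bd]; split; [apply: Lact | apply: has_derivative_act]. Qed.

Lemma has_derivative_near b b' t d : 0 < d -> (forall t', `|t' - t| < d -> b t' = b' t') ->
  has_derivative b t -> has_derivative b' t.
Proof.
move=> d0 E [y Hy]; exists y => eta eta0; have [e e0 He] := Hy eta eta0.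
exists (Num.min d e) => [|t']; first by rewrite lt_min d0.
by rewrite lt_min => /andP[td te]; rewrite -!E ?subrr ?normr0 //; apply: He.
Qed.

(** The orbit of (x, w) is finite, and on an interval that ends at s the lift b
    follows a single element of it by connectedness. *)
Lemma onesided_jet D s b x w : is_interval D -> ~ D s -> jet s x w ->
  (forall t, D t -> differentiable_lift b t) ->
  exists2 g, g \in G & forall eta, 0 < eta -> exists2 d : R, 0 < d &
    forall t, D t -> `|t - s| < d -> `|b t - act x g| <= eta /\
       `|b t - act x g - (t - s) *: act w g| <= eta * `|t - s|.
Proof.
move=> iD nDs Hjet Hb.
have [ex ex0 Hex] := orbit_separated rG x.
have [ew ew0 Hew] := orbit_separated rG w.
pose e0 := Num.min ex ew / 4.
have e00 : 0 < e0 by rewrite divr_gt0 // lt_min ex0.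
have e0x : 4 * e0 <= ex by rewrite /e0 mulrCA mulfV // mulr1 ge_min lexx.
have e0w : 4 * e0 <= ew by rewrite /e0 mulrCA mulfV // mulr1 ge_min lexx orbT.
have [k k1 Hk] := act_bounded rG.
have k0 : 0 < k by apply: lt_le_trans k1.
pose close eta t g := `|b t - act x g| <= eta /\
   `|b t - act x g - (t - s) *: act w g| <= eta * `|t - s|.
have Hclose eta : 0 < eta -> exists2 d : R, 0 < d &
    forall t, D t -> `|t - s| < d -> exists2 g, g \in G & close eta t g.
  move=> eta0; have [d d0 Hd] := Hjet eta eta0; exists d => // t Dt td.
  by apply: Hd => //; have [] := Hb t Dt.
have [d0 d00 Hd0] := Hclose e0 e00.
pose D0 := [set t | D t /\ `|t - s| < d0].
have iD0 : is_interval D0.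
  move=> u v [Du ud] [Dv vd] z /andP[uz zv]; split; first by apply: (iD u v) => //; rewrite uz.
  by move: ud vd uz zv; rewrite !ltr_distl; lra.
have neq_s t : D t -> 0 < `|t - s|.
  by move=> Dt; rewrite normr_gt0 subr_eq0; apply/eqP => ts; apply: nDs; rewrite -ts.
(* e0 is small against the gaps in the orbits of x and w: neither at one point
   nor between nearby points can the lift be close to two elements of the orbit
   of (x, w). *)
have same t t' g g' : D t -> D t' -> g \in G -> g' \in G ->
    close e0 t g -> close e0 t' g' ->
    `|b t' - b t| <= e0 -> `|b t' - b t| <= e0 * `|t - s| / 2 ->
    `|t' - t| <= `|t - s| / 4 -> `|t' - t| * (k * `|w|) <= e0 * `|t - s| / 2 ->
    act x g = act x g' /\ act w g = act w g'.
  move=> Dt Dt' Gg Gg' [c1 c2] [c1' c2'] b1 b2 tt tw.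
  have xg : act x g = act x g'.
    apply: Hex => //; apply: le_trans e0x.
    have -> : act x g - act x g' = (b t' - act x g') - (b t - act x g) - (b t' - b t).
      by apply/rowP => j; rewrite !mxE; ring.
    apply: le_trans (ler_normB _ _) _; apply: le_trans (lerD (ler_normB _ _) (lexx _)) _.
    by move: c1 c1' b1 e00; lra.
  split => //; apply: Hew => //; apply: le_trans e0w.
  have tp := neq_s t Dt.
  have E : (t - s) *: (act w g - act w g') =
     (b t' - act x g' - (t' - s) *: act w g') - (b t - act x g - (t - s) *: act w g)
       - (b t' - b t) + (t' - t) *: act w g'.
    rewrite -xg; apply/rowP => j; rewrite !mxE; ring.
  have wk : `|act w g'| <= k * `|w| by apply: Hk.
  have ts : `|t' - s| <= `|t - s| + `|t - s| / 4.
    by rewrite -(subrK t t') -addrA addrC; apply: le_trans (ler_normD _ _) _; rewrite lerD.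
  have : `|t - s| * `|act w g - act w g'| <= 4 * e0 * `|t - s|.
    rewrite -normrZ E.
    apply: le_trans (ler_normD _ _) _.
    apply: le_trans (lerD (le_trans (ler_normB _ _) (lerD (ler_normB _ _) (lexx _))) (lexx _)) _.
    rewrite [`|(t' - t) *: _|]normrZ.
    have h1 : `|t' - t| * `|act w g'| <= e0 * `|t - s| / 2.
      by apply: le_trans tw; rewrite ler_wpM2l.
    have h2 : e0 * `|t' - s| <= e0 * (`|t - s| + `|t - s| / 4) by rewrite ler_wpM2l // ltW.
    move: c2 c2' b2 h1 h2 (mulr_gt0 e00 tp); lra.
  by rewrite mulrC ler_pM2r.
have near t : D t -> exists2 d : R, 0 < d & forall t', D t' -> `|t' - t| < d ->
   [/\ `|b t' - b t| <= e0, `|b t' - b t| <= e0 * `|t - s| / 2,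
    `|t' - t| <= `|t - s| / 4 & `|t' - t| * (k * `|w|) <= e0 * `|t - s| / 2].
  move=> Dt; have tp := neq_s t Dt; have [_ bd] := Hb t Dt.
  have e2 : 0 < e0 * `|t - s| / 2 by rewrite divr_gt0 // mulr_gt0.
  have [d1 d10 H1] := has_derivative_continuous bd e00.
  have [d2 d20 H2] := has_derivative_continuous bd e2.
  have kw : 0 < k * `|w| + 1 by rewrite ltr_wpDl // mulr_ge0 // ltW.
  exists (Num.min (Num.min d1 d2) (Num.min (`|t - s| / 4) (e0 * `|t - s| / 2 / (k * `|w| + 1)))).
    by rewrite !lt_min d10 d20 (divr_gt0 tp) ?ltr0n // (divr_gt0 e2).
  move=> t' Dt'; rewrite !lt_min => /andP[/andP[td1 td2] /andP[td3 td4]].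
  split; [exact: H1 | exact: H2 | exact: ltW |].
  move: td4; rewrite ltr_pdivlMr // => td4; apply: le_trans (ltW td4).
  by rewrite ler_wpM2l // lerDl.
pose P g t := exists g', [/\ g' \in G, act x g' = act x g, act w g' = act w g & close e0 t g'].
have Ploc g : g \in G -> forall t, D0 t -> exists2 d : R, 0 < d & forall t', D0 t' -> `|t' - t| < d -> (P g t' <-> P g t).
  move=> Gg t [Dt td]; have [d dp Hd] := near t Dt; exists d => // t' [Dt' td'] tt'.
  have [h1 h2 h3 h4] := Hd t' Dt' tt'.
  have [a Ga ca] := Hd0 t Dt td; have [a' Ga' ca'] := Hd0 t' Dt' td'.
  have [] := same t t' a a' Dt Dt' Ga Ga' ca ca' h1 h2 h3 h4.
  split=> -[g' [Gg' E1 E2 c']].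
    have [] := same t t' a g' Dt Dt' Ga Gg' ca c' h1 h2 h3 h4.
    by exists a; split => //; congruence.
  have [] := same t t' g' a' Dt Dt' Gg' Ga' c' ca' h1 h2 h3 h4.
  by exists a'; split => //; congruence.
have same0 t g g' : D t -> g \in G -> g' \in G -> close e0 t g -> close e0 t g' ->
    act x g = act x g' /\ act w g = act w g'.
  move=> Dt Gg Gg' c c'; have tp := neq_s t Dt.
  have z1 : 0 <= e0 * `|t - s| / 2 by rewrite ltW // divr_gt0 // mulr_gt0.
  have z2 : 0 <= `|t - s| / 4 by rewrite ltW // divr_gt0.
  by apply: (same t t) => //; rewrite ?subrr ?normr0 ?mul0r // ltW.
have [D0e|D0ne] := pselect (exists t, D0 t); last first.
  exists 1%g => // eta eta0; exists d0 => // t Dt td; exfalso; apply: D0ne; by exists t.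
have [t1 [Dt1 td1]] := D0e.
have [g Gg cg] := Hd0 t1 Dt1 td1.
exists g => // eta eta0.
have em0 : 0 < Num.min eta e0 by rewrite lt_min eta0.
have [d dp Hd] := Hclose _ em0.
exists (Num.min d d0) => [|t Dt]; first by rewrite lt_min dp.
rewrite lt_min => /andP[td td0].
have [g' Gg' [c1 c2]] := Hd t Dt td.
have Pt : P g t.
  apply: (interval_locally_constant iD0 (Ploc g Gg) (t := t1)) => //.
  by exists g.
have [a [Ga E1 E2 ca]] := Pt.
have cg' : close e0 t g'.
  split; first by apply: le_trans c1 _; rewrite ge_min lexx orbT.
  by apply: le_trans c2 _; rewrite ler_wpM2r // ge_min lexx orbT.
have [F1 F2] := same0 t a g' Dt Ga Gg' ca cg'.
rewrite -E1 -E2 F1 F2; split; first by apply: le_trans c1 _; rewrite ge_min lexx.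
by apply: le_trans c2 _; rewrite ler_wpM2r // ge_min lexx.
Qed.

Definition open_real D := forall t, D t -> exists2 d : R, 0 < d & forall t', `|t' - t| < d -> D t'.

(** Both one-sided jets at s lie in the orbit of the same (x, w), so an element of G
    applied to b2 makes them equal. The lift b1 is left unchanged, as needed for
    an extension argument. *)
Lemma patch D1 D2 s b1 b2 : I s -> open_real D1 -> open_real D2 ->
  is_interval D1 -> is_interval D2 -> ~ D1 s -> ~ D2 s ->
  (forall t, D1 t -> ~ D2 t) ->
  (exists2 d : R, 0 < d & forall t, `|t - s| < d -> [\/ D1 t, t = s | D2 t]) ->
  (forall t, D1 t -> differentiable_lift b1 t) -> (forall t, D2 t -> differentiable_lift b2 t) ->
  exists2 b, (forall t, D1 t -> b t = b1 t) &
    forall t, [\/ D1 t, t = s | D2 t] -> differentiable_lift b t.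
Proof.
move=> Is o1 o2 i1 i2 n1 n2 D12 [d0 d00 Hd0] H1 H2.
have [x Lx] := Lex Is; have [w Hw] := Ljet Lx.
have [g1 G1 J1] := onesided_jet i1 n1 Hw H1.
have [g2 G2 J2] := onesided_jet i2 n2 Hw H2.
pose g := (g2^-1 * g1)%g; have Gg : g \in G by rewrite groupM // groupV.
pose b t := if `[< D1 t >] then b1 t else if `[< D2 t >] then act (b2 t) g else act x g1.
have bD1 t : D1 t -> b t = b1 t by move=> Dt; rewrite /b asboolT.
have bD2 t : D2 t -> b t = act (b2 t) g.
  by move=> Dt; rewrite /b asboolF ?asboolT // => /D12.
have bs : b s = act x g1 by rewrite /b !asboolF.
have [k k1 Hk] := act_bounded rG.
have k0 : 0 < k by apply: lt_le_trans k1.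
exists b => // t [Dt|->|Dt].
- have [L1 d1] := H1 t Dt; split; first by rewrite bD1.
  have [d dp Hd] := o1 t Dt; apply: (has_derivative_near dp) d1 => t' tt'.
  by rewrite bD1 //; apply: Hd.
- split; first by rewrite bs; apply: Lact.
  exists (act w g1) => eta eta0.
  have [e1 e10 K1] := J1 eta eta0.
  have [e2 e20 K2] := J2 (eta / k) (divr_gt0 eta0 k0).
  exists (Num.min d0 (Num.min e1 e2)) => [|t']; first by rewrite !lt_min d00 e10.
  rewrite !lt_min => /and3P[t0 t1 t2]; rewrite bs.
  have [Dt'|->|Dt'] := Hd0 t' t0; first by rewrite bD1 //; have [] := K1 t' Dt' t1.
    by rewrite bs !subrr scale0r subrr normr0 mulr_ge0 // ltW.
  have [_ ] := K2 t' Dt' t2; rewrite bD2 // => H.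
  have -> : act (b2 t') g - act x g1 - (t' - s) *: act w g1 =
      act (b2 t' - act x g2 - (t' - s) *: act w g2) g.
    by rewrite !actB actZ !actM // /g mulKVg.
  apply: le_trans (Hk _ _ Gg) _; apply: le_trans (ler_wpM2l (ltW k0) H) _.
  by rewrite mulrA [k * _]mulrC divfK // gt_eqF.
- have [L2 d2] := differentiable_lift_act Gg (H2 t Dt); split; first by rewrite bD2.
  have [d dp Hd] := o2 t Dt; apply: (has_derivative_near dp) d2 => t' tt'.
  by rewrite bD2 //; apply: Hd.
Qed.

Definition local_lift t := exists2 d : R, 0 < d & exists b,
  forall t', `|t' - t| < d -> differentiable_lift b t'.

Lemma interval_cat D1 D2 s : is_interval D1 -> is_interval D2 ->
  (forall e : R, 0 < e -> exists2 u, `|u - s| < e & D1 u) ->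
  (forall e : R, 0 < e -> exists2 u, `|u - s| < e & D2 u) ->
  (forall t, D1 t -> t < s) -> (forall t, D2 t -> s < t) ->
  is_interval [set t | [\/ D1 t, t = s | D2 t]].
Proof.
move=> i1 i2 c1 c2 l1 l2 u v Hu Hv z /andP[uz zv].
have [zs|zs|<-] := ltgtP z s; last by constructor 2.
  constructor 1; have Du : D1 u.
    case: Hu uz => [//|->|/l2 su] uz.
      by move: (le_lt_trans uz zs); rewrite ltxx.
    by move: (lt_trans (lt_le_trans su uz) zs); rewrite ltxx.
  have [a] := c1 _ (etrans (subr_gt0 _ _) zs); rewrite ltr_distl => /andP[za _] Da.
  by apply: (i1 u a) => //; rewrite uz /= ltW //; move: za; rewrite subKr.
constructor 3; have Dv : D2 v.
  case: Hv zv => [/l1 vs|->|//] zv.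
    by move: (lt_trans zs (le_lt_trans zv vs)); rewrite ltxx.
  by move: (lt_le_trans zs zv); rewrite ltxx.
have [a] := c2 _ (etrans (subr_gt0 _ _) zs); rewrite ltr_distl => /andP[_ az] Da.
by apply: (i2 a v) => //; rewrite zv andbT ltW //; move: az; rewrite addrC subrK.
Qed.

Lemma interval_below D s u v : is_interval D -> (forall t, D t -> t < s) ->
  (forall e : R, 0 < e -> exists2 u, `|u - s| < e & D u) -> D u -> u <= v -> v < s -> D v.
Proof.
move=> iD lD cD Du uv vs.
have [a] := cD _ (etrans (subr_gt0 _ _) vs); rewrite ltr_distl => /andP[za _] Da.
by apply: (iD u a) => //; rewrite uv /= ltW //; move: za; rewrite subKr.
Qed.

Lemma interval_above D s u v : is_interval D -> (forall t, D t -> s < t) ->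
  (forall e : R, 0 < e -> exists2 u, `|u - s| < e & D u) -> D u -> v <= u -> s < v -> D v.
Proof.
move=> iD lD cD Du uv vs.
have [a] := cD _ (etrans (subr_gt0 _ _) vs); rewrite ltr_distl => /andP[_ az] Da.
by apply: (iD a u) => //; rewrite uv andbT ltW //; move: az; rewrite addrC subrK.
Qed.

Section Zorn.
Variables (J : set R).
Hypotheses (Jint : is_interval J) (Jopen : open_real J) (JI : J `<=` I).
Hypothesis Jloc : forall t, J t -> local_lift t.

(** Differentiable lifts on open subintervals of J, encoded as graphs, so that the
    union of a chain is again one. The last clause makes the domain open. *)
Definition partial_lift (F : set (R * V)) : Prop :=
  [/\ forall t x y, F (t, x) -> F (t, y) -> x = y,
      is_interval [set t | exists x, F (t, x)]
    & forall t x, F (t, x) -> [/\ J t, L t x & exists y, forall eta, 0 < eta ->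
        exists2 d : R, 0 < d & forall t', `|t' - t| < d -> exists2 x', F (t', x') &
          `|x' - x - (t' - t) *: y| <= eta * `|t' - t| ]].

Lemma partial_lift_bigcup (C : set (set (R * V))) :
  C `<=` partial_lift -> total_on C subset ->
  partial_lift (\bigcup_(F in C) F).
Proof.
move=> HC tot.
have both p q : (\bigcup_(F in C) F) p -> (\bigcup_(F in C) F) q ->
    exists F, [/\ C F, F p & F q].
  move=> [F CF Fp] [F' CF' Fq]; have [FF'|F'F] := tot F F' CF CF'.
    by exists F'; split => //; apply: FF'.
  by exists F; split => //; apply: F'F.
split.
- move=> t x y Hx Hy; have [F [CF Fx Fy]] := both _ _ Hx Hy.
  by have [fF _ _] := HC F CF; apply: fF Fx Fy.
- move=> u v [x Hx] [y Hy] z uzv; have [F [CF Fx Fy]] := both _ _ Hx Hy.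
  have [_ iF _] := HC F CF.
  have [a Fa] := iF u v (ex_intro _ x Fx) (ex_intro _ y Fy) z uzv.
  by exists a; exists F.
- move=> t x [F CF Fx]; have [_ _ dF] := HC F CF.
  have [Jt Ltx [y Hy]] := dF t x Fx; split => //; exists y => eta eta0.
  have [d d0 Hd] := Hy eta eta0; exists d => // t' tt'.
  by have [x' Fx' H] := Hd t' tt'; exists x' => //; exists F.
Qed.

Lemma graph_partial_lift D b : is_interval D -> open_real D -> D `<=` J ->
  (forall t, D t -> differentiable_lift b t) ->
  partial_lift [set p | D p.1 /\ p.2 = b p.1].
Proof.
move=> iD oD DJ Hb; split => /=.
- by move=> t x y [_ ->] [_ ->].
- by move=> u v [x [Du _]] [y [Dv _]] z uzv; exists (b z); split => //; apply: (iD u v).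
- move=> t x [Dt ->]; have [bL [y Hy]] := Hb t Dt; split => //; first exact: DJ.
  exists y => eta eta0; have [d d0 Hd] := Hy eta eta0; have [d' d'0 Hd'] := oD t Dt.
  exists (Num.min d d') => [|t']; first by rewrite lt_min d0.
  rewrite lt_min => /andP[td td']; exists (b t'); first by split => //; apply: Hd'.
  exact: Hd.
Qed.

(** A maximal lift cannot end at a point s of J, since it could be patched at s
    with the local lift on the other side. *)
Lemma glue_interval : exists b, forall t, J t -> differentiable_lift b t.
Proof.
have [[t0 Jt0]|Jne] := pselect (exists t, J t); last first.
  by exists (fun=> 0) => t Jt; exfalso; apply: Jne; exists t.
have [F [HF Fmax]] := Zorn_bigcup partial_lift_bigcup.
have [fF iF dF] := HF.
pose D := [set t | exists x, F (t, x)].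
have [bF HbF] : {bF & forall t, D t -> F (t, bF t)}.
  apply: (@choice _ _ (fun t x => D t -> F (t, x))) => t.
  have [[x Fx]|nD] := pselect (D t); first by exists x.
  by exists 0 => /nD.
have oD : open_real D.
  move=> t [x Fx]; have [_ _ [y Hy]] := dF t x Fx; have [d d0 Hd] := Hy 1 ltr01.
  by exists d => // t' tt'; have [x' Fx' _] := Hd t' tt'; exists x'.
have DJ : D `<=` J by move=> t [x Fx]; have [] := dF t x Fx.
have liftF t : D t -> differentiable_lift bF t.
  move=> Dt; have [_ Lt [y Hy]] := dF t _ (HbF t Dt); split => //.
  exists y => eta eta0; have [d d0 Hd] := Hy eta eta0; exists d => // t' tt'.
  have [x' Fx' H] := Hd t' tt'.
  by rewrite (fF t' (bF t') x') //; apply: HbF; exists x'.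
have maxD D' b' : is_interval D' -> open_real D' -> D' `<=` J -> D `<=` D' ->
    (forall t, D t -> b' t = bF t) -> (forall t, D' t -> differentiable_lift b' t) -> D' `<=` D.
  move=> iD' oD' D'J DD' bb' Hb' t D't; apply: contrapT => nDt.
  apply: (Fmax [set p | D' p.1 /\ p.2 = b' p.1]); last exact: graph_partial_lift.
  split; last first.
    move=> H; apply: nDt; exists (b' t); by apply: H.
  move=> [u x] Fux; have Du : D u by exists x.
  split => /=; first exact: DD'.
  by rewrite bb' //; apply: fF Fux _; apply: HbF.
have [De|Dne] := pselect (exists t, D t); last first.
  have nD u : ~ D u by move=> Du; apply: Dne; exists u.
  exfalso; apply: Dne; have [d d0 [b Hb]] := Jloc Jt0; have [d' d'0 Hd'] := Jopen Jt0.
  pose D' := [set t | `|t - t0| < Num.min d d'].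
  have Dt0 : D' t0 by rewrite /D' /= subrr normr0 lt_min d0.
  exists t0; apply: (maxD D' b) => //.
  - move=> u v; rewrite /D' /= !ltr_distl => /andP[u1 u2] /andP[v1 v2] z /andP[uz zv].
    by rewrite ltr_distl; apply/andP; split; [apply: lt_le_trans uz | apply: le_lt_trans zv _].
  - move=> u /= ud; exists (Num.min d d' - `|u - t0|) => [|v]; first by rewrite subr_gt0.
    move=> uv; rewrite /D' /= -(subrK u v) -addrA; apply: le_lt_trans (ler_normD _ _) _.
    by rewrite -ltrBrDr.
  - by move=> u; rewrite /D' /= lt_min => /andP[_ /Hd'].
  - by move=> u /nD.
  - by move=> u /nD.
  - by move=> u; rewrite /D' /= lt_min => /andP[/Hb].
exists bF => t Jt; have [/liftF //|nDt] := pselect (D t); exfalso.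
have {De} [u0 Du0] := De.
have [s [Js nDs Dnear side]] : exists s, [/\ J s, ~ D s,
    forall e : R, 0 < e -> exists2 u, `|u - s| < e & D u &
    (forall u, D u -> u < s) \/ (forall u, D u -> s < u)].
  have neq u : D u -> u != t by move=> Du; apply/eqP => ut; apply: nDt; rewrite -ut.
  have [ltu|ltu] := ltP u0 t.
    have Dt u : D u -> u < t.
      move=> Du; rewrite lt_neqAle neq //= leNgt; apply/negP => tu.
      by apply: nDt; apply: (iF u0 u) => //; rewrite !ltW.
    have hD : has_sup D by split; [exists u0 | exists t => u /Dt/ltW].
    have supt : sup D <= t by apply: ge_sup => [|u /Dt/ltW //]; exists u0.
    have nDs : ~ D (sup D).
      move=> Ds; have [e e0 He] := oD _ Ds.
      have : D (sup D + e / 2).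
        by apply: He; rewrite addrC addKr gtr0_norm ?divr_gt0 // ltr_pdivrMr // ltr_pMr // ltr1n.
      by move/(ub_le_sup hD.2); rewrite gerDl leNgt divr_gt0.
    exists (sup D); split => //.
    - by apply: (Jint (x := u0) (y := t)) => //; [exact: DJ | rewrite supt andbT; apply: ub_le_sup hD.2 _ _].
    - move=> e e0; have [u Du ue] := sup_adherent e0 hD; exists u => //.
      by rewrite ltr_distl ue /=; apply: le_lt_trans (ub_le_sup hD.2 Du) _; rewrite ltrDl.
    - left=> u Du; rewrite lt_neqAle (ub_le_sup hD.2 Du) andbT; apply/eqP => us.
      by apply: nDs; rewrite -us.
  have Dt u : D u -> t < u.
    move=> Du; rewrite lt_neqAle eq_sym neq //= leNgt; apply/negP => tu.
    by apply: nDt; apply: (iF u u0) => //; rewrite ltu ltW.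
  have hD : has_inf D by split; [exists u0 | exists t => u /Dt/ltW].
  have tinf : t <= inf D by apply: lb_le_inf => [|u /Dt/ltW //]; exists u0.
  have nDs : ~ D (inf D).
    move=> Ds; have [e e0 He] := oD _ Ds.
    have : D (inf D - e / 2).
      by apply: He; rewrite addrC addKr normrN gtr0_norm ?divr_gt0 // ltr_pdivrMr // ltr_pMr // ltr1n.
    by move/(ge_inf hD.2); rewrite lerDl oppr_ge0 leNgt divr_gt0.
  exists (inf D); split => //.
  - by apply: (Jint (x := t) (y := u0)) => //; [exact: DJ | rewrite tinf /=; apply: ge_inf hD.2 _ _].
  - move=> e e0; have [u Du ue] := inf_adherent e0 hD; exists u => //.
    rewrite ltr_distl ue andbT; apply: lt_le_trans (ge_inf hD.2 Du).
    by rewrite ltrBlDr ltrDl.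
  - right=> u Du; rewrite lt_neqAle (ge_inf hD.2 Du) andbT; apply/eqP => us.
    by apply: nDs; rewrite us.
have [d d0 [b2 Hb2]] := Jloc Js; have [d' d'0 Hd'] := Jopen Js.
pose r := Num.min d d'; have r0 : 0 < r by rewrite lt_min d0.
have [u1 u1s Du1] := Dnear r r0.
have interval_oo (a a' : R) : is_interval [set u | a < u /\ u < a'] /\ open_real [set u | a < u /\ u < a'].
  split.
    by move=> u v [u1' u2] [v1 v2] z /andP[uz zv]; split; [apply: lt_le_trans uz | apply: le_lt_trans zv _].
  move=> u [ua ub]; exists (Num.min (u - a) (a' - u)); first by rewrite lt_min !subr_gt0 ua.
  by move=> v; rewrite lt_min !ltr_distl => /andP[/andP[h1 h2] /andP[h3 h4]]; split; lra.
have nearJ u : `|u - s| < r -> J u /\ differentiable_lift b2 u.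
  by rewrite lt_min => /andP[ud ud']; split; [apply: Hd' | apply: Hb2].
have extend D2 : is_interval D2 -> open_real D2 -> ~ D2 s -> (forall u, D u -> ~ D2 u) ->
    (forall u, D2 u -> `|u - s| < r) -> is_interval [set t | [\/ D t, t = s | D2 t]] ->
    (exists2 e : R, 0 < e & forall t, `|t - s| < e -> [\/ D t, t = s | D2 t]) -> False.
  move=> iD2 oD2 nD2 DD2 D2r iU cover.
  have [b bE Hb] := patch (JI Js) oD oD2 iF iD2 nDs nD2 DD2 cover liftF (fun u Du => (nearJ u (D2r u Du)).2).
  apply: nDs; apply: (maxD [set t | [\/ D t, t = s | D2 t]] b) => //.
  - move=> u [Du|->|Du].
    + by have [e e0 He] := oD u Du; exists e => // v /He; constructor 1.
    + exact: cover.
    + by have [e e0 He] := oD2 u Du; exists e => // v /He; constructor 3.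
  - by move=> u [/DJ //|-> //|/D2r/nearJ[]].
  - by move=> u Du; constructor 1.
  - by constructor 2.
case: side => side.
- have [iD2 oD2] := interval_oo s (s + r).
  apply: (extend _ iD2 oD2).
  + by move=> []; rewrite ltxx.
  + by move=> u /side us [su _]; move: (lt_trans us su); rewrite ltxx.
  + by move=> u [h1 h2]; rewrite ltr_distl h2 andbT; apply: lt_trans h1; rewrite ltrBlDr ltrDl.
  + apply: interval_cat => //; last by move=> u [].
    move=> e e0; have q0 : 0 < Num.min e r by rewrite lt_min e0.
    exists (s + Num.min e r / 2).
      rewrite addrC addKr gtr0_norm ?divr_gt0 //.
      rewrite ltr_pdivrMr //; apply: (@le_lt_trans _ _ e); first by rewrite ge_min lexx.
      by rewrite ltr_pMr // ltr1n.
    split; first by rewrite ltrDl divr_gt0.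
    rewrite ltrD2l ltr_pdivrMr //; apply: (@le_lt_trans _ _ r); first by rewrite ge_min lexx orbT.
    by rewrite ltr_pMr // ltr1n.
  + exists (Num.min (s - u1) r) => [|v]; first by rewrite lt_min subr_gt0 side.
    rewrite lt_min !ltr_distl => /andP[/andP[h1 h2] /andP[h3 h4]].
    have [vs|vs|->] := ltgtP v s; [constructor 1 | constructor 3 | by constructor 2] => //.
    by apply: (interval_below iF side Dnear Du1) => //; move: h1; rewrite subKr => /ltW.
- have [iD2 oD2] := interval_oo (s - r) s.
  apply: (extend _ iD2 oD2).
  + by move=> []; rewrite ltxx.
  + by move=> u /side us [_ su]; move: (lt_trans us su); rewrite ltxx.
  + by move=> u [h1 h2]; rewrite ltr_distl h1 /=; apply: lt_trans h2 _; rewrite ltrDl.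
  + have iU : is_interval [set t | [\/ [set u | s - r < u /\ u < s] t, t = s | D t]].
      apply: interval_cat => //; last by move=> u [].
      move=> e e0; have q0 : 0 < Num.min e r by rewrite lt_min e0.
      exists (s - Num.min e r / 2).
        rewrite addrC addKr normrN gtr0_norm ?divr_gt0 //.
        rewrite ltr_pdivrMr //; apply: (@le_lt_trans _ _ e); first by rewrite ge_min lexx.
        by rewrite ltr_pMr // ltr1n.
      split; last by rewrite ltrBlDr ltrDl divr_gt0.
      rewrite ltrD2l ltrN2 ltr_pdivrMr //; apply: (@le_lt_trans _ _ r); first by rewrite ge_min lexx orbT.
      by rewrite ltr_pMr // ltr1n.
    have sym u : [\/ D u, u = s | [set u | s - r < u /\ u < s] u] <-> [\/ [set u | s - r < u /\ u < s] u, u = s | D u].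
      by split=> -[h|h|h]; [constructor 3|constructor 2|constructor 1|constructor 3|constructor 2|constructor 1].
    by move=> u v /sym hu /sym hv z hz; apply/sym; apply: (iU u v).
  + exists (Num.min (u1 - s) r) => [|v]; first by rewrite lt_min subr_gt0 side.
    rewrite lt_min !ltr_distl => /andP[/andP[h1 h2] /andP[h3 h4]].
    have [vs|vs|->] := ltgtP v s; [constructor 3 | constructor 1 | by constructor 2] => //.
    by apply: (interval_above iF side Dnear Du1) => //; move: h2; rewrite addrC subrK => /ltW.
Qed.
End Zorn.

Lemma between_split (a b c p : R) : (a <= p <= b) || (b <= p <= a) ->
  ((a <= p <= c) || (c <= p <= a)) || ((c <= p <= b) || (b <= p <= c)).
Proof.
move=> /orP[/andP[h1 h2]|/andP[h1 h2]]; case: (leP p c) => h;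
  rewrite ?h1 ?h2 ?(ltW h) ?andbT ?orbT //=.
Qed.

Section InductionStep.
Variables (t0 : R) (x0 : V).
Hypothesis Lt0 : L t0 x0.
Let H := rstab rG x0.
Hypothesis IH : forall t x, L t x -> (#|rstab rG x| < #|H|)%N -> local_lift t.

(** E' is the set of accumulation points of E. Its complement A is open and has
    local lifts, hence lifts on its connected components, which can be moved into
    the ball of radius r1 around x0. On E' the lift is the unique one in that
    ball. *)
Lemma local_step : local_lift t0.
Proof.
have [k k1 Hk] := act_bounded rG.
have k0 : 0 < k by apply: lt_le_trans k1.
have [r r0 Hr] := slice_radius rG x0.
have HG g : g \in H -> g \in G by case/rstabP.
have Hx0 g : g \in H -> act x0 g = x0 by case/rstabP.
(* Every orbit near t0 meets the ball of radius r2. A lift that does so once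
   stays within r1, because G distorts norms by at most k. The margin r - r1
   absorbs the errors in the jets. *)
pose r1 := r / 2; have r10 : 0 < r1 by rewrite divr_gt0.
have r1r : r1 < r by rewrite ltr_pdivrMr // ltr_pMr // ltr1n.
have r11 : r1 + r1 = r by rewrite -splitr.
pose r2 := r1 / k; have r20 : 0 < r2 by rewrite divr_gt0.
have r21 : r2 <= r1 by rewrite ler_pdivrMr // ler_peMr // ltW.
have r2r : r2 < r by apply: le_lt_trans r1r.
have inB1 y g : g \in H -> `|act y g - x0| < r2 -> `|y - x0| < r1.
  move=> Hg yg; have Gg := HG _ Hg.
  have -> : y - x0 = act (act y g - x0) g^-1%g.
    by rewrite actB actK // -{2}(Hx0 g Hg) actK.
  apply: le_lt_trans (Hk _ _ (groupVr Gg)) _.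
  by rewrite mulrC -ltr_pdivlMr.
have [d0 d00 Hd0] : exists2 d : R, 0 < d & forall t, `|t - t0| < d ->
    I t /\ forall y, L t y -> exists2 g, g \in G & `|act y g - x0| < r2.
  have [w0 Hw0] := Ljet Lt0.
  have q0 : 0 < r2 / (2 * k) by rewrite divr_gt0 // mulr_gt0.
  have [d1 d10 Hd1] := Hw0 _ q0.
  have [d2 d20 Hd2] := Iopen (Ldom Lt0).
  exists (Num.min d1 d2) => [|t]; first by rewrite lt_min d10.
  rewrite lt_min => /andP[td1 td2]; split; first exact: Hd2.
  move=> y Ly; have [g Gg [yg _]] := Hd1 t y td1 Ly.
  exists g^-1%g; first by rewrite groupV.
  have -> : act y g^-1%g - x0 = act (y - act x0 g) g^-1%g by rewrite actB actK.
  apply: le_lt_trans (Hk _ _ (groupVr Gg)) _.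
  apply: le_lt_trans (ler_wpM2l (ltW k0) yg) _.
  have -> : k * (r2 / (2 * k)) = r2 / 2 by field; rewrite gt_eqF.
  by rewrite ltr_pdivrMr // ltr_pMr // ltr1n.
pose J t := `|t - t0| < d0.
have JI t : J t -> I t by move=> /Hd0[].
have Jnear t y : J t -> L t y -> exists2 g, g \in G & `|act y g - x0| < r2.
  by move=> /Hd0[_]; apply.
have Jint : is_interval J.
  move=> u v; rewrite /J !ltr_distl => /andP[u1 u2] /andP[v1 v2] z /andP[uz zv].
  by rewrite ltr_distl; apply/andP; split; [apply: lt_le_trans uz | apply: le_lt_trans zv _].
have Jopen : open_real J.
  move=> u Ju; exists (d0 - `|u - t0|) => [|v uv]; first by rewrite subr_gt0.
  rewrite /J -(subrK u v) -addrA; apply: le_lt_trans (ler_normD _ _) _.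
  by rewrite -ltrBrDr.
pose fixed x := forall h, h \in H -> act x h = x.
(* E consists of the parameters in J at which the isotropy group is still
   conjugate to H. *)
pose E t := J t /\ exists x, [/\ L t x, `|x - x0| < r2 & fixed x].
have fixB2 t x : J t -> L t x -> `|x - x0| < r -> fixed x -> `|x - x0| < r2.
  move=> Jt Lx xr fx; have [g Gg xg] := Jnear t x Jt Lx.
  by rewrite -(fx g) //; apply: Hr Gg xr (lt_trans xg r2r).
have nElocal t : J t -> ~ E t -> local_lift t.
  move=> Jt nE; have [y Ly] := Lex (JI t Jt); have [g Gg yg] := Jnear t y Jt Ly.
  apply: (IH (x := act y g) (t := t)); first exact: Lact.
  apply: proper_card; rewrite finset.properEneq; apply/andP; split.
    apply/eqP => e; apply: nE; split => //; exists (act y g); split => //; first exact: Lact.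
    by move=> h; rewrite -e => /rstabP[].
  apply/fintype.subsetP => h /rstabP[Gh e]; have yr := lt_trans yg r2r.
  by apply: (Hr (act y g)) => //; rewrite e.
have Eclosed t : J t -> (forall d : R, 0 < d -> exists2 t', `|t' - t| < d & E t') -> E t.
  move=> Jt acc; have [z Lz] := Lex (JI t Jt); have [w Hw] := Ljet Lz.
  have [e e0 He] := orbit_separated rG z.
  have kk : 0 < k + 1 by rewrite addr_gt0.
  pose eta := Num.min (e / (k + 1)) r1.
  have eta0 : 0 < eta by rewrite lt_min r10 divr_gt0.
  have [d dp Hd] := Hw eta eta0.
  have [t' tt' [Jt' [x' [Lx' x'r fx']]]] := acc d dp.
  have [g Gg [c1 _]] := Hd t' x' tt' Lx'.
  have zgr : `|act z g - x0| < r.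
    rewrite -(subrKA x') -r11; apply: le_lt_trans (ler_normD _ _) _.
    rewrite distrC; apply: ler_ltD; first by apply: le_trans c1 _; rewrite ge_min lexx orbT.
    exact: lt_le_trans x'r r21.
  have fz : fixed (act z g).
    move=> h Hh; have Gh := HG _ Hh.
    rewrite actM //; apply: He => //; rewrite ?groupM // -actM //.
    have -> : act (act z g) h - act z g = (x' - act z g) - act (x' - act z g) h.
      by rewrite actB fx' // opprB [RHS]addrC subrKA.
    apply: le_trans (ler_normB _ _) _.
    apply: le_trans (lerD c1 (le_trans (Hk _ _ (HG _ Hh)) (ler_wpM2l (ltW k0) c1))) _.
    have -> : eta + k * eta = eta * (k + 1) by ring.
    by rewrite -ler_pdivlMr // ge_min lexx.
  have Lzg : L t (act z g) by apply: Lact.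
  by split => //; exists (act z g); split => //; exact: (fixB2 t).
pose E' t := E t /\ forall d : R, 0 < d -> exists2 t', `|t' - t| < d & t' != t /\ E t'.
have E'jet t x w : L t x -> `|x - x0| < r2 -> fixed x -> jet t x w ->
    (forall d : R, 0 < d -> exists2 t', `|t' - t| < d & t' != t /\ E t') -> fixed w.
  move=> Lx xr fx Hw acc.
  have [e e0 He] := orbit_separated rG w.
  have kk : 0 < k + 1 by rewrite addr_gt0.
  pose eta := Num.min (e / (k + 1)) r1.
  have eta0 : 0 < eta by rewrite lt_min r10 divr_gt0.
  have [d dp Hd] := Hw eta eta0.
  have [t' tt' [neq [Jt' [x' [Lx' x'r fx']]]]] := acc d dp.
  have [g Gg [c1 c2]] := Hd t' x' tt' Lx'.
  have Hg : g \in H.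
    apply: (Hr x) => //; first exact: lt_trans xr r2r.
    rewrite -(subrKA x') -r11; apply: le_lt_trans (ler_normD _ _) _.
    rewrite distrC; apply: ler_ltD; first by apply: le_trans c1 _; rewrite ge_min lexx orbT.
    exact: lt_le_trans x'r r21.
  rewrite (fx g Hg) in c2.
  have tp : 0 < `|t' - t| by rewrite normr_gt0 subr_eq0.
  have fw : fixed (act w g).
    move=> h Hh; have Gh := HG _ Hh.
    rewrite actM //; apply: He => //; rewrite ?groupM // -actM //.
    rewrite -(ler_pM2l tp) -normrZ.
    have -> : (t' - t) *: (act (act w g) h - act w g) =
       (x' - x - (t' - t) *: act w g) - act (x' - x - (t' - t) *: act w g) h.
      rewrite !actB actZ fx' // fx // scalerBr.
      by rewrite opprB [RHS]addrC subrKA.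
    apply: le_trans (ler_normB _ _) _.
    apply: le_trans (lerD c2 (le_trans (Hk _ _ (HG _ Hh)) (ler_wpM2l (ltW k0) c2))) _.
    have -> : eta * `|t' - t| + k * (eta * `|t' - t|) = `|t' - t| * (eta * (k + 1)) by ring.
    by rewrite ler_pM2l // -ler_pdivlMr // ge_min lexx.
  by rewrite -(actK rG w Gg) fw ?groupV // => h Hh; apply: fw.
pose A t := J t /\ ~ E' t.
have AJ : A `<=` J by move=> t [].
have Aopen : open_real A.
  move=> t [Jt nE]; have [dJ dJ0 HdJ] := Jopen t Jt.
  have [d dp Hd] : exists2 d : R, 0 < d & forall t', `|t' - t| < d -> t' != t -> ~ E t'.
    apply: contrapT => nd; apply: nE.
    have acc d : 0 < d -> exists2 t', `|t' - t| < d & t' != t /\ E t'.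
      move=> dp; apply: contrapT => nt; apply: nd; exists d => // t' tt' neq Et'.
      by apply: nt; exists t'.
    split => //; apply: Eclosed => // d dp.
    by have [t' tt' [_ Et']] := acc d dp; exists t'.
  exists (Num.min d dJ) => [|t']; first by rewrite lt_min dp.
  rewrite lt_min => /andP[td tdJ]; split; first exact: HdJ.
  have [->|neq] := eqVneq t' t => //.
  by move=> [Et' _]; apply: (Hd t').
have Alocal t : A t -> local_lift t.
  move=> [Jt nE']; have [Et|nEt] := pselect (E t); last exact: nElocal.
  have [d dp Hd] : exists2 d : R, 0 < d & forall t', `|t' - t| < d -> t' != t -> ~ E t'.
    apply: contrapT => nd; apply: nE'; split => // d dp; apply: contrapT => nt; apply: nd.
    by exists d => // t' tt' neq Et'; apply: nt; exists t'.
  have [dJ dJ0 HdJ] := Jopen t Jt.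
  pose e := Num.min d dJ; have e0 : 0 < e by rewrite lt_min dp.
  have punct u : `|u - t| < e -> u != t -> local_lift u.
    by rewrite lt_min => /andP[ud udJ] neq; apply: nElocal; [apply: HdJ | apply: Hd].
  have oo (a a' : R) : is_interval [set u | a < u /\ u < a'] /\ open_real [set u | a < u /\ u < a'].
    split.
      by move=> u v [u1' u2] [v1 v2] z /andP[uz zv]; split; [apply: lt_le_trans uz | apply: le_lt_trans zv _].
    move=> u [ua ub]; exists (Num.min (u - a) (a' - u)); first by rewrite lt_min !subr_gt0 ua.
    by move=> v; rewrite lt_min !ltr_distl => /andP[/andP[h1 h2] /andP[h3 h4]]; split; lra.
  have [iD1 oD1] := oo (t - e) t; have [iD2 oD2] := oo t (t + e).
  have in1 u : t - e < u /\ u < t -> `|u - t| < e.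
    by move=> [h1 h2]; rewrite ltr_distl h1 /=; apply: lt_trans h2 _; rewrite ltrDl.
  have in2 u : t < u /\ u < t + e -> `|u - t| < e.
    by move=> [h1 h2]; rewrite ltr_distl h2 andbT; apply: lt_trans h1; rewrite ltrBlDr ltrDl.
  have inJ u : `|u - t| < e -> J u by rewrite lt_min => /andP[_ /HdJ].
  have [b1 Hb1] : exists b, forall u, t - e < u /\ u < t -> differentiable_lift b u.
    apply: (glue_interval iD1 oD1) => u Du; first exact/JI/inJ/in1.
    by apply: punct; [apply: in1 | rewrite lt_eqF //; case: Du].
  have [b2 Hb2] : exists b, forall u, t < u /\ u < t + e -> differentiable_lift b u.
    apply: (glue_interval iD2 oD2) => u Du; first exact/JI/inJ/in2.
    by apply: punct; [apply: in2 | rewrite gt_eqF //; case: Du].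
  have cover u : `|u - t| < e -> [\/ t - e < u /\ u < t, u = t | t < u /\ u < t + e].
    rewrite ltr_distl => /andP[h1 h2].
    by case: (ltgtP u t) => h; [constructor 1 | constructor 3 | constructor 2].
  have n1 : ~ [set u | t - e < u /\ u < t] t by move=> []; rewrite ltxx.
  have n2 : ~ [set u | t < u /\ u < t + e] t by move=> []; rewrite ltxx.
  have n12 u : [set u | t - e < u /\ u < t] u -> ~ [set u | t < u /\ u < t + e] u.
    by move=> [_ ut] [tu _]; move: (lt_trans ut tu); rewrite ltxx.
  have [b _ Hb] := patch (JI t Jt) oD1 oD2 iD1 iD2 n1 n2 n12
     (ex_intro2 _ _ e e0 cover) Hb1 Hb2.
  by exists e => //; exists b => u /cover; apply: Hb.
have normalize C b : is_interval C -> C `<=` J -> (forall u, C u -> differentiable_lift b u) ->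
    exists b', forall u, C u -> differentiable_lift b' u /\ `|b' u - x0| < r1.
  move=> iC CJ Hb; have [[t1 Ct1]|nC] := pselect (exists u, C u); last first.
    by exists b => u Cu; exfalso; apply: nC; exists u.
  have [g Gg tg] := Jnear t1 (b t1) (CJ _ Ct1) (Hb _ Ct1).1.
  pose b' u := act (b u) g; exists b'.
  have Hb' u : C u -> differentiable_lift b' u by move=> Cu; apply: differentiable_lift_act => //; apply: Hb.
  move=> u Cu; split; first exact: Hb'.
  apply: (interval_locally_constant (P := fun u => `|b' u - x0| < r1) iC _ (t := t1)) => //; last first.
    exact: lt_le_trans tg r21.
  move=> {u Cu} u Cu; have [Lu bdu] := Hb' u Cu.
  have [h Gh uh] := Jnear u (b' u) (CJ _ Cu) Lu.
  have [q|q] := pselect (`|b' u - x0| < r1).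
    have e0 : 0 < (r1 - `|b' u - x0|) / 2 by rewrite divr_gt0 // subr_gt0.
    have [d dp Hd] := has_derivative_continuous bdu e0.
    exists d => // u' Cu' uu'; split => // _.
    rewrite -(subrKA (b' u)); apply: le_lt_trans (ler_normD _ _) _.
    apply: le_lt_trans (lerD (Hd u' uu') (lexx _)) _.
    by move: q; set a := `|_| => q; lra.
  have nHh : h \notin H by apply/negP => Hh; apply: q; apply: inB1 Hh uh.
  have e0 : 0 < (r2 - `|act (b' u) h - x0|) / 2 by rewrite divr_gt0 // subr_gt0.
  have [d dp Hd] := has_derivative_continuous (has_derivative_act Gh bdu) e0.
  exists d => // u' Cu' uu'; split => // q'; exfalso.
  move/negP: nHh; apply; apply: (Hr (b' u')) => //; first exact: lt_trans q' r1r.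
  rewrite -(subrKA (act (b' u) h)); apply: le_lt_trans (ler_normD _ _) _.
  apply: le_lt_trans (lerD (Hd u' uu') (lexx _)) _.
  by move: uh; set a := `|_| => uh; move: r2r; lra.
(* connected components of A *)
pose comp t := [set u | forall p, (t <= p <= u) || (u <= p <= t) -> A p].
have compt t : A t -> comp t t.
  by move=> At p /orP[]/andP[h1 h2]; rewrite (@le_anti _ _ p t) ?h1 ?h2.
have compA t : comp t `<=` A.
  by move=> u; apply; rewrite lexx !andbT; exact: le_total.
have compi t : is_interval (comp t).
  move=> u v Cu Cv z /andP[uz zv] p /orP[]/andP[h1 h2].
    by apply: Cv; rewrite h1 (le_trans h2).
  by apply: Cu; rewrite h2 (le_trans uz) ?orbT.
have compo t : open_real (comp t).
  move=> u Cu; have [d dp Hd] := Aopen u (compA t u Cu).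
  exists d => // v uv p /(between_split u) /orP[/Cu //|pp]; apply: Hd; apply: le_lt_trans uv.
  move: pp => /orP[]/andP[h1 h2].
    by rewrite !ger0_norm ?subr_ge0 ?(le_trans h1) // lerD2r.
  by rewrite !ler0_norm ?subr_le0 ?(le_trans _ h2) // lerN2 lerD2r.
have compE t u : comp t u -> comp u = comp t.
  move=> Cu; apply/seteqP; split => v Cv p.
    by move=> /(between_split u) /orP[/Cu|/Cv].
  by move=> /(between_split t) /orP[|/Cv //]; rewrite orbC => /Cu.
have [F HF] : {F : set R -> R -> V & forall C, (exists2 t, A t & C = comp t) ->
    forall u, C u -> differentiable_lift (F C) u /\ `|F C u - x0| < r1}.
  apply: (@choice _ _ (fun C b => (exists2 t, A t & C = comp t) ->
    forall u, C u -> differentiable_lift b u /\ `|b u - x0| < r1)) => C.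
  have [[t At ->]|nC] := pselect (exists2 t, A t & C = comp t); last by exists (fun=> 0) => /nC.
  have [b Hb] : exists b, forall u, comp t u -> differentiable_lift b u.
    apply: (glue_interval (compi t) (compo t)) => u Cu; first exact/JI/AJ/compA/Cu.
    exact/Alocal/compA/Cu.
  have [b' Hb'] := normalize _ _ (compi t) (fun u Cu => AJ _ (compA t u Cu)) Hb.
  by exists b' => _.
have [e He] : {e : R -> V & forall t, E t -> [/\ L t (e t), `|e t - x0| < r2 & fixed (e t)]}.
  apply: (@choice _ _ (fun t x => E t -> [/\ L t x, `|x - x0| < r2 & fixed x])) => t.
  have [[Jt [x Hx]]|nE] := pselect (E t); first by exists x.
  by exists 0 => /nE.
pose b t := if `[< E' t >] then e t else F (comp t) t.
have bE t : E' t -> b t = e t by move=> h; rewrite /b asboolT.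
have bA t : A t -> b t = F (comp t) t by move=> [_ h]; rewrite /b asboolF.
have FA t : A t -> forall u, comp t u -> differentiable_lift (F (comp t)) u /\ `|F (comp t) u - x0| < r1.
  by move=> At; apply: HF; exists t.
have bval t : J t -> L t (b t) /\ `|b t - x0| < r1.
  move=> Jt; have [h|h] := pselect (E' t).
    rewrite bE //; have [h1 h2 _] := He t h.1; split => //; exact: lt_le_trans r21.
  have At : A t by [].
  by rewrite bA //; have [[h1 _] h2] := FA t At t (compt t At).
exists d0 => //; exists b => t Jt; split; first exact: (bval t Jt).1.
have [h|h] := pselect (E' t); last first.
  have At : A t by [].
  have [[_ bd] _] := FA t At t (compt t At).
  have [d dp Hd] := compo t t (compt t At); apply: (has_derivative_near dp) bd => t' tt'.
  have Ct' := Hd t' tt'.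
  by rewrite bA ?(compE t t') //; apply: compA Ct'.
have [Lx xr fx] := He t h.1; have [w Hw] := Ljet Lx.
have fw := E'jet t (e t) w Lx xr fx Hw h.2.
exists w => eta eta0.
have em0 : 0 < Num.min eta r1 by rewrite lt_min eta0.
have [d dp Hd] := Hw _ em0; have [dJ dJ0 HdJ] := Jopen t Jt.
exists (Num.min d dJ) => [|t']; first by rewrite lt_min dp.
rewrite lt_min => /andP[td tdJ].
have [Lb br] := bval t' (HdJ t' tdJ).
have [g Gg [c1 c2]] := Hd t' (b t') td Lb.
have Hg : g \in H.
  apply: (Hr (e t)) => //; first exact: lt_trans xr r2r.
  rewrite -(subrKA (b t')) -r11; apply: le_lt_trans (ler_normD _ _) _.
  by rewrite distrC; apply: ler_ltD => //; apply: le_trans c1 _; rewrite ge_min lexx orbT.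
rewrite (bE t h); move: c2; rewrite (fx g Hg) (fw g Hg) => /le_trans; apply.
by rewrite ler_wpM2r // ge_min lexx.
Qed.
End InductionStep.

Theorem local_lift_exists t : I t -> local_lift t.
Proof.
move=> It; have [x Lx] := Lex It.
have [n] := ubnP #|rstab rG x|; elim: n t x Lx {It} => // n IHn t x Lx; rewrite ltnS => xn.
apply: (local_step Lx) => t' x' Lx' lt; apply: (IHn t' x' Lx').
exact: leq_trans lt xn.
Qed.
End Gluing.

(** * The theorem *)

Section Final.
Local Open Scope classical_set_scope.
Variable R : realType.

Lemma has_derivative_derivable m (b : R -> 'rV[R]_m) t (y : 'rV[R]_m) :
  (forall eta, 0 < eta -> exists2 d : R, 0 < d &
    forall t', `|t' - t| < d -> `|b t' - b t - (t' - t) *: y| <= eta * `|t' - t|) ->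
  derivable b t 1 /\ derive1 b t = y.
Proof.
move=> H.
have cv : (fun h : R => h^-1 *: (b (h *: 1 + t) - b t)) @ 0^' --> y.
  apply/cvgrPdist_le => /= eta eta0; have [d d0 Hd] := H eta eta0.
  near=> h; have h0 : h != 0 by near: h; exact: nbhs_dnbhs_neq.
  have hd : `|h| < d by near: h; exact: dnbhs0_lt.
  have hp : 0 < `|h| by rewrite normr_gt0.
  have := Hd (h + t); rewrite addrK => /(_ hd) Hh.
  rewrite -(ler_pM2l hp) -normrZ scalerBr scalerA divff // scale1r.
  by rewrite [_%:A]mulr1 distrC mulrC.
split; first by apply/cvg_ex; exists y.
by rewrite derive1E; apply: cvg_lim.
Unshelve. all: by end_near. Qed.

Lemma euclidean_norm_le m (x : 'rV[R]_m) (C : R) : 0 <= C -> `|x| <= C ->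
  euclidean_norm x <= Num.sqrt (m%:R * C ^+ 2).
Proof.
move=> C0 xC; rewrite /euclidean_norm ler_sqrt; last first.
  by rewrite mulr_ge0 // sqr_ge0.
have -> : m%:R * C ^+ 2 = \sum_(j < m) C ^+ 2 by rewrite sumr_const card_ord mulr_natl.
apply: ler_sum => j _; rewrite -[x 0 j ^+ 2]real_normK ?num_real //.
by rewrite ler_pXn2r ?nnegrE // (le_trans (coord_le_norm x j)).
Qed.
End Final.

Theorem corollary8p2 (R : realType) (gT : finGroupType) (G : {group gT})
    (m : nat) (rG : mx_representation R G m) (rG_orth : orthogonal_repr rG)
    (l : nat) (W : 'I_l -> 'M[R]_m)
    (W_irr : forall i, mxsimple rG (W i))
    (W_sum : (\sum_(i < l) W i :=: 1%:M)%MS)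
    (W_direct : mxdirect (\sum_(i < l) W i)%MS)
    (v : 'I_l -> 'rV[R]_m)
    (v_in : forall i, (v i <= W i)%MS)
    (v_neq0 : forall i, v i != 0)
    (v_max : forall i (w : 'rV[R]_m), (w <= W i)%MS -> w != 0 ->
       (#|rstab rG w| <= #|rstab rG (v i)|)%N)
    (sigma : seq (mpoly m R)) (sigma_gen : homogeneous_generators rG sigma)
    (d : nat) (d_rho : is_max_generator_degree rG d) :
  property_B sigma (maxn d (\max_(i < l) (#|G| %/ #|rstab rG (v i)|)%N)).
Proof.
set k := maxn d _.
have [gens [[[gens_inv _ gens_gen] _] dE]] := d_rho.
have gens_deg p : p \in gens -> (pdeg p <= k)%N.
  by move=> pg; apply: leq_trans (leq_maxl _ _); rewrite dE; apply: leq_bigmax_seq.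
have v_orbit i : (#|G| %/ #|rstab rG (v i)| <= k)%N.
  by apply: leq_trans (leq_maxr _ _); apply: (leq_bigmax i).
have [sigma_inv _ sigma_gens] := sigma_gen.
exists (range (orbit_map sigma)); split => //; first exact: withinT.
move=> I c oI _ Uc cc t1 It1.
have /nbhs_ballP [r /= r0 Hr] := open_nbhs_nbhs (conj oI It1).
pose e := Num.min (r / 4) 1.
have e0 : 0 < e by rewrite lt_min divr_gt0 //= ltr01.
have e1 : e <= 1 by rewrite ge_min lexx orbT.
have er : e <= r / 4 by rewrite ge_min lexx.
have I2 s : `|s| <= e + e -> I (t1 + s).
  move=> se; apply: Hr; rewrite /ball /= opprD addNKr normrN.
  by apply: le_lt_trans se _; move: er r0; lra.
pose K := [set t : R | `|t - t1| <= e]%classic.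
pose L t x := I t /\ orbit_map sigma x = c t.
have KI t : K t -> forall s, `|s| <= e -> I (t + s).
  move=> Kt s se; rewrite -(subrKC t1 (t + s)); apply: I2.
  by rewrite addrAC; apply: le_trans (ler_normD _ _) _; rewrite lerD.
have Lex t : I t -> exists x, L t x.
  by move=> It; have [x _ xE] := Uc t It; exists x.
have orbit_act x g : g \in G -> orbit_map sigma (act rG x g) = orbit_map sigma x.
  move=> Gg; apply/rowP => i; rewrite !mxE; apply: sigma_inv Gg _.
  exact: mem_tnth.
have Lact t x g : L t x -> g \in G -> L t (act rG x g).
  by move=> [It xE] Gg; split => //; rewrite orbit_act.
have Linv f : polyfun f -> invariant rG f ->
    exists phi, (forall t x, L t x -> f x = phi t) /\ uniform_taylor K e k phi.
  move=> [p Hp] invf; have ip : invariant_poly rG p.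
    by move=> g Gg x; rewrite -!Hp; apply: invf.
  have [q qE] := sigma_gens p ip.
  exists (fun t => meval (fun i => c t 0 i) q); split.
    move=> t x [_ xE]; rewrite Hp qE comp_mpoly_meval -xE; apply: meval_eq => i.
    by rewrite mxE.
  apply: (uniform_taylor_meval q (c := fun i t => c t 0 i) e1) => i.
  exact: class_C_uniform_taylor oI cc e0 I2 i.
have norming := orbits_norming W_irr W_sum v_in v_neq0.
have jets t x : K t -> L t x -> exists w, jet rG L t x w.
  exact: (lift_jet rG_orth e0 e1 KI Lex Lact Linv gens_inv gens_deg gens_gen v_orbit norming).
have [C C0 lip] := lift_lipschitz rG_orth e0 e1 KI Lex Linv v_orbit norming.
(* Gluing needs an open interval on which jets are known: the interior of K. *)
pose I' t := `|t - t1| < e.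
pose L' t x := I' t /\ L t x.
have I'K t : I' t -> K t by move=> h; apply: ltW.
have I'I t : I' t -> I t.
  by move=> /I'K Kt; rewrite -[t]addr0; apply: KI Kt _ _; rewrite normr0 ltW.
have [] := @local_lift_exists R gT G m rG I' L' _ _ _ _ _ t1.
- move=> t It; exists (e - `|t - t1|) => [|t' tt']; first by rewrite subr_gt0.
  rewrite /I' -(subrKA t); apply: le_lt_trans (ler_normD _ _) _.
  by rewrite -ltrBrDr.
- by move=> t It; have [x Lx] := Lex t (I'I t It); exists x.
- by move=> t x [].
- by move=> t x g [It Lx] Gg; split => //; apply: Lact.
- move=> t x [It Lx]; have [w Hw] := jets t x (I'K t It) Lx.
  exists w => eta eta0; have [d1 d10 Hd1] := Hw eta eta0.
  by exists d1 => // t' y tt' [_ Ly]; apply: Hd1.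
- by rewrite /I' subrr normr0.
move=> d1 d10 [b Hb].
pose J := [set t : R | `|t - t1| < Num.min d1 e]%classic.
have Jb t : J t -> differentiable_lift L' b t.
  by rewrite /J /= lt_min => /andP[td _]; apply: Hb.
have oJ : open J.
  rewrite (_ : J = ball t1 (Num.min d1 e)); first exact: ball_open.
  by apply/seteqP; split => t; rewrite /J /ball /= distrC.
exists J, b; split => //.
- split; first by rewrite /J /= subrr normr0 lt_min d10.
  by move=> t; rewrite /J /= lt_min => /andP[_ /I'I].
- by move=> t /Jb [[_ [_ ->]] _].
- by move=> t /Jb [_ [y /has_derivative_derivable[]]].
move=> K' _ K'J; exists (Num.sqrt (m%:R * C ^+ 2)) => t /K'J Jt.
apply: euclidean_norm_le => //.
have [[It Lt] bd] := Jb t Jt; have [y Hy] := bd.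
have [_ ->] := has_derivative_derivable Hy.
have [d2 d20 Hd2] := lip t (b t) (I'K t It) Lt.
rewrite leNgt; apply/negP => Cy.
have gap : 0 < (`|y| - C) / 2 by rewrite divr_gt0 // subr_gt0.
have [d3 d30 Hd3] := Hy _ gap.
have d22 : 0 < d2 / 2 by rewrite divr_gt0.
have [d4 d40 Hd4] := has_derivative_continuous bd d22.
have [d5 d50 Hd5] : exists2 d5 : R, 0 < d5 & forall t', `|t' - t| < d5 -> J t'.
  have /nbhs_ballP [d5 d50 Hd5] := open_nbhs_nbhs (conj oJ Jt).
  by exists d5 => // t' tt'; apply: Hd5; rewrite /ball /= distrC.
pose s := Num.min (Num.min d2 d3) (Num.min d4 d5) / 2.
have mp : 0 < Num.min (Num.min d2 d3) (Num.min d4 d5) by rewrite !lt_min d20 d30 d40.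
have s0 : 0 < s by rewrite divr_gt0.
have sm : s < Num.min (Num.min d2 d3) (Num.min d4 d5).
  by rewrite ltr_pdivrMr // ltr_pMr // ltr1n.
move: sm; rewrite !lt_min => /andP[/andP[s2 s3] /andP[s4 s5]].
have ts : t + s - t = s by rewrite addrAC subrr add0r.
have tn : `|t + s - t| = s by rewrite ts gtr0_norm.
have [[_ Lts] _] := Jb _ (Hd5 (t + s) (etrans (congr1 (fun a => a < d5) tn) s5)).
have h1 : `|b (t + s) - b t| <= C * s.
  have := Hd2 (t + s) (b (t + s)); rewrite tn => /(_ s2 Lts); apply.
  apply: le_lt_trans (Hd4 _ _) _; first by rewrite tn.
  by rewrite ltr_pdivrMr // ltr_pMr // ltr1n.
have h2 : `|b (t + s) - b t - s *: y| <= (`|y| - C) / 2 * s.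
  by have := Hd3 (t + s); rewrite tn ts => /(_ s3).
have h3 : s * `|y| <= C * s + (`|y| - C) / 2 * s.
  rewrite -{1}(gtr0_norm s0) -normrZ.
  have -> : s *: y = (b (t + s) - b t) - (b (t + s) - b t - s *: y) by rewrite subKr.
  by apply: le_trans (ler_normB _ _) _; rewrite lerD.
have : 0 < s * (`|y| - C) by rewrite mulr_gt0 // subr_gt0.
by move: h3; lra.
Qed.
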